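(* There is a deterministic parallel algorithm which, given an $n\times n$ matrix $A$ with entries $A_{ij}\in\{-1,+1\}$, finds vectors $x,y\in\{-1,+1\}^n$ with $$\sum_{i,j}A_{ij}x_iy_j\ge\bigl(\sqrt{2/\pi}-o(1)\bigr)n^{3/2},$$ using $\tilde O(n^{3.5})$ processors and polylogarithmic time.
   Context: Computational model: deterministic PRAM; $\tilde O(g)$ means at most $g\cdot\mathrm{polylog}(n,g)$. The $o(1)$ term tends to $0$ as $n\to\infty$. *)

(* Defs.v *)
From mathcomp Require Import all_boot all_order all_algebra.
From mathcomp Require Import all_classical all_reals all_analysis.

Set Implicit Arguments.
Unset Strict Implicit.
Unset Printing Implicit Defensive.

Import Order.TTheory GRing.Theory Num.Theory.
Import numFieldNormedType.Exports.

Local Open Scope ring_scope.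

(** * A word PRAM

    Synchronous processors, each with its own control and its own registers,
    run one common program on a shared memory.  The program is a fixed finite
    object: it does not depend on the input size.  All words are [b]-bit signed
    integers, with [b] logarithmic in the input size (see [word_size]), so
    unit-cost arithmetic has bounded power. *)

(** Two's complement reduction of [z] to [b] bits,
    into the interval from [- 2 ^ (b - 1)] to [2 ^ (b - 1) - 1]. *)
Definition to_word (b : nat) (z : int) : int :=
  ((z + 2 ^+ b.-1) %% (2 ^+ b))%Z - 2 ^+ b.-1.

Inductive binop := OpAdd | OpSub | OpMul | OpDiv | OpMod | OpLt | OpEq.

Definition eval_binop (o : binop) (u v : int) : int :=
  match o with
  | OpAdd => u + v
  | OpSub => u - v
  | OpMul => u * v
  | OpDiv => (u %/ v)%Z
  | OpMod => (u %% v)%Z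
  | OpLt => if u < v then 1 else 0
  | OpEq => if u == v then 1 else 0
  end.

Inductive expr :=
  | EConst of int
  | EReg of nat
  | EBin of binop & expr & expr.

Fixpoint eval_expr (b : nat) (r : nat -> int) (e : expr) : int :=
  match e with
  | EConst z => to_word b z
  | EReg i => r i
  | EBin o e1 e2 => to_word b (eval_binop o (eval_expr b r e1) (eval_expr b r e2))
  end.

(** [CFork i e] activates a new processor, a copy of the executing one except
    that register [i] of the copy holds the value of [e]. *)
Inductive cmd :=
  | CSkip
  | CAssign of nat & expr
  | CRead of nat & expr
  | CWrite of expr & expr
  | CFork of nat & expr
  | CSeq of cmd & cmd
  | CIf of expr & cmd & cmd
  | CWhile of expr & cmd.

(** [todo] is the stack of commands still to be executed; a processor halts
    when it is empty. *)
Record processor := Processor { todo : seq cmd; regs : nat -> int }.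

Record config := Config { procs : seq processor; cells : int -> int }.

Definition upd (r : nat -> int) (i : nat) (v : int) : nat -> int :=
  fun j => if j == i then v else r j.

(** One time step of a single processor.  It makes at most one access to the
    shared memory [m]; the second component is its write request, if any, as a
    pair (address, value).  The first component is the processor afterwards,
    followed by the newly activated one in the case of a fork. *)
Definition proc_step (b : nat) (m : int -> int) (p : processor) :
    seq processor * option (int * int) :=
  let r := regs p in
  match todo p with
  | [::] => ([:: p], None)
  | c :: k =>
    match c with
    | CSkip => ([:: Processor k r], None)
    | CAssign i e => ([:: Processor k (upd r i (eval_expr b r e))], None)
    | CRead i e => ([:: Processor k (upd r i (m (eval_expr b r e)))], None)
    | CWrite a e => ([:: Processor k r], Some (eval_expr b r a, eval_expr b r e))
    | CFork i e =>
        ([:: Processor k r; Processor k (upd r i (eval_expr b r e))], None)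
    | CSeq c1 c2 => ([:: Processor [:: c1, c2 & k] r], None)
    | CIf e c1 c2 =>
        ([:: Processor ((if eval_expr b r e != 0 then c1 else c2) :: k) r], None)
    | CWhile e c1 =>
        ([:: Processor (if eval_expr b r e != 0 then [:: c1, c & k] else k) r], None)
    end
  end.

(** Concurrent writes to one cell are resolved by priority: the processor that
    comes first in the list wins. *)
Definition commit (ws : seq (int * int)) (m : int -> int) : int -> int :=
  fun a => foldr (fun w v => if w.1 == a then w.2 else v) (m a) ws.

(** All processors move simultaneously; reads see the memory as it was before
    the writes of the same step. *)
Definition step (b : nat) (s : config) : config :=
  let out := [seq proc_step b (cells s) p | p <- procs s] in
  Config (flatten [seq o.1 | o <- out])
         (commit (pmap (fun o => o.2) out) (cells s)).

Definition run (b t : nat) (s : config) : config := iter t (step b) s.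

Definition halted (s : config) : bool := all (fun p => nilp (todo p)) (procs s).

(** Processors are never removed, so this is the number of processors activated
    so far, whether still running or not. *)
Definition nprocs (s : config) : nat := size (procs s).

(** [O(log n)] bits.  For every [c] this suffices to represent [n] itself and
    the entries 1 and -1. *)
Definition word_size (c n : nat) : nat := (c.+1 * (trunc_log 2 n).+2)%N.

(** Initially a single processor is active, with [n] in register 0; cell
    [i * n + j] of the shared memory holds [A i j]; everything else is 0. *)
Definition input_mem (n : nat) (A : 'M[int]_n) (a : int) : int :=
  \sum_(i < n) \sum_(j < n) (if a == (i * n + j)%N%:Z then A i j else 0).

Definition init (prog : cmd) (n : nat) (A : 'M[int]_n) : config :=
  Config [:: Processor [:: prog] (fun i => if i == 0%N then n%:Z else 0)]
         (input_mem A).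

(** The output vectors [x] and [y] are read off the cells following the
    input: [x] starts at cell [n * n] and [y] at cell [n * n + n]. *)
Definition output_x (n : nat) (s : config) : 'cV[int]_n :=
  \col_i cells s (n * n + i)%N%:Z.

Definition output_y (n : nat) (s : config) : 'cV[int]_n :=
  \col_j cells s (n * n + n + j)%N%:Z.

Definition pm1_matrix (m n : nat) (A : 'M[int]_(m, n)) : Prop :=
  forall i j, A i j = 1 \/ A i j = -1.

Definition bilinear_value (n : nat) (A : 'M[int]_n) (x y : 'cV[int]_n) : int :=
  \sum_(i < n) \sum_(j < n) A i j * x i 0 * y j 0.

(** * Growth rates *)

(** [f n <= g n * polylog (n, g n)] for all [n > 0].  Adding 1 to the
    logarithms only serves the arguments where they vanish. *)
Definition soft_O (R : realType) (f : nat -> nat) (g : nat -> R) : Prop :=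
  exists c k : nat, forall n : nat, (0 < n)%N ->
    (f n)%:R <= g n * (c%:R * (1 + `|ln n%:R| + `|ln (g n)|) ^+ k).

Definition polylogarithmic (f : nat -> nat) : Prop :=
  exists c k : nat, forall n : nat, (0 < n)%N ->
    (f n <= c * (trunc_log 2 n).+1 ^ k)%N.

(* Main.v *)
(** Choose [y] and let [x] be the signs of the row sums of [A y].  Split the
    columns into [K] residue classes, [K] a power of two of order [log n].  If
    [L_p] is the signed sum of class [p] in a row and the [L_p] get independent
    random signs [u_p], then [E |\sum_p u_p L_p|] is close to
    [sqrt (2 V / pi)], [V = \sum_p L_p ^ 2], as soon as no [L_p] dominates: by
    Lindeberg replacement [u_p L_p] may be exchanged for a simple random walk of
    [L_p ^ 2] steps, and the expected modulus of a walk of [V] steps is a central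
    binomial coefficient.  The [2 ^ K <= 2 n] patterns [u] are searched
    exhaustively.

    The signs inside the classes have to make [V] close to [n] and
    [\sum_p L_p ^ 4] of order [n ^ 2 / K] in the average row.  They are found by
    halving the number of columns [log n] times: column [c + H] is added to column
    [c < H] with a Walsh sign [walsh l a (c + H)].  These signs are pairwise
    independent in the seed [a], which is all that the conditional expectation of
    [(V - n) ^ 2 + \sum_p L_p ^ 4] (see [potential]) depends on, so that its
    average over the [O(n)] seeds does not change and the best seed does not
    increase it.  Each round takes [O(n ^ 3 log n)] operations. *)

Require Import Defs.
From mathcomp Require Import all_boot all_order all_algebra.
From mathcomp Require Import all_classical all_reals all_analysis.
From mathcomp Require Import ring lra zify.

Set Implicit Arguments.
Unset Strict Implicit.
Unset Printing Implicit Defensive.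

Import Order.TTheory GRing.Theory Num.Theory.
Import numFieldNormedType.Exports.

Local Open Scope ring_scope.

(** * Rademacher averages *)

(** One trade-off fixes the exponents. Smoothing the modulus at scale [sqrt n / q] costs about
    [sqrt n / q]; the third-order error is controlled only through fourth powers, at the price
    [q ^ 6 / n ^ (3/2)] per unit of [(V - n) ^ 2 + \sum_p L_p ^ 4]. This quantity is at most
    [6 n ^ 2 / K] in the average row, so [q = K ^ (1/8)] makes both losses [o(sqrt n)]. The
    coefficients 5 and 4 of the potential arise because in a class of energy [C] and fourth-power
    sum [Q] independent signs give [Var (L ^ 2) = 2 (C ^ 2 - Q)] and [E L ^ 4 = 3 C ^ 2 - 2 Q]. One
    round needs only pairwise independence: as [e ^ 2 = 1], the square of a merged entry is affine
    in its sign [e], so the potential is quadratic in the signs of the round. On the machine the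
    obstacle is that each processor has its own control. The program therefore never branches on
    data: loop guards agree on all processors and conditional writes are diverted to a dump cell, so
    a configuration is one command stack plus registers indexed by processor. Words wrap around,
    which ring operations tolerate; only divisions and comparisons need true values. *)

Definition symavg (R : realFieldType) (c : R) (f : R -> R) (z : R) : R :=
  (f (z + c) + f (z - c)) / 2.

Fixpoint rademacher (R : realFieldType) (s : seq R) (f : R -> R) : R -> R :=
  if s is c :: s' then symavg c (rademacher s' f) else f.

Definition walk (R : realFieldType) (t : nat) (f : R -> R) : R -> R :=
  iter t (symavg 1) f.

Lemma symavg_le (R : realFieldType) (c : R) (f g : R -> R) (z : R) :
  (forall x, f x <= g x) -> symavg c f z <= symavg c g z.
Proof.
move=> fg; rewrite /symavg; have := fg (z + c); have := fg (z - c); lra.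
Qed.

Lemma rademacher_le (R : realFieldType) (s : seq R) (f g : R -> R) :
  (forall x, f x <= g x) -> forall z, rademacher s f z <= rademacher s g z.
Proof. by elim: s => [|c s IH] fg z //=; apply/symavg_le/IH. Qed.

Lemma rademacher_affine (R : realFieldType) (s : seq R) (f : R -> R) (a b : R) z :
  rademacher s (fun x => a * f x + b) z = a * rademacher s f z + b.
Proof.
by elim: s z => [|c s IH] z //=; rewrite /symavg !IH; field.
Qed.

Lemma walk_rademacher (R : realFieldType) t (f : R -> R) :
  walk t f = rademacher (nseq t 1) f.
Proof. by elim: t => [|t IH] //=; rewrite -IH. Qed.

Lemma walkS (R : realFieldType) t (f : R -> R) :
  walk t.+1 f = symavg 1 (walk t f).
Proof. by []. Qed.

Lemma walkD (R : realFieldType) t u (f : R -> R) :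
  walk (t + u) f = walk t (walk u f).
Proof. exact: iterD. Qed.

Lemma walk_le (R : realFieldType) t (f g : R -> R) :
  (forall x, f x <= g x) -> forall z, walk t f z <= walk t g z.
Proof. by rewrite !walk_rademacher; apply: rademacher_le. Qed.

Lemma walk_affine (R : realFieldType) t (f : R -> R) (a b : R) z :
  walk t (fun x => a * f x + b) z = a * walk t f z + b.
Proof. by rewrite !walk_rademacher rademacher_affine. Qed.

(** Independent increments commute. The Lindeberg argument uses this to exchange one term while the
    others are already unit steps. *)
Lemma symavg_walkC (R : realFieldType) t (c : R) (f : R -> R) z :
  symavg c (walk t f) z = walk t (symavg c f) z.
Proof.
elim: t z => [|t IH] z //.
rewrite !walkS [RHS]/symavg -!IH /symavg.
by rewrite !(addrAC z 1) !(addrAC z (- 1)); field.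
Qed.

(** The displacement [S] after [t] steps has [E S ^ 2 = t] and [E S ^ 4 = 3 t ^ 2 - 2 t]. Quartics
    without cubic term suffice to enclose the spline between its Taylor bounds. *)
Lemma walk_quartic (R : realFieldType) t (c0 c1 c2 c4 z0 z : R) :
  walk t (fun x => c0 + c1 * (x - z0) + c2 * (x - z0) ^+ 2 + c4 * (x - z0) ^+ 4) z
  = c0 + c1 * (z - z0) + c2 * ((z - z0) ^+ 2 + t%:R)
    + c4 * ((z - z0) ^+ 4 + 6 * t%:R * (z - z0) ^+ 2 + 3 * t%:R ^+ 2 - 2 * t%:R).
Proof.
elim: t z => [|t IH] z; first by rewrite /walk /=; ring.
by rewrite walkS /symavg !IH -natr1; field.
Qed.

(** * The cubic spline *)

(* Divided by [3 * a ^+ 2], this is a [C^2] smoothing of the absolute value at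
   scale [a]. *)
Definition spline (R : realFieldType) (a x : R) : R :=
  (`|x + a| ^+ 3 + `|x - a| ^+ 3) / 2 - `|x| ^+ 3.

(** This second difference of [|x| ^ 3] is exactly [3 a ^ 2 |x|] away from the origin. The
    correcting bump lives on [|x| < a] and stays between 0 and [a ^ 3], which gives the two bounds
    that follow. *)
Lemma splineE (R : realFieldType) (a x : R) : 0 <= a ->
  spline a x = 3 * a ^+ 2 * `|x| + Num.max 0 (a - `|x|) ^+ 3.
Proof.
move=> a0; wlog x0 : x / 0 <= x.
  move=> H; have [/H //|x0] := lerP 0 x.
  have := H (- x); rewrite /spline normrN => <-; last lra.
  by rewrite -(normrN (- x + a)) -(normrN (- x - a)) !opprD !opprK (addrC (`|x - a| ^+ 3)).
rewrite /spline (ger0_norm x0) (ger0_norm (addr_ge0 x0 a0)).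
have [xa|xa] := lerP x a.
  by rewrite max_r ?subr_ge0 //; field.
by rewrite max_l ?subr_le0 ?ltW //; field.
Qed.

Lemma spline_ge (R : realFieldType) (a x : R) :
  0 <= a -> 3 * a ^+ 2 * `|x| <= spline a x.
Proof. by move=> a0; rewrite splineE // lerDl exprn_ge0 // le_max lexx. Qed.

Lemma spline_le (R : realFieldType) (a x : R) :
  0 <= a -> spline a x <= 3 * a ^+ 2 * `|x| + a ^+ 3.
Proof.
move=> a0; rewrite splineE // lerD2l lerXn2r ?nnegrE ?le_max ?lexx //.
by rewrite ge_max a0 gerBl normr_ge0.
Qed.

(** The second derivative [6 |x|] is 6-Lipschitz, so the remainder constant is [6 / 3! = 1]. *)
Lemma norm_cube_taylor (R : realFieldType) (x d : R) :
  `| `|x + d| ^+ 3 - (`|x| ^+ 3 + 3 * x * `|x| * d + 3 * `|x| * d ^+ 2) |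
    <= `|d| ^+ 3.
Proof.
have D3 : 0 <= `|d| ^+ 3 by rewrite exprn_ge0.
wlog x0 : x d D3 / 0 <= x.
  move=> H; have [/H|x0] := lerP 0 x; first exact.
  have := H (- x) (- d); rewrite -opprD !normrN; move=> /(_ D3).
  have -> : 3 * - x * `|x| * - d = 3 * x * `|x| * d by ring.
  by rewrite sqrrN; apply; lra.
rewrite (ger0_norm x0); have [xd|xd] := lerP 0 (x + d).
  by rewrite (ger0_norm xd) (_ : _ - _ = d ^+ 3) ?normrX //; ring.
have d0 : d < 0 by lra.
rewrite (ltr0_norm xd) (ltr0_norm d0) ler_norml; apply/andP; split.
  have : 0 <= (- (x + d)) ^+ 3 by rewrite exprn_ge0 //; lra.
  nra.
have : (- (x + d)) ^+ 3 <= (- d) ^+ 3 by apply: lerXn2r; rewrite ?nnegrE; lra.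
nra.
Qed.

(** The two half-weighted shifted cubes contribute 1 to the remainder constant and the central cube
    another 1. The coefficients stay abstract: they cancel between two laws with equal mean and
    variance. *)
Lemma spline_taylor (R : realFieldType) (a x : R) : exists d1 d2 : R,
  forall d, `|spline a (x + d) - (spline a x + d1 * d + d2 * d ^+ 2)| <= 2 * `|d| ^+ 3.
Proof.
pose g (y : R) := 3 * y * `|y|; pose h (y : R) : R := 3 * `|y|.
exists ((g (x + a) + g (x - a)) / 2 - g x), ((h (x + a) + h (x - a)) / 2 - h x).
move=> d.
have := norm_cube_taylor (x + a) d; have := norm_cube_taylor (x - a) d.
have := norm_cube_taylor x d.
rewrite /spline /g /h (addrAC x d a) (addrAC x d (- a)) !ler_norml.
move=> /andP[? ?] /andP[? ?] /andP[? ?]; apply/andP; split; lra.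
Qed.

(** The third absolute moment of a walk is not polynomial in its length; AM-GM, that is
    [(|d| - m) ^ 2 >= 0], trades it for the second and fourth moments. *)
Lemma norm_cube_le (R : realFieldType) (m d : R) : 0 < m ->
  `|d| ^+ 3 <= (m^-1 * d ^+ 4 + m * d ^+ 2) / 2.
Proof.
move=> m0; have mi : m^-1 * m = 1 by rewrite mulVf ?gt_eqF.
have -> : d ^+ 4 = `|d| ^+ 4 by rewrite -normrX ger0_norm // (exprM d 2 2) sqr_ge0.
have -> : d ^+ 2 = `|d| ^+ 2 by rewrite -normrX ger0_norm // sqr_ge0.
have : 0 <= m^-1 * `|d| ^+ 2 * (`|d| - m) ^+ 2.
  by rewrite mulr_ge0 ?sqr_ge0 // mulr_ge0 ?sqr_ge0 // invr_ge0 ltW.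
have -> : m^-1 * `|d| ^+ 2 * (`|d| - m) ^+ 2
   = m^-1 * `|d| ^+ 4 - 2 * (m^-1 * m) * `|d| ^+ 3 + (m^-1 * m) * m * `|d| ^+ 2 by ring.
by rewrite mi; move: m^-1; intros; lra.
Qed.

(* The walk of [m ^ 2] unit steps and a single step of length [m] have the same
   variance, so only the third-order terms of the spline contribute. *)
Lemma spline_walk (R : realFieldType) (a : R) (m : nat) (z : R) :
  `|symavg m%:R (spline a) z - walk (m ^ 2) (spline a) z| <= 6 * m%:R ^+ 3.
Proof.
case: m => [|m].
  by rewrite /symavg /walk /= addr0 subr0 ler_norml; apply/andP; split; lra.
set M : R := m.+1%:R; have M0 : 0 < M by rewrite ltr0n.
have [d1 [d2 Ht]] := spline_taylor a z.
have MM : (m.+1 ^ 2)%:R = M ^+ 2 :> R by rewrite natrX.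
have Mi : M^-1 * M = 1 by rewrite mulVf ?gt_eqF.
have cube_le d := norm_cube_le d M0.
clearbody M.
have step : `|symavg M (spline a) z - (spline a z + d2 * M ^+ 2)| <= 2 * M ^+ 3.
  have := Ht M; have := Ht (- M); rewrite normrN sqrrN (gtr0_norm M0) !ler_norml.
  by rewrite /symavg => /andP[? ?] /andP[? ?]; apply/andP; split; lra.
(* [e] is 1 for the majorant and -1 for the minorant. The correction is
   [M^-1 * (3 M ^ 4 - 2 M ^ 2) + M * M ^ 2], from the fourth and second moments after [M ^ 2] steps;
   with the [2 M ^ 3] of the single step the total stays below [6 M ^ 3]. *)
have bound (e : R) : walk (m.+1 ^ 2) (fun x => spline a z + d1 * (x - z) +
     (d2 + e * M) * (x - z) ^+ 2 + (e * M^-1) * (x - z) ^+ 4) z =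
   spline a z + d2 * M ^+ 2 + e * (4 * M ^+ 3 - 2 * M).
  rewrite walk_quartic subrr MM !expr0n /= mulr0 addr0 !add0r mulr0 add0r.
  have -> : e / M * (3 * M ^+ 2 ^+ 2 - 2 * M ^+ 2)
    = e * (M^-1 * M) * (3 * M ^+ 3 - 2 * M) by ring.
  by rewrite Mi; ring.
have up : walk (m.+1 ^ 2) (spline a) z <= spline a z + d2 * M ^+ 2 + 4 * M ^+ 3.
  apply: (le_trans (y := spline a z + d2 * M ^+ 2 + 1 * (4 * M ^+ 3 - 2 * M))); last lra.
  rewrite -bound; apply: walk_le => x.
  have := Ht (x - z); rewrite (addrC z (x - z)) subrK ler_norml => /andP[_ H].
  have := cube_le (x - z); lra.
have lo : spline a z + d2 * M ^+ 2 - 4 * M ^+ 3 <= walk (m.+1 ^ 2) (spline a) z.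
  apply: (le_trans (y := spline a z + d2 * M ^+ 2 + -1 * (4 * M ^+ 3 - 2 * M))); first lra.
  rewrite -bound; apply: walk_le => x.
  have := Ht (x - z); rewrite (addrC z (x - z)) subrK ler_norml => /andP[H _].
  have := cube_le (x - z); lra.
by move: step; rewrite !ler_norml => /andP[? ?]; apply/andP; split; lra.
Qed.

Lemma spline_lindeberg (R : realFieldType) (a : R) (s : seq nat) (z : R) :
  `|rademacher [seq m%:R | m <- s] (spline a) z
    - walk (\sum_(m <- s) m ^ 2) (spline a) z|
    <= 6 * (\sum_(m <- s) m ^ 3)%:R.
Proof.
elim: s z => [|m s IH] z.
  by rewrite !big_nil /walk /= subrr normr0 mulr0.
rewrite !big_cons /= addnC walkD natrD.
set V := (\sum_(j <- s) j ^ 2)%N in IH *.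
set f := rademacher _ _ in IH *.
have H1 : `|symavg m%:R f z - symavg m%:R (walk V (spline a)) z|
    <= 6 * (\sum_(m <- s) m ^ 3)%:R.
  have := IH (z + m%:R); have := IH (z - m%:R); rewrite !ler_norml /symavg.
  by move=> /andP[? ?] /andP[? ?]; apply/andP; split; lra.
have H2 : `|walk V (symavg m%:R (spline a)) z - walk V (walk (m ^ 2) (spline a)) z|
    <= 6 * (m ^ 3)%:R.
  have B x := spline_walk a m x.
  rewrite natrX ler_norml; apply/andP; split.
    rewrite lerBrDr addrC -[X in X - _]mul1r -walk_affine; apply: walk_le => x.
    by move: (B x); rewrite ler_norml => /andP[? _]; lra.
  rewrite lerBlDr addrC -[X in X + _]mul1r -walk_affine; apply: walk_le => x.
  by move: (B x); rewrite ler_norml => /andP[_ ?]; lra.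
move: H1 H2; rewrite symavg_walkC !ler_norml.
by move=> /andP[? ?] /andP[? ?]; apply/andP; split; lra.
Qed.

(** The spline exceeds [3 a ^ 2 |x|] by at most [a ^ 3]. Division by [3 a ^ 2] turns this gap into
    [a / 3] and the Lindeberg constant 6 into [2 / a ^ 2]. *)
Theorem rademacher_lower (R : realFieldType) (a : R) (s : seq nat) : 0 < a ->
  walk (\sum_(m <- s) m ^ 2) Num.norm 0 - a / 3
    - 2 * (\sum_(m <- s) m ^ 3)%:R / a ^+ 2
  <= rademacher [seq m%:R | m <- s] Num.norm 0.
Proof.
move=> a0.
have H := spline_lindeberg a s 0.
have H1 : 3 * a ^+ 2 * walk (\sum_(m <- s) m ^ 2) Num.norm 0
    <= walk (\sum_(m <- s) m ^ 2) (spline a) 0.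
  rewrite -[X in X <= _]addr0 -walk_affine; apply: walk_le => x.
  by rewrite addr0 spline_ge // ltW.
have H2 : rademacher [seq m%:R | m <- s] (spline a) 0
    <= 3 * a ^+ 2 * rademacher [seq m%:R | m <- s] Num.norm 0 + a ^+ 3.
  rewrite -rademacher_affine; apply: rademacher_le => x.
  by rewrite spline_le // ltW.
have a2 : 0 < a ^+ 2 by rewrite exprn_gt0.
rewrite -(ler_pM2l (x := 3 * a ^+ 2)) ?mulr_gt0 //.
set S := (\sum_(m <- s) m ^ 3)%:R in H *.
have -> : forall w : R, 3 * a ^+ 2 * (w - a / 3 - 2 * S / a ^+ 2)
  = 3 * a ^+ 2 * w - a ^+ 3 - 6 * S.
  by move=> w; field; rewrite gt_eqF.
by move: H; rewrite ler_norml => /andP[? ?]; lra.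
Qed.

(** * The simple random walk *)

Lemma walk_binomial (R : realFieldType) t (f : R -> R) z :
  2 ^+ t * walk t f z = \sum_(j < t.+1) 'C(t, j)%:R * f (z + t%:R - 2 * j%:R).
Proof.
elim: t z => [|t IH] z.
  by rewrite big_ord1 /walk /= bin0 expr0 !mul1r mulr0 subr0 addr0.
rewrite walkS /symavg.
have -> : 2 ^+ t.+1 * ((walk t f (z + 1) + walk t f (z - 1)) / 2)
  = 2 ^+ t * walk t f (z + 1) + 2 ^+ t * walk t f (z - 1) by rewrite exprS; field.
rewrite !IH [RHS]big_ord_recl /= bin0.
rewrite [in RHS](eq_bigr (fun i : 'I_t.+1 =>
   'C(t, i.+1)%:R * f (z + 1 + t%:R - 2 * i.+1%:R)
   + 'C(t, i)%:R * f (z - 1 + t%:R - 2 * i%:R))); last first.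
  move=> i _; rewrite /bump /= binS natrD mulrDl; congr (_ * f _ + _ * f _).
    by rewrite -[t.+1%:R]natr1; ring.
  by rewrite -[t.+1%:R]natr1 -[(1 + i)%:R]natr1; ring.
rewrite big_split /= addrA; congr (_ + _).
rewrite [in RHS]big_ord_recr /= bin_small // mul0r addr0 big_ord_recl bin0.
congr (_ * f _ + _).
by rewrite -natr1 /=; ring.
Qed.

(** The probability that the simple random walk is back at its origin after [2 k] steps. *)
Definition central (R : realFieldType) (k : nat) : R := 'C(k.*2, k)%:R / 4 ^+ k.

Lemma central0 (R : realFieldType) : central R 0 = 1.
Proof. by rewrite /central bin0 expr0 divr1. Qed.

Lemma centralS (R : realFieldType) k :
  central R k.+1 * (2 * k%:R + 2) = central R k * (2 * k%:R + 1).
Proof.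
have H : ('C(k.+1.*2, k.+1) * k.+1 = 2 * (k.*2.+1 * 'C(k.*2, k)))%N.
  have h1 := mul_bin_diag k.*2.+2 k.
  have h2 := mul_bin_down k.*2.+1 k.
  rewrite /= (_ : k.*2.+1 - k = k.+1)%N in h2; last by lia.
  by rewrite h2 mulnC doubleS -h1 /=; lia.
have HR : 'C(k.+1.*2, k.+1)%:R * (k%:R + 1) = 2 * ((2 * k%:R + 1) * 'C(k.*2, k)%:R) :> R.
  have := congr1 (fun n => n%:R : R) H; rewrite !natrM -natr1 => ->.
  by rewrite -[k.*2.+1%:R]natr1 -mul2n natrM.
rewrite /central exprS -mulrA (mulrC _ (2 * _ + 2)) mulrA.
have -> : 'C(k.+1.*2, k.+1)%:R * (2 * k%:R + 2) = 2 * ('C(k.+1.*2, k.+1)%:R * (k%:R + 1)) :> R.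
  by ring.
by rewrite HR; field; rewrite expf_neq0.
Qed.

Lemma central_gt0 (R : realFieldType) k : 0 < central R k.
Proof.
by rewrite /central divr_gt0 ?exprn_gt0 // ltr0n bin_gt0 -addnn leq_addr.
Qed.

(** Discrete Tanaka formula: one more step leaves the mean of [|x|] unchanged at a nonzero integer
    and raises it from 0 to 1 at the origin, so the increment is the return probability. *)
Lemma walk_normS (R : realFieldType) t :
  walk t.+1 Num.norm 0
  = walk t Num.norm 0 + (if odd t then 0 else central R t./2).
Proof.
have T2 : (2 : R) ^+ t != 0 by rewrite expf_neq0.
apply: (mulfI T2); rewrite {1}/walk iterSr -/(walk t _) mulrDr !walk_binomial.
apply/eqP; rewrite -subr_eq0 opprD addrA -sumrB; apply/eqP.
rewrite (eq_bigr (fun j : 'I_t.+1 => if j.*2 == t then 'C(t, j)%:R else 0)).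
  have [ot|et] := boolP (odd t).
    rewrite mulr0 subr0 big1 // => i _; case: eqP => // E.
    by have := odd_double i; rewrite E ot.
  have t2 : (t./2).*2 = t by rewrite even_halfK.
  have H : (t./2 < t.+1)%N by lia.
  rewrite (bigD1 (Ordinal H)) //= t2 eqxx big1 => [|i ni].
    rewrite addr0 /central t2 [X in _ * (_ / X)](_ : _ = 2 ^+ t).
      by rewrite mulrC divfK ?subrr.
    by rewrite -[in RHS]t2 -mul2n exprM; congr (_ ^+ _); rewrite expr2 -natrM.
  case: eqP => // E; case/eqP: ni; apply: val_inj => /=; lia.
move=> i _; rewrite -mulrBr add0r /symavg.
case: eqP => E.
  have -> : t%:R - 2 * i%:R = 0 :> R by rewrite -natrM mul2n E subrr.
  by rewrite add0r sub0r normrN normr0 normr1; field.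
suff -> : (`|t%:R - 2 * i%:R + 1| + `|t%:R - 2 * i%:R - 1|) / 2 - `|t%:R - 2 * i%:R| = 0 :> R.
  by rewrite mulr0.
have [lt|le] := ltnP i.*2 t.
  have : (i.*2.+1)%:R <= t%:R :> R by rewrite ler_nat.
  rewrite -natr1 -mul2n natrM => le.
  by rewrite !ger0_norm; try lra; field.
have : (t.+1)%:R <= (i.*2)%:R :> R by rewrite ler_nat; lia.
rewrite -natr1 -mul2n natrM => ge.
by rewrite !ler0_norm; try lra; field.
Qed.

Lemma walk_norm_even (R : realFieldType) k :
  walk k.*2 Num.norm 0 = 2 * k%:R * central R k.
Proof.
elim: k => [|k IH]; first by rewrite /walk /= normr0 mulr0 mul0r.
rewrite doubleS !walk_normS /= odd_double /= addr0 doubleK IH.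
by rewrite -[k.+1%:R]natr1 mulrDr mulr1 [RHS]mulrC centralS; ring.
Qed.

Lemma walk_norm_odd (R : realFieldType) k :
  walk k.*2.+1 Num.norm 0 = (2 * k%:R + 1) * central R k.
Proof. by rewrite walk_normS odd_double doubleK walk_norm_even; ring. Qed.

(** * Wallis integrals and the asymptotics of the walk *)

(** The primitive of [sin ^+ m] that vanishes at 0, by the reduction formula. With it the Wallis
    comparison needs derivatives and monotonicity but no integral. *)
Fixpoint sin_primitive (R : realType) (m : nat) : R -> R :=
  match m with
  | 0 => id
  | 1 => fun x => 1 - cos x
  | k.+2 => fun x =>
      ((k.+1)%:R * @sin_primitive R k x - sin x ^+ k.+1 * cos x) / (k.+2)%:R
  end.

Lemma is_derive_sin_primitive (R : realType) m (x : R) :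
  is_derive x 1 (@sin_primitive R m) (sin x ^+ m).
Proof.
elim/ltn_ind: m => -[|[|m]] IH.
- by rewrite expr0; exact: is_derive_id.
- by apply: is_derive_eq; rewrite expr1; ring.
have H := IH m (ltnW (ltnSn m.+1)).
have -> : @sin_primitive R m.+2 = (m.+2%:R^-1 : R) *:
    ((m.+1%:R : R) *: (@sin_primitive R m) - (@sin R) ^+ m.+1 * (@cos R)).
  by apply/funext => y /=; rewrite mulrC exprfctE.
apply: is_derive_eq; rewrite exprfctE /GRing.scale /=.
have c2 : cos x * cos x = 1 - sin x * sin x.
  by have := cos2Dsin2 x; rewrite !expr2 => /(canRL (addrK _)).
rewrite -mulr_natl !exprS -[m.+2%:R]natr1 -[m.+1%:R]natr1.
transitivity ((m%:R + 1 + 1)^-1 * ((m%:R + 1) * sin x ^+ m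
   + sin x * sin x ^+ m * sin x - (m%:R + 1) * sin x ^+ m * (cos x * cos x))); first by rewrite mulr1; ring.
rewrite c2; field.
by apply: lt0r_neq0; have := ler0n R m; lra.
Qed.

Lemma sin_primitive_at0 (R : realType) m : @sin_primitive R m 0 = 0.
Proof.
elim/ltn_ind: m => -[|[|m]] IH //=; first by rewrite cos0 subrr.
by rewrite (IH m (ltnW (ltnSn _))) sin0 exprS !mul0r mulr0 subr0 mul0r.
Qed.

(** At [pi / 2] the boundary term of the reduction formula vanishes and the factor
    [(m + 1) / (m + 2)] remains; this is the recurrence of [central] for even [m] and of its
    reciprocal, up to [2 k + 1], for odd [m]. *)
Lemma sin_primitive_pihalf (R : realType) k :
  sin_primitive k.*2 (pi / 2) = pi / 2 * central R k /\
  (2 * k%:R + 1) * central R k * sin_primitive k.*2.+1 (pi / 2) = 1.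
Proof.
elim: k => [|k [IHe IHo]].
  by rewrite /= cos_pihalf central0; split; ring.
have E m : @sin_primitive R m.+2 (pi / 2)
    = m.+1%:R / m.+2%:R * @sin_primitive R m (pi / 2).
  by rewrite /= cos_pihalf mulr0 subr0 mulrAC.
have k2 : (k.*2)%:R = 2 * k%:R :> R by rewrite -mul2n natrM.
have k0 : 0 <= k%:R :> R by [].
have cS := centralS R k.
rewrite doubleS !E IHe -[k.*2.+3%:R]natr1 -[k.*2.+2%:R]natr1 -[k.*2.+1%:R]natr1 k2.
rewrite -[k.+1%:R]natr1; split.
  apply: (mulIf (x := 2 * k%:R + 1 + 1)); first by rewrite gt_eqF //; lra.
  rewrite mulrAC divfK; last by rewrite gt_eqF //; lra.
  transitivity (pi / 2 * (central R k * (2 * k%:R + 1))); first by ring.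
  by rewrite -cS; ring.
rewrite -[RHS]IHo; transitivity
   (central R k.+1 * (2 * k%:R + 2) * @sin_primitive R k.*2.+1 (pi / 2)).
  field; lra.
by rewrite cS; ring.
Qed.

(* Wallis: the integral of [sin ^+ k.*2.+1] over [0, pi / 2] is at most that of
   [sin ^+ k.*2]. *)
Lemma central_lower (R : realType) k :
  2 / pi <= central R k ^+ 2 * (2 * k%:R + 1).
Proof.
have [He Ho] := sin_primitive_pihalf R k.
have c0 := central_gt0 R k; have p0 := @pi_gt0 R.
have k0 : 0 <= k%:R :> R by [].
suff le : sin_primitive k.*2.+1 (pi / 2) <= sin_primitive k.*2 (pi / 2) :> R.
  have : 0 < (2 * k%:R + 1) * central R k by rewrite mulr_gt0 //; lra.
  move=> /(ler_pM2l) /(_ _ _) /esym; move: le => /[swap] ->; rewrite Ho He => H.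
  rewrite ler_pdivrMr //; nra.
pose F : R -> R := @sin_primitive R k.*2 - @sin_primitive R k.*2.+1.
have dF (x : R) : is_derive x 1 F (sin x ^+ k.*2 - sin x ^+ k.*2.+1).
  have := is_derive_sin_primitive k.*2 x.
  have := is_derive_sin_primitive k.*2.+1 x.
  by move=> *; apply: is_derive_eq.
suff : F 0 <= F (pi / 2).
  by rewrite /F !fctE !sin_primitive_at0 subrr subr_ge0.
apply: (@ger0_derive1_ndecr R F 0 (pi / 2)) => //; last by lra.
- move=> x _; rewrite derive1E (@derive_val _ _ _ _ _ _ _ (dF x)).
  rewrite (_ : _ - _ = (1 - sin x) * sin x ^+ k.*2); last by rewrite exprS; ring.
  by rewrite mulr_ge0 ?subr_ge0 ?sin_le1 // -mul2n exprM exprn_ge0 ?sqr_ge0.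
- by apply: derivable_within_continuous => x _; case: (dF x).
Qed.

(** For odd [t] the bound holds without the [- 1]. For even [t] the value is
    [(s ^ 2 - 1) * central R k] with [s ^ 2 = t + 1], and [s - s^-1 >= s - 1] absorbs the
    difference. *)
Lemma walk_norm_lower (R : realType) t :
  Num.sqrt (2 / pi) * (Num.sqrt t%:R - 1) <= walk t Num.norm 0 :> R.
Proof.
have p0 := @pi_gt0 R.
have cl k : Num.sqrt (2 / pi) / Num.sqrt (2 * k%:R + 1) <= central R k.
  have k0 : 0 < 2 * k%:R + 1 :> R by rewrite ltr_wpDl // mulr_ge0.
  have pi2 : 0 <= 2 / pi :> R by rewrite divr_ge0 // ltW.
  rewrite -sqrtrV; last exact: ltW.
  rewrite -sqrtrM // -[leRHS](ger0_norm (ltW (central_gt0 R k))) -sqrtr_sqr.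
  by rewrite ler_sqrt ?sqr_ge0 // ler_pdivrMr // central_lower.
have odd_form k : (k.*2.+1)%:R = 2 * k%:R + 1 :> R by rewrite -natr1 -mul2n natrM.
have c0 : 0 <= Num.sqrt (2 / pi) :> R by rewrite sqrtr_ge0.
rewrite -[t]odd_double_half; set k := t./2.
pose s : R := Num.sqrt (2 * k%:R + 1).
have s1 : 1 <= s by rewrite -[leLHS]sqrtr1 ler_sqrt ?ler_wpDl ?mulr_ge0 // addr_ge0 ?mulr_ge0.
have ss : 2 * k%:R + 1 = s * s by rewrite -expr2 sqr_sqrtr // addr_ge0 ?mulr_ge0.
have {}cl : Num.sqrt (2 / pi) <= central R k * s.
  by rewrite -ler_pdivrMr ?cl //; lra.
have cs0 := central_gt0 R k.
case: (odd t); rewrite ?add1n ?add0n.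
  rewrite odd_form walk_norm_odd -/s ss; nra.
have se : Num.sqrt (k.*2)%:R <= s.
  by rewrite ler_sqrt ?addr_ge0 ?mulr_ge0 // -mul2n natrM lerDl.
rewrite walk_norm_even (_ : 2 * k%:R = s * s - 1); last by rewrite -ss addrK.
apply: (le_trans (y := Num.sqrt (2 / pi) * (s - 1))); first by rewrite ler_wpM2l // lerD2r.
nra.
Qed.

(** * Walsh functions *)

(** The character [(-1) ^ <a, x>] of the group of [l]-bit vectors. Recursion on the lowest bit is
    the order in which the program consumes the bits. *)
Fixpoint walsh (l a x : nat) : int :=
  if l is l'.+1 then
    (if odd a && odd x then -1 else 1) * walsh l' a./2 x./2
  else 1.

Lemma sum_parity (V : nmodType) m (F : nat -> V) :
  \sum_(a < m.*2) F a = \sum_(a < m) (F a.*2 + F a.*2.+1).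
Proof.
elim: m => [|m IH]; first by rewrite !big_ord0.
by rewrite doubleS !big_ord_recr /= IH addrA.
Qed.

Lemma walsh_sqr l a x : walsh l a x * walsh l a x = 1.
Proof.
elim: l a x => [|l IH] a x //=.
by rewrite mulrACA IH mulr1; case: ifP.
Qed.

Lemma walsh0 l a : walsh l a 0 = 1.
Proof. by elim: l a => [|l IH] a //=; rewrite IH andbF. Qed.

(** Orthogonality of characters: in each bit position the two seed bits contribute the factor 2 or
    0. Over a uniform seed it says that distinct signs are uncorrelated. *)
Lemma walsh_orth l x y : (x < 2 ^ l)%N -> (y < 2 ^ l)%N ->
  \sum_(a < 2 ^ l) walsh l a x * walsh l a y = (2 ^ l)%N%:Z *+ (x == y).
Proof.
elim: l x y => [|l IH] x y.
  by rewrite !ltnS !leqn0 => /eqP-> /eqP->; rewrite big_ord1.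
move=> hx hy; rewrite expnS mul2n.
rewrite (sum_parity _ (fun a => walsh l.+1 a x * walsh l.+1 a y)).
have hx2 : (x./2 < 2 ^ l)%N by move: hx; rewrite expnS; lia.
have hy2 : (y./2 < 2 ^ l)%N by move: hy; rewrite expnS; lia.
under eq_bigr => a _.
  rewrite /= odd_double /= doubleK uphalf_double !mul1r mulrACA -{1}[_ * _]mul1r -mulrDl.
  over.
rewrite -mulr_sumr IH //.
have -> : (x == y) = (odd x == odd y) && (x./2 == y./2).
  by apply/eqP/andP => [->|[/eqP o /eqP h]] //; rewrite -[x]odd_double_half o h odd_double_half.
by case: (odd x); case: (odd y) => //=; rewrite ?mul0r //; case: eqP => _; rewrite ?mulr0n ?mulr0 //; lia.
Qed.

Lemma walsh_mean l x : (0 < x < 2 ^ l)%N -> \sum_(a < 2 ^ l) walsh l a x = 0.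
Proof.
move=> /andP[x0 xl]; have := @walsh_orth l x 0 xl; rewrite expn_gt0 => /(_ isT).
under eq_bigr => a _ do rewrite walsh0 mulr1.
by rewrite gtn_eqF.
Qed.

(** At [2 ^ p] the Walsh function reads off bit [p] of the seed, so these signs are fully
    independent as long as the seed has a bit for each term. *)
Lemma walsh_rademacher (R : realFieldType) l (s : seq int) (F : R -> R) z :
  (size s <= l)%N ->
  \sum_(a < 2 ^ l) F (z + (\sum_(p < size s) walsh l a (2 ^ p) * s`_p)%:~R)
  = 2 ^+ l * rademacher [seq c%:~R | c <- s] F z.
Proof.
elim: s l z => [|c s IH] l z.
  move=> _ /=; under eq_bigr => a _ do rewrite big_ord0 addr0.
  by rewrite sumr_const card_ord -[LHS]mulr_natl natrX.
case: l => [//|l] /= sl; rewrite expnS mul2n.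
rewrite (sum_parity _ (fun a => F (z + (\sum_(p < (size s).+1)
   walsh l.+1 a (2 ^ p) * (c :: s)`_p)%:~R))) big_split /=.
transitivity (2 ^+ l * rademacher [seq c%:~R | c <- s] F (z + c%:~R)
   + 2 ^+ l * rademacher [seq c%:~R | c <- s] F (z - c%:~R)).
  rewrite -!IH //; congr (_ + _); apply: eq_bigr => a _;
    rewrite big_ord_recl /= odd_double ?doubleK ?uphalf_double walsh0 rmorphD /= addrA;
    congr (F (_ + _%:~R)); rewrite ?mul1r ?mulN1r ?rmorphN //=;
    apply: eq_bigr => p _;
    by rewrite /bump add1n expnS mul2n doubleK ?odd_double ?andbF mul1r.
by rewrite /symavg exprS; field.
Qed.

(** The Lindeberg bound needs natural step lengths, since [m ^ 2] counts steps of a walk; the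
    symmetry of the signs permits the passage to absolute values. *)
Lemma rademacher_absz (R : realFieldType) (s : seq int) (F : R -> R) z :
  rademacher [seq c%:~R | c <- s] F z
  = rademacher [seq m%:R | m <- [seq `|c|%N | c <- s]] F z.
Proof.
elim: s z => [|c s IH] z //=; rewrite /symavg !IH.
have [->|->] : c%:~R = `|c|%N%:R :> R \/ c%:~R = - `|c|%N%:R :> R.
- by case: c => k; [left | right; rewrite NegzE rmorphN].
- by [].
by rewrite opprK addrC.
Qed.

(** * The potential *)

(** The second moment of an affine function of the signs: [e1] kills the linear term and [e2] leaves
    the diagonal. The predicate is a residue class or everything. *)
Lemma signed_sum_sqr m H (e : nat -> nat -> int) (P : pred nat) (X Z : nat -> int) :
  (forall c, (c < H)%N -> \sum_(a < m) e a c = 0) ->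
  (forall c d, (c < H)%N -> (d < H)%N ->
     \sum_(a < m) e a c * e a d = m%:Z *+ (c == d)) ->
  \sum_(a < m) (\sum_(c < H | P c) (X c + e a c * Z c)) ^+ 2
  = m%:Z * ((\sum_(c < H | P c) X c) ^+ 2 + \sum_(c < H | P c) Z c ^+ 2).
Proof.
move=> e1 e2; set SX := \sum_(c < H | P c) X c.
transitivity (\sum_(a < m) (SX ^+ 2 + 2 * SX * (\sum_(c < H | P c) e a c * Z c)
   + \sum_(c < H | P c) \sum_(d < H | P d) e a c * Z c * (e a d * Z d))).
  apply: eq_bigr => a _; rewrite big_split /= -/SX.
  set W := \sum_(c < H | P c) e a c * Z c.
  rewrite (_ : \sum_(c < H | P c) _ = W * W); first ring.
  by rewrite /W mulr_suml; apply: eq_bigr => c _; rewrite mulr_sumr.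
rewrite !big_split /= sumr_const card_ord -mulr_sumr.
have -> : \sum_(a < m) \sum_(c < H | P c) e a c * Z c = 0.
  rewrite exchange_big big1 //= => c _.
  by rewrite -mulr_suml e1 // mul0r.
rewrite mulr0 addr0 mulrDr -[X in X + _ = _]mulr_natl; congr (_ + _).
  by rewrite -natz.
rewrite exchange_big mulr_sumr /=; apply: eq_bigr => c Pc.
rewrite exchange_big (bigD1 c) //= [X in _ + X]big1 => [|d /andP[Pd dc]].
  rewrite addr0.
  transitivity ((\sum_(a < m) e a c * e a c) * Z c ^+ 2).
    by rewrite mulr_suml; apply: eq_bigr => a _; ring.
  by rewrite e2 // eqxx.
transitivity ((\sum_(a < m) e a c * e a d) * (Z c * Z d)).
  by rewrite mulr_suml; apply: eq_bigr => a _; ring.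
rewrite e2 // (_ : (c == d :> nat) = false) ?mul0r //.
by apply/eqP => cd; move/eqP: dc; apply; apply: val_inj.
Qed.

Definition energy H (f : nat -> int) : int := \sum_(c < H) f c ^+ 2.

Definition class_energy K H (f : nat -> int) p : int :=
  \sum_(c < H | (c %% K == p)%N) f c ^+ 2.

(* Up to an additive constant this is the conditional expectation of
   [(V - n) ^ 2 + \sum_p L_p ^ 4], [V = \sum_p L_p ^ 2], over the signs that
   still have to be chosen to merge [H] columns into [K]. *)
Definition potential K n H (f : nat -> int) : int :=
  energy H f ^+ 2 - 2 * n%:Z * energy H f
  + 5 * (\sum_(p < K) class_energy K H f p ^+ 2) - 4 * (\sum_(c < H) f c ^+ 4).

Lemma sum_halves (V : nmodType) H (P : pred nat) (F : nat -> V) :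
  (forall c, (c < H)%N -> P (H + c)%N = P c) ->
  \sum_(c < H.*2 | P c) F c = \sum_(c < H | P c) (F c + F (H + c)%N).
Proof.
move=> hP; rewrite -addnn big_split_ord big_split /=; congr (_ + _).
by apply: eq_bigl => c; apply: hP.
Qed.

(** The terms [\sum_c Z c ^ 2] created by averaging have weight [1 + 5 - 4 = 2], and
    [- 4 X ^ 2 + 2 Z ^ 2] is [- 4] times the two fourth powers before the merge. Divisibility by [K]
    keeps the columns [c] and [H + c] in one class. *)
Lemma potential_avg K n H m (e : nat -> nat -> int) (f : nat -> int) :
  (0 < K)%N -> (K %| H)%N ->
  (forall a c, e a c * e a c = 1) ->
  (forall c, (c < H)%N -> \sum_(a < m) e a c = 0) ->
  (forall c d, (c < H)%N -> (d < H)%N ->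
     \sum_(a < m) e a c * e a d = m%:Z *+ (c == d)) ->
  \sum_(a < m) potential K n H (fun c => f c + e a c * f (H + c)%N)
  = m%:Z * potential K n H.*2 f.
Proof.
move=> K0 KH ee e1 e2.
pose X c := f c ^+ 2 + f (H + c)%N ^+ 2; pose Z c := 2 * f c * f (H + c)%N.
have sq a c : (f c + e a c * f (H + c)%N) ^+ 2 = X c + e a c * Z c.
  by rewrite /X /Z sqrrD exprMn [e a c ^+ 2]expr2 ee; ring.
have mK c : ((H + c) %% K = c %% K)%N by rewrite -modnDml (eqP KH) add0n.
have EX : energy H.*2 f = \sum_(c < H) X c by rewrite /energy (sum_halves (P := xpredT) (fun c => f c ^+ 2)).
have CX p : class_energy K H.*2 f p = \sum_(c < H | (c %% K == p)%N) X c.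
  rewrite /class_energy (sum_halves (P := fun c => c %% K == p)%N (fun c => f c ^+ 2)) //.
  by move=> c _; rewrite mK.
have QX : \sum_(c < H.*2) f c ^+ 4 = \sum_(c < H) (X c ^+ 2 - 2 * (f c * f (H + c)%N) ^+ 2).
  by rewrite (sum_halves (P := xpredT) (fun c => f c ^+ 4)) //; apply: eq_bigr => c _; rewrite /X; ring.
have ZZ : \sum_(c < H) Z c ^+ 2 = 4 * \sum_(c < H) (f c * f (H + c)%N) ^+ 2.
  by rewrite mulr_sumr; apply: eq_bigr => c _; rewrite /Z; ring.
clearbody X Z.
rewrite /potential EX QX (eq_bigr (fun p : 'I_K => (\sum_(c < H | (c %% K == p)%N) X c) ^+ 2));
  last by move=> p _; rewrite CX.
rewrite sumrB !big_split /= -!mulr_sumr.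
have -> : \sum_(a < m) energy H (fun c => f c + e a c * f (H + c)%N) ^+ 2
  = m%:Z * ((\sum_(c < H) X c) ^+ 2 + \sum_(c < H) Z c ^+ 2).
  rewrite -(signed_sum_sqr xpredT X Z e1 e2); apply: eq_bigr => a _.
  by rewrite /energy; congr (_ ^+ 2); apply: eq_bigr => c _; rewrite sq.
have -> : \sum_(a < m) - (2 * n%:Z * energy H (fun c => f c + e a c * f (H + c)%N))
  = - (m%:Z * (2 * n%:Z * \sum_(c < H) X c)).
  rewrite sumrN -mulr_sumr; congr (- _); rewrite mulrCA; congr (_ * _).
  transitivity (\sum_(a < m) (\sum_(c < H) X c + \sum_(c < H) e a c * Z c)).
    by apply: eq_bigr => a _; rewrite /energy -big_split; apply: eq_bigr => c _; rewrite sq.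
  rewrite big_split /= sumr_const card_ord -mulr_natl natz exchange_big [X in _ + X]big1 ?addr0 // => c _.
  by rewrite -mulr_suml e1 ?mul0r.
have -> : \sum_(a < m) \sum_(p < K) class_energy K H (fun c => f c + e a c * f (H + c)%N) p ^+ 2
  = m%:Z * (\sum_(p < K) (\sum_(c < H | (c %% K == p)%N) X c) ^+ 2 + \sum_(c < H) Z c ^+ 2).
  rewrite exchange_big mulrDr /= mulr_sumr.
  have -> : \sum_(c < H) Z c ^+ 2 = \sum_(p < K) \sum_(c < H | (c %% K == p)%N) Z c ^+ 2.
    by rewrite (partition_big (fun c : 'I_H => Ordinal (ltn_pmod c K0)) xpredT).
  rewrite [X in _ + X]mulr_sumr -big_split; apply: eq_bigr => p _ /=.
  rewrite -mulrDr -(signed_sum_sqr (fun c => c %% K == p)%N X Z e1 e2) /class_energy; apply: eq_bigr => a _.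
  by congr (_ ^+ 2); apply: eq_bigr => c _; rewrite sq.
have -> : \sum_(a < m) \sum_(c < H) (f c + e a c * f (H + c)%N) ^+ 4
  = m%:Z * \sum_(c < H) (X c ^+ 2 + Z c ^+ 2).
  rewrite exchange_big mulr_sumr; apply: eq_bigr => c _ /=.
  transitivity (\sum_(a < m) (X c ^+ 2 + Z c ^+ 2 + 2 * X c * Z c * e a c)).
    apply: eq_bigr => a _; rewrite (exprM _ 2 2) sq sqrrD exprMn [e a c ^+ 2]expr2 ee; ring.
  by rewrite big_split /= sumr_const card_ord -[(_ + _) *+ m]mulr_natl natz -mulr_sumr e1 // mulr0 addr0.
rewrite [\sum_(c < H) (X c ^+ 2 + _)]big_split /= sumrN -mulr_sumr ZZ.
ring.
Qed.

(** * The guaranteed value *)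

Lemma sqrt2pi_le1 (R : realType) : Num.sqrt (2 / pi) <= 1 :> R.
Proof.
rewrite -[leRHS]sqrtr1 ler_sqrt // ler_pdivrMr ?pi_gt0 // mul1r.
exact: pi_ge2.
Qed.

(** The smoothing scale is [s / q]. The deviation of [V] from [n] and the third moments are both
    charged to the quantity that the potential controls. *)
Lemma row_lower (R : realType) (n : nat) (s q : R) (r : seq nat) :
  0 < s -> s ^+ 2 = n%:R -> 1 <= q ->
  Num.sqrt (2 / pi) * s - 1 - 3 * s / q - q ^+ 6 / s ^+ 3 * (((\sum_(m <- r) m ^ 2)%:R - n%:R) ^+ 2 + (\sum_(m <- r) m ^ 4)%:R)
  <= rademacher [seq m%:R | m <- r] Num.norm 0.
Proof.
move=> s0 sn q1; set V : R := (\sum_(m <- r) m ^ 2)%:R.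
set F : R := (\sum_(m <- r) m ^ 4)%:R.
have q0 : 0 < q by lra.
have a0 : 0 < s / q by rewrite divr_gt0.
have := rademacher_lower r a0; apply: le_trans.
have := walk_norm_lower R (\sum_(m <- r) m ^ 2)%N.
set W := walk _ _ _; rewrite -/V => hW.
set c := Num.sqrt (2 / pi) in hW *.
have c0 : 0 <= c by rewrite sqrtr_ge0.
have c1 : c <= 1 := sqrt2pi_le1 R.
set C : R := (\sum_(m <- r) m ^ 3)%:R.
have V0 : 0 <= V by [].
pose i := s^-1; have i0 : 0 < i by rewrite invr_gt0.
have si : s * i = 1 by rewrite mulfV ?gt_eqF.
pose j := q^-1; have j0 : 0 < j by rewrite invr_gt0.
have qj : q * j = 1 by rewrite mulfV ?gt_eqF.
(* AM-GM with weight [s / q ^ 4]. Multiplied by [2 q ^ 2 / s ^ 2], this gives [F] the coefficient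
   [q ^ 6 / s ^ 3], and [V], which is near [s ^ 2], costs about [s / q ^ 2]. *)
have hC : C <= (q ^+ 4 * i * F + s * j ^+ 4 * V) / 2.
  rewrite /C /F /V !natr_sum !mulr_sumr -big_split /= mulr_suml.
  apply: ler_sum => m _.
  have h := norm_cube_le (m%:R : R) (_ : 0 < s * j ^+ 4).
  rewrite !natrX -(ger0_norm (ler0n R m)) (le_trans (h _)) ?mulr_gt0 ?exprn_gt0 //.
  by rewrite !(ger0_norm (ler0n R m)) invfM exprVn invrK -/i [i * _]mulrC.
set E := (V - n%:R) ^+ 2.
(* Used twice: [t = 1] for a crude bound on [V], and [t = q ^ -4] where the deviation itself is the
   loss. *)
have hA (t : R) : 0 < t -> `|V - n%:R| <= (t * s ^+ 2 + E * i ^+ 2 / t) / 2.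
  move=> t0.
  have -> : E = `|V - n%:R| ^+ 2 by rewrite -normrX ger0_norm ?sqr_ge0.
  set x := `|_|; have : 0 <= (t * s - x * i) ^+ 2 / t by rewrite divr_ge0 ?sqr_ge0 ?ltW.
  have -> : (t * s - x * i) ^+ 2 / t
     = t * s ^+ 2 - 2 * x * (s * i) + x ^+ 2 * i ^+ 2 / t.
    by field; rewrite gt_eqF.
  by rewrite si; lra.
(* From [s ^ 2 - V = (s - sqrt V) * (s + sqrt V)] and [s + sqrt V >= s]. *)
have hS : s - `|V - n%:R| * i <= Num.sqrt V.
  have v0 : 0 <= Num.sqrt V by rewrite sqrtr_ge0.
  have vv : Num.sqrt V * Num.sqrt V = V by rewrite -expr2 sqr_sqrtr.
  have [le|lt] := lerP s (Num.sqrt V).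
    by rewrite lerBlDr; apply: ler_wpDr; rewrite // mulr_ge0 // ltW.
  have : s ^+ 2 - V <= `|V - n%:R| by rewrite sn -normrN opprB ler_norm.
  move: `|_| => x hx.
  suff : (s - Num.sqrt V) * 1 <= x * i by lra.
  rewrite -si mulrA ler_wpM2r ?(ltW i0) //.
  apply: le_trans hx; rewrite -{2}vv; nra.
have h1 := hA 1 ltr01.
have h4 := hA (j ^+ 4) (exprn_gt0 _ j0).
have hV : V <= s ^+ 2 + `|V - n%:R|.
  by rewrite sn -lerBlDl ler_norm.
have E0 : 0 <= E by rewrite sqr_ge0.
have F0 : 0 <= F by [].
have -> : 2 * C / (s / q) ^+ 2 = 2 * C * i ^+ 2 * q ^+ 2.
  by rewrite /i; field; rewrite !gt_eqF.
have -> : s / q / 3 = s * j / 3 by [].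
have -> : 3 * s / q = 3 * s * j by [].
have -> : q ^+ 6 / s ^+ 3 * (E + F) = q ^+ 6 * i ^+ 3 * (E + F) by rewrite -exprVn.
have e4 : E * i ^+ 2 / j ^+ 4 = q ^+ 4 * E * i ^+ 2.
  by rewrite /j -exprVn invrK; ring.
rewrite e4 in h4; clear e4.
have j1 : j <= 1 by rewrite invf_le1 // q1.
set x := `|V - n%:R| in h1 h4 hV hS *.
have x0 : 0 <= x by rewrite normr_ge0.
have jj : j ^+ 2 <= j by rewrite -[leRHS]mulr1 expr2 ler_wpM2l // ltW.
have j4 : j ^+ 4 <= j.
  apply: le_trans jj; rewrite (exprD _ 2 2) -[leRHS]mulr1 ler_wpM2l ?sqr_ge0 //.
  by rewrite expr_le1 // ltW.
have q46 : q ^+ 4 <= q ^+ 6 by rewrite ler_weXn2l.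
have q16 : 1 <= q ^+ 6 by rewrite exprn_ege1.
have i3 : 0 < i ^+ 3 by rewrite exprn_gt0.
have T1 : c * Num.sqrt V >= c * s - (j ^+ 4 * s + q ^+ 4 * i ^+ 3 * E) / 2.
  have h4i : x * i <= (j ^+ 4 * s + q ^+ 4 * i ^+ 3 * E) / 2.
    have := ler_wpM2r (ltW i0) h4.
    have -> : (j ^+ 4 * s ^+ 2 + q ^+ 4 * E * i ^+ 2) / 2 * i
      = (j ^+ 4 * s * (s * i) + q ^+ 4 * i ^+ 3 * E) / 2 by ring.
    by rewrite si mulr1.
  have := ler_wpM2l c0 hS; rewrite mulrBr => H.
  have : c * (x * i) <= 1 * (x * i) by rewrite ler_wpM2r // mulr_ge0 // ltW.
  by lra.
have T2 : 2 * C * i ^+ 2 * q ^+ 2 <= q ^+ 6 * i ^+ 3 * F + i * j ^+ 2 * V.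
  have k0 : 0 <= 2 * i ^+ 2 * q ^+ 2 by rewrite mulr_ge0 ?sqr_ge0 // mulr_ge0 ?sqr_ge0.
  have := ler_wpM2l k0 hC.
  have -> : 2 * i ^+ 2 * q ^+ 2 * ((q ^+ 4 * i * F + s * j ^+ 4 * V) / 2)
    = q ^+ 6 * i ^+ 3 * F + (s * i) * (q * j) ^+ 2 * (i * j ^+ 2 * V) by field.
  rewrite si qj expr1n !mul1r; apply: le_trans.
  by rewrite le_eqVlt; apply/orP; left; apply/eqP; ring.
have T3 : i * j ^+ 2 * V <= (3 * s * j ^+ 2 + j ^+ 2 * i ^+ 3 * E) / 2.
  have k0 : 0 <= i * j ^+ 2 by rewrite mulr_ge0 ?sqr_ge0 // ltW.
  have hV2 : V <= (3 * s ^+ 2 + E * i ^+ 2) / 2 by lra.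
  have := ler_wpM2l k0 hV2.
  have -> : i * j ^+ 2 * ((3 * s ^+ 2 + E * i ^+ 2) / 2)
    = (3 * s * j ^+ 2 * (s * i) + j ^+ 2 * i ^+ 3 * E) / 2 by field.
  by rewrite si mulr1.
have iE : 0 <= i ^+ 3 * E by rewrite mulr_ge0 // ltW.
have G1 : q ^+ 4 * i ^+ 3 * E <= q ^+ 6 * i ^+ 3 * E by have := ler_wpM2r iE q46; rewrite !mulrA.
have G2 : j ^+ 2 * i ^+ 3 * E <= q ^+ 6 * i ^+ 3 * E.
  have jq : j ^+ 2 <= q ^+ 6 by lra.
  by have := ler_wpM2r iE jq; rewrite !mulrA.
have G3 : s * j ^+ 2 <= s * j by rewrite ler_wpM2l // ltW.
have G4 : j ^+ 4 * s <= s * j by rewrite mulrC ler_wpM2l // ltW.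
have sj : 0 < s * j by rewrite mulr_gt0.
clear h1 h4 hV hS; clearbody x j i c W C E F.
lra.
Qed.

(** With [q ^ 8 = K] the charge [q ^ 6 / s ^ 3] times the total [6 s ^ 6 / q ^ 8] is
    [6 s ^ 3 / q ^ 2]. The 10 is [1 + 3 + 6], counting multiples of [s ^ 3 / q]; the loss of 1 per
    row fits because [q <= s]. *)
Lemma sum_rows_lower (R : realType) (n K : nat) (L : nat -> nat -> int) :
  (0 < K <= n)%N ->
  K%:Z * \sum_(i < n) ((energy K (L i) - n%:Z) ^+ 2 + \sum_(p < K) L i p ^+ 4)
    <= 6 * n%:Z ^+ 3 ->
  (Num.sqrt (2 / pi) - 10 / Num.sqrt (Num.sqrt (Num.sqrt K%:R)))
     * (n%:R * Num.sqrt n%:R)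
  <= \sum_(i < n) rademacher [seq (L i p)%:~R | p <- iota 0 K] Num.norm 0 :> R.
Proof.
move=> /andP[K0 Kn] hD.
set s := Num.sqrt n%:R; set q := Num.sqrt (Num.sqrt _); set c := Num.sqrt (2 / pi).
have sn : s ^+ 2 = n%:R by rewrite sqr_sqrtr.
have s0 : 0 < s by rewrite sqrtr_gt0 ltr0n; lia.
have q1 : 1 <= q by rewrite -[leLHS]sqrtr1 ler_sqrt // -[leLHS]sqrtr1 ler_sqrt //
  -[leLHS]sqrtr1 ler_sqrt // ler1n.
have q0 : 0 < q by lra.
have q8 : q ^+ 8 = K%:R by rewrite (exprM _ 2 4) sqr_sqrtr // (exprM _ 2 2) sqr_sqrtr // sqr_sqrtr.
have qs : q <= s.
  apply: (le_trans (y := q ^+ 4)); first by rewrite -[leLHS]expr1 ler_weXn2l.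
  by rewrite -(ler_pXn2r (n := 2)) ?nnegrE ?exprn_ge0 ?(ltW q0) ?(ltW s0) // -exprM q8 sn ler_nat.
pose r i := [seq `|L i p|%N | p <- iota 0 K].
pose D i : R := ((\sum_(m <- r i) m ^ 2)%:R - n%:R) ^+ 2 + (\sum_(m <- r i) m ^ 4)%:R.
have DE i : D i = ((energy K (L i) - n%:Z) ^+ 2 + \sum_(p < K) L i p ^+ 4)%:~R.
  have rE (F : nat -> nat) : (\sum_(m <- r i) F m = \sum_(p < K) F `|L i p|%N)%N.
    by rewrite big_map -(big_mkord xpredT (fun p => F `|L i p|%N)) /index_iota subn0.
  have sq (z : int) : ((`|z|%N ^ 2)%N)%:R = (z ^+ 2)%:~R :> R.
    by rewrite -abszX [LHS]pmulrn gez0_abs // sqr_ge0.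
  rewrite /D !rE rmorphD rmorphXn rmorphB /= /energy !rmorph_sum /= ?natr_sum.
  congr ((_ - _) ^+ 2 + _); apply: eq_bigr => p _; first exact: sq.
  by rewrite -[4%N]/(2 * 2)%N expnM exprM natrX sq -rmorphXn.
have hDR : q ^+ 8 * \sum_(i < n) D i <= 6 * s ^+ 6.
  have := hD; rewrite -(ler_int R) intrM rmorph_sum /=.
  have -> : (6 * n%:Z ^+ 3)%:~R = 6 * s ^+ 6 :> R.
    by rewrite (exprM s 2 3) sn intrM rmorphXn.
  under eq_bigr => i _ do rewrite -DE.
  by rewrite q8.
apply: (le_trans (y := \sum_(i < n) (c * s - 1 - 3 * s / q - q ^+ 6 / s ^+ 3 * D i))).
  rewrite sumrB sumr_const card_ord -mulr_sumr -[(c * s - 1 - 3 * s / q) *+ n]mulr_natl -sn.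
  set S := \sum_(i < n) _ in hDR *.
  have h1 : q ^+ 6 / s ^+ 3 * S <= 6 * s ^+ 3 / q.
    have k0 : 0 <= (q ^+ 2 * s ^+ 3)^-1.
      by rewrite invr_ge0 mulr_ge0 ?exprn_ge0 ?(ltW q0) ?(ltW s0).
    have := ler_wpM2l k0 hDR.
    have -> : (q ^+ 2 * s ^+ 3)^-1 * (q ^+ 8 * S) = q ^+ 6 / s ^+ 3 * S.
      by field; rewrite !gt_eqF.
    have -> : (q ^+ 2 * s ^+ 3)^-1 * (6 * s ^+ 6) = 6 * s ^+ 3 / q * q^-1.
      by field; rewrite !gt_eqF.
    move=> /le_trans; apply; apply: ler_piMr; last by rewrite invf_le1.
    by rewrite divr_ge0 ?mulr_ge0 ?exprn_ge0 ?(ltW q0) ?(ltW s0).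
  have h2 : s ^+ 2 <= s ^+ 3 / q.
    by rewrite ler_pdivlMr // [leRHS]exprSr ler_wpM2l ?sqr_ge0.
  have -> : (c - 10 / q) * (s ^+ 2 * s) = s ^+ 2 * (c * s) - 10 * (s ^+ 3 / q) by ring.
  have -> : s ^+ 2 * (c * s - 1 - 3 * s / q)
     = s ^+ 2 * (c * s) - s ^+ 2 - 3 * (s ^+ 3 / q) by ring.
  by rewrite -mulrA in h1; lra.
apply: ler_sum => i _; rewrite (map_comp (fun z : int => z%:~R)) rademacher_absz.
rewrite -[[seq `|c|%N | c <- _]](map_comp absz (L i)).
exact: (@row_lower R n s q (r i) s0 sn q1).
Qed.

(** * Merging columns *)

(** No merged array is ever stored: the sign vector [y] determines it, and its column [c] is a
    signed sum over the residue class of [c] modulo [2 ^ h]. *)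
Definition merged (l h : nat) (row y : nat -> int) (c : nat) : int :=
  \sum_(t < 2 ^ (l - h)) row (c + t * 2 ^ h)%N * y (c + t * 2 ^ h)%N.

Definition signed (l : nat) (x : nat -> nat) (y : nat -> int) (a j : nat) : int :=
  y j * walsh l a (x j).

(* [walsh l a 0 = 1]: the columns of the lower half keep their signs. *)
Definition upper_half (h j : nat) : nat :=
  if (j %% 2 ^ h.+1 < 2 ^ h)%N then 0%N else (j %% 2 ^ h.+1)%N.

(** Even [t] run through the residue class of [c] modulo [2 ^ h.+1] and odd [t] through that of
    [2 ^ h + c], whose columns all receive the same Walsh sign. *)
Lemma merged_signed l h row y a c : (h < l)%N -> (c < 2 ^ h)%N ->
  merged l h row (signed l (upper_half h) y a) c
  = merged l h.+1 row y c
    + walsh l a (2 ^ h + c) * merged l h.+1 row y (2 ^ h + c)%N.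
Proof.
move=> hl ch; rewrite /merged.
have -> : (l - h = (l - h.+1).+1)%N by lia.
rewrite expnS mul2n (sum_parity _ (fun t => row (c + t * 2 ^ h)%N *
   signed l (upper_half h) y a (c + t * 2 ^ h)%N)) big_split /= mulr_sumr.
have h2 : (2 ^ h.+1 = 2 * 2 ^ h)%N by rewrite expnS.
have modMDr d t u : ((u + t * d) %% d = u %% d)%N by rewrite addnC modnMDl.
congr (_ + _); apply: eq_bigr => t _; rewrite /signed /upper_half.
  have -> : (c + t.*2 * 2 ^ h = c + t * 2 ^ h.+1)%N by rewrite h2; lia.
  rewrite modMDr modn_small ?ch ?walsh0 ?mulr1 //; lia.
have -> : (c + t.*2.+1 * 2 ^ h = 2 ^ h + c + t * 2 ^ h.+1)%N by rewrite h2; lia.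
rewrite modMDr modn_small; last lia.
by rewrite ltnNge leq_addr /=; ring.
Qed.

(** The sum runs over [2 ^ l] rows because the program folds over a power of two; the padding rows
    are zero and have zero potential. *)
Definition total_potential l k n h (M : nat -> nat -> int) (y : nat -> int) : int :=
  \sum_(i < 2 ^ l) potential (2 ^ k) n (2 ^ h) (merged l h (M i) y).

Lemma potential_eq K n H f g : (forall c, (c < H)%N -> f c = g c) ->
  potential K n H f = potential K n H g.
Proof.
move=> fg; rewrite /potential /energy /class_energy.
congr (_ ^+ 2 - _ * _ + _ * _ - _ * _);
  try (by apply: eq_bigr => c _; rewrite fg).
by apply: eq_bigr => p _; congr (_ ^+ 2); apply: eq_bigr => c _; rewrite fg.
Qed.

(** The Walsh functions are taken at [2 ^ h + c], which is nonzero and below [2 ^ l]: the signs have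
    mean zero and are uncorrelated. *)
Lemma total_potential_avg l k n h M y : (k <= h < l)%N ->
  \sum_(a < 2 ^ l) total_potential l k n h M (signed l (upper_half h) y a)
  = (2 ^ l)%N%:Z * total_potential l k n h.+1 M y.
Proof.
move=> /andP[kh hl]; rewrite exchange_big mulr_sumr; apply: eq_bigr => i _ /=.
have hh : (2 ^ h + 2 ^ h <= 2 ^ l)%N by rewrite addnn -mul2n -expnS leq_exp2l.
have h0 : (0 < 2 ^ h)%N by rewrite expn_gt0.
rewrite expnS mul2n -(@potential_avg _ n (2 ^ h) _ (fun a c => walsh l a (2 ^ h + c))).
- apply: eq_bigr => a _; apply: potential_eq => c ch; exact: merged_signed.
- by rewrite expn_gt0.
- by rewrite dvdn_exp2l.
- by move=> a c; rewrite walsh_sqr.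
- move=> c ch; apply: walsh_mean; lia.
- by move=> c d ch dh; rewrite walsh_orth ?eqn_add2l //; lia.
Qed.

Definition minimizer l (cost : nat -> int) a : Prop :=
  (a < 2 ^ l)%N /\ forall b, (b < 2 ^ l)%N -> cost a <= cost b.

Lemma minimizer_le_avg l cost a (v : int) : minimizer l cost a ->
  \sum_(b < 2 ^ l) cost b = (2 ^ l)%N%:Z * v -> cost a <= v.
Proof.
move=> [_ H] E; have p0 : 0 < (2 ^ l)%N%:Z by rewrite ltz_nat expn_gt0.
rewrite -(ler_pM2l p0) -E.
have -> : (2 ^ l)%N%:Z * cost a = \sum_(b < 2 ^ l) cost a.
  by rewrite sumr_const card_ord -mulr_natl natz.
by apply: ler_sum => b _; apply: H.
Qed.

Lemma total_potential_step l k n h M y a : (k <= h < l)%N ->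
  minimizer l (fun b => total_potential l k n h M (signed l (upper_half h) y b)) a ->
  total_potential l k n h M (signed l (upper_half h) y a)
  <= total_potential l k n h.+1 M y.
Proof. by move=> kh /minimizer_le_avg; apply; apply: total_potential_avg. Qed.

Lemma class_count K n p : (0 < K)%N ->
  (K * \sum_(c < n | (c %% K == p)%N) 1 <= n + K)%N.
Proof.
move=> K0; elim/ltn_ind: n => n IH; have [nK|Kn] := ltnP n K.
  have : (\sum_(c < n | (c %% K == p)%N) 1 <= 1)%N.
    rewrite sum1dep_card; apply/card_le1_eqP => c d; rewrite !inE => /eqP cp /eqP dp.
    apply: val_inj; move: cp dp; rewrite !modn_small /=; first by move=> -> ->.
      exact: ltn_trans (ltn_ord d) nK.
    exact: ltn_trans (ltn_ord c) nK.
  by nia.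
have nKn : (n - K < n)%N by lia.
have {IH} h2 := IH _ nKn.
have -> : (\sum_(c < n | (c %% K == p)%N) 1
  = \sum_(c < K | (c %% K == p)%N) 1 + \sum_(c < n - K | (c %% K == p)%N) 1)%N.
  rewrite -[in LHS](subnKC Kn) big_split_ord /=; congr (_ + _)%N.
  by apply: eq_bigl => c; rewrite modnDl.
have h1 : (\sum_(c < K | (c %% K == p)%N) 1 <= 1)%N.
  rewrite sum1dep_card; apply/card_le1_eqP => c d; rewrite !inE => /eqP cp /eqP dp.
  by apply: val_inj; move: cp dp; rewrite !modn_small //= => -> ->.
move: h1 h2; move: (\sum_(c < K | _) 1)%N (\sum_(c < n - K | _) 1)%N => u v; nia.
Qed.

(** Before any merge the left factor is [5 \sum_p u_p ^ 2 - 4 n] with class sizes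
    [u_p <= n / K + 1], and [5 n (n + K) - 4 n K <= 6 n ^ 2] because [K <= n]. *)
Lemma potential_init K n H f : (0 < K <= n)%N -> (n <= H)%N ->
  (forall c, (c < H)%N -> f c ^+ 2 = (c < n)%N%:Z) ->
  K%:Z * (potential K n H f + n%:Z ^+ 2) <= 6 * n%:Z ^+ 2.
Proof.
move=> /andP[K0 Kn] nH f2.
have ind (P : pred nat) : \sum_(c < H | P c) (c < n)%N%:Z = (\sum_(c < n | P c) 1)%N%:Z.
  rewrite -(subnKC nH) big_split_ord /= [X in _ + X]big1 ?addr0 => [|c _].
    by rewrite -[RHS]natz natr_sum; apply: eq_bigr => c _; rewrite ltn_ord.
  by rewrite ltnNge leq_addr.
rewrite /potential /energy.
have -> : \sum_(c < H) f c ^+ 2 = n%:Z.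
  under eq_bigr => c _ do rewrite f2 //.
  by rewrite (ind xpredT) sum1_card card_ord.
have -> : \sum_(c < H) f c ^+ 4 = n%:Z.
  rewrite -[RHS](_ : \sum_(c < H) (c < n)%N%:Z = _).
    by apply: eq_bigr => c _; rewrite (exprM _ 2 2) f2 // ; case: ltnP.
  by rewrite (ind xpredT) sum1_card card_ord.
pose u p := (\sum_(c < n | (c %% K == p)%N) 1)%N.
have -> : \sum_(p < K) class_energy K H f p ^+ 2 = \sum_(p < K) (u p)%:Z ^+ 2.
  apply: eq_bigr => p _; congr (_ ^+ 2); rewrite /u -(ind (fun c => c %% K == p)%N).
  by apply: eq_bigr => c _; rewrite f2.
have su : \sum_(p < K) (u p)%:Z = n%:Z.
  transitivity (\sum_(p < K) \sum_(c < n | (c %% K == p)%N) (1 : int)).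
    by apply: eq_bigr => p _; rewrite /u -[LHS]natz natr_sum.
  transitivity (\sum_(c < n) (1 : int)); last by rewrite sumr_const card_ord natz.
  by rewrite (partition_big (fun c : 'I_n => Ordinal (ltn_pmod c K0)) xpredT).
have : K%:Z * \sum_(p < K) (u p)%:Z ^+ 2 <= (n + K)%N%:Z * n%:Z.
  rewrite -[in leRHS]su !mulr_sumr; apply: ler_sum => p _.
  by rewrite expr2 mulrA ler_wpM2r // -PoszM lez_nat class_count.
set S := \sum_(p < K) _.
nia.
Qed.

(** When every class is a single column its squared energy is a fourth power, so [5 - 4 = 1] copy of
    the fourth powers remains and nothing random is left. *)
Lemma potential_final K n f :
  potential K n K f + n%:Z ^+ 2 = (energy K f - n%:Z) ^+ 2 + \sum_(p < K) f p ^+ 4.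
Proof.
rewrite /potential (eq_bigr (fun p : 'I_K => f p ^+ 4)); first by ring.
move=> p _; rewrite /class_energy (big_pred1 p) => [|c /=].
  by rewrite -exprM.
by rewrite modn_small.
Qed.

Lemma sum_blocks (V : nmodType) m K (F : nat -> V) :
  \sum_(j < m * K) F j = \sum_(p < K) \sum_(t < m) F (p + t * K)%N.
Proof.
rewrite exchange_big; elim: m => [|m IH]; first by rewrite !big_ord0.
rewrite mulSnr big_split_ord /= IH big_ord_recr; congr (_ + _) => /=.
by apply: eq_bigr => p _; rewrite addnC.
Qed.

(** * One sign per class: the exhaustive search *)

Definition row_sum l (row y : nat -> int) : int := \sum_(j < 2 ^ l) row j * y j.

Definition total_abs l (M : nat -> nat -> int) y : int :=
  \sum_(i < 2 ^ l) `|row_sum l (M i) y|.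

(* The Walsh functions of distinct powers of two are independent, so a seed [a]
   stands for an arbitrary choice of one sign per class. *)
Definition digit (k j : nat) : nat := (2 ^ (j %% 2 ^ k))%N.

Lemma row_sum_signed l k row y a : (k <= l)%N ->
  row_sum l row (signed l (digit k) y a)
  = \sum_(p < 2 ^ k) walsh l a (2 ^ p) * merged l k row y p.
Proof.
move=> kl; rewrite /row_sum.
have -> : (2 ^ l = 2 ^ (l - k) * 2 ^ k)%N by rewrite -expnD subnK.
rewrite (sum_blocks _ _ (fun j => row j * signed l (digit k) y a j)).
apply: eq_bigr => p _; rewrite mulr_sumr; apply: eq_bigr => t _.
by rewrite /signed /digit addnC modnMDl modn_small //; ring.
Qed.

Lemma sum_rows_zero n l (F : nat -> int) : (n <= 2 ^ l)%N ->
  (forall i, (n <= i)%N -> F i = 0) -> \sum_(i < 2 ^ l) F i = \sum_(i < n) F i.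
Proof.
move=> nl F0; rewrite -(subnKC nl) big_split_ord /= [X in _ + X]big1 ?addr0 // => i _.
by rewrite F0 // leq_addr.
Qed.

Lemma potential0 K n H f : (forall c, f c = 0) -> potential K n H f = 0.
Proof.
move=> f0; rewrite /potential /energy /class_energy.
rewrite (eq_bigr (fun=> 0)) => [|c _]; last by rewrite f0 expr0n.
rewrite [X in _ + 5 * X](eq_bigr (fun=> 0)) => [|p _].
  rewrite [X in _ - 4 * X](eq_bigr (fun=> 0)) => [|c _]; last by rewrite f0 expr0n.
  by rewrite !big1_eq; ring.
by rewrite big1 ?expr0n // => c _; rewrite f0 expr0n.
Qed.

Lemma merged0 l h row y c : (forall j, row j = 0) -> merged l h row y c = 0.
Proof. by move=> r0; rewrite /merged big1 // => t _; rewrite r0 mul0r. Qed.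

(** The last two hypotheses are all that is asked of a run. A potential not above its initial value
    gives the averaged lower bound over independent class signs; the best seed reaches the average,
    and [2 ^ k <= l] makes the seeds exhaust all sign patterns. *)
Theorem signed_value (R : realType) n l k M y y0 a :
  (2 ^ k <= n)%N -> (n <= 2 ^ l)%N -> (2 ^ k <= l)%N ->
  (forall i j, (i < n)%N -> (j < n)%N -> M i j ^+ 2 = 1) ->
  (forall i j, (n <= i)%N -> M i j = 0) ->
  (forall j, (j < 2 ^ l)%N -> y0 j = (j < n)%N%:Z) ->
  total_potential l k n k M y <= total_potential l k n l M y0 ->
  minimizer l (fun b => - total_abs l M (signed l (digit k) y b)) a ->
  (Num.sqrt (2 / pi) - 10 / Num.sqrt (Num.sqrt (Num.sqrt (2 ^ k)%:R)))
     * (n%:R * Num.sqrt n%:R)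
  <= (total_abs l M (signed l (digit k) y a))%:~R :> R.
Proof.
move=> kn nl kl M1 M0 y0E hpot hmin.
have K0 : (0 < 2 ^ k)%N by rewrite expn_gt0.
have k_le_l : (k <= l)%N by apply: leq_trans kl; apply/ltnW/ltn_expl.
have tpE h z : total_potential l k n h M z
   = \sum_(i < n) potential (2 ^ k) n (2 ^ h) (merged l h (M i) z).
  rewrite /total_potential.
  apply: (sum_rows_zero (F := fun i => potential (2 ^ k) n (2 ^ h) (merged l h (M i) z)) nl).
  by move=> i ni; apply: potential0 => c; apply: merged0 => j; apply: M0.
have := @sum_rows_lower R n (2 ^ k) (fun i => merged l k (M i) y) _ _.
rewrite K0 kn => /(_ isT) low.
have {}low := low _; apply: le_trans (low _) _ => {low}.
  rewrite (eq_bigr (fun i : 'I_n => potential (2 ^ k) n (2 ^ k) (merged l k (M i) y) + n%:Z ^+ 2)); last first.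
    by move=> i _; rewrite potential_final.
  apply: (le_trans (y := (2 ^ k)%N%:Z * \sum_(i < n) (potential (2 ^ k) n (2 ^ l) (merged l l (M i) y0) + n%:Z ^+ 2))).
    have sD (F : nat -> int) : \sum_(i < n) (F i + n%:Z ^+ 2)
      = \sum_(i < n) F i + \sum_(i < n) n%:Z ^+ 2 by rewrite big_split.
    rewrite ler_wpM2l // (sD (fun i => potential _ n _ (merged l k (M i) y))).
    by rewrite (sD (fun i => potential _ n _ (merged l l (M i) y0))) lerD2r -!tpE.
  rewrite mulr_sumr.
  have -> : 6 * n%:Z ^+ 3 = \sum_(i < n) 6 * n%:Z ^+ 2.
    by rewrite sumr_const card_ord -mulr_natl natz; ring.
  apply: ler_sum => i _; apply: potential_init; rewrite ?K0 // => c cl.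
  rewrite /merged subnn big_ord1 mul0n addn0 y0E // exprMn.
  have [cn|cn] := ltnP c n; first by rewrite M1.
  by rewrite mulr0.
set W := \sum_(i < n) _.
have p0 : 0 < (2 ^+ l : R) by rewrite exprn_gt0.
have avg : \sum_(b < 2 ^ l) (total_abs l M (signed l (digit k) y b))%:~R = 2 ^+ l * W.
  rewrite /W mulr_sumr.
  transitivity (\sum_(b < 2 ^ l) \sum_(i < n) `|row_sum l (M i) (signed l (digit k) y b)|%:~R : R).
    apply: eq_bigr => b _; rewrite -rmorph_sum; congr (_%:~R).
    apply: (sum_rows_zero (F := fun i => `|row_sum l (M i) (signed l (digit k) y b)|) nl).
    by move=> i ni; rewrite /row_sum big1 ?normr0 // => j _; rewrite M0 ?mul0r.
  rewrite exchange_big; apply: eq_bigr => i _ /=.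
  rewrite (map_comp (fun z : int => z%:~R)) -walsh_rademacher ?size_map ?size_iota //.
  apply: eq_bigr => b _; rewrite add0r -intr_norm row_sum_signed //.
  congr (`|_|%:~R); apply: eq_bigr => p _; congr (_ * _).
  by rewrite (nth_map 0%N) ?size_iota // nth_iota.
rewrite -(ler_pM2l p0) -avg.
have -> : 2 ^+ l * (total_abs l M (signed l (digit k) y a))%:~R
   = \sum_(b < 2 ^ l) (total_abs l M (signed l (digit k) y a))%:~R :> R.
  by rewrite sumr_const card_ord -[RHS]mulr_natl natrX.
apply: ler_sum => b _; rewrite ler_int.
by have := hmin.2 b (ltn_ord b); rewrite lerN2.
Qed.

(** * Words *)

Lemma to_word_small b z :
  - 2 ^+ b.-1 <= z < 2 ^+ b.-1 -> (0 < b)%N -> to_word b z = z.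
Proof.
move=> /andP[lo hi] b0; rewrite /to_word modz_small ?addrK //.
have -> : 2 ^+ b = 2 ^+ b.-1 + 2 ^+ b.-1 :> int by rewrite -{1}(prednK b0) exprS; ring.
by apply/andP; split; lia.
Qed.

Lemma to_word_congr b x y : (x = y %[mod 2 ^+ b])%Z -> to_word b x = to_word b y.
Proof. by move=> e; rewrite /to_word -modzDml e modzDml. Qed.

Lemma to_wordK b x : (to_word b x = x %[mod 2 ^+ b])%Z.
Proof. by rewrite /to_word modzDml addrK. Qed.

Lemma to_word_id b x : to_word b (to_word b x) = to_word b x.
Proof. exact/to_word_congr/to_wordK. Qed.

Lemma to_wordDl b x y : to_word b (to_word b x + y) = to_word b (x + y).
Proof. by apply: to_word_congr; rewrite -modzDml to_wordK modzDml. Qed.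

Lemma to_wordDr b x y : to_word b (x + to_word b y) = to_word b (x + y).
Proof. by rewrite addrC to_wordDl addrC. Qed.

Lemma to_wordN b x : to_word b (- to_word b x) = to_word b (- x).
Proof.
apply: to_word_congr; apply/eqP; rewrite eqz_mod_dvd opprK addrC -eqz_mod_dvd.
by apply/eqP; rewrite to_wordK.
Qed.

Lemma to_wordMl b x y : to_word b (to_word b x * y) = to_word b (x * y).
Proof. by apply: to_word_congr; rewrite -modzMml to_wordK modzMml. Qed.

Lemma to_wordMr b x y : to_word b (x * to_word b y) = to_word b (x * y).
Proof. by rewrite mulrC to_wordMl mulrC. Qed.

Lemma to_wordBl b x y : to_word b (to_word b x - y) = to_word b (x - y).
Proof. exact: to_wordDl. Qed.

Lemma to_wordBr b x y : to_word b (x - to_word b y) = to_word b (x - y).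
Proof. by rewrite -to_wordDr to_wordN to_wordDr. Qed.

Lemma to_word_add b x y x' y' :
  to_word b x = to_word b x' -> to_word b y = to_word b y' ->
  to_word b (x + y) = to_word b (x' + y').
Proof. by move=> ex ey; rewrite -to_wordDl ex to_wordDl -to_wordDr ey to_wordDr. Qed.

Lemma to_word_opp b x x' : to_word b x = to_word b x' -> to_word b (- x) = to_word b (- x').
Proof. by move=> ex; rewrite -to_wordN ex to_wordN. Qed.

Lemma to_word_mul b x y x' y' :
  to_word b x = to_word b x' -> to_word b y = to_word b y' ->
  to_word b (x * y) = to_word b (x' * y').
Proof. by move=> ex ey; rewrite -to_wordMl ex to_wordMl -to_wordMr ey to_wordMr. Qed.

Ltac drop_words := repeat first [reflexivity | apply: to_word_id
  | apply: to_word_add | apply: to_word_opp | apply: to_word_mul].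

(* The word operations are ring operations modulo [2 ^ b]: only the arguments
   of divisions and comparisons have to be reduced. *)
Fixpoint raw_expr (b : nat) (r : nat -> int) (e : expr) : int :=
  match e with
  | EConst z => z
  | EReg i => r i
  | EBin OpAdd x y => raw_expr b r x + raw_expr b r y
  | EBin OpSub x y => raw_expr b r x - raw_expr b r y
  | EBin OpMul x y => raw_expr b r x * raw_expr b r y
  | EBin o x y => eval_binop o (eval_expr b r x) (eval_expr b r y)
  end.

Lemma to_word_eval b r e : to_word b (eval_expr b r e) = to_word b (raw_expr b r e).
Proof.
elim: e => [z|i|o x IHx y IHy] //=; first exact: to_word_id.
rewrite to_word_id; case: o => //=.
- by rewrite -to_wordDl -to_wordDr IHx IHy to_wordDl to_wordDr.
- by rewrite -to_wordBl -to_wordBr IHx IHy to_wordBl to_wordBr.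
- by rewrite -to_wordMl -to_wordMr IHx IHy to_wordMl to_wordMr.
Qed.

Lemma eval_bin b r o x y :
  eval_expr b r (EBin o x y) = to_word b (raw_expr b r (EBin o x y)).
Proof. by rewrite -to_word_eval /= to_word_id. Qed.

Lemma eval_reg b r i : eval_expr b r (EReg i) = r i. Proof. by []. Qed.

Lemma eval_const b r z : eval_expr b r (EConst z) = to_word b z. Proof. by []. Qed.

Definition evalE := (eval_bin, eval_reg, eval_const).

Arguments eval_expr : simpl never.

(** * Lockstep execution *)

(** The shape that every configuration keeps while no guard tells the processors apart: one common
    command stack, registers as a function of the processor number. *)
Definition lockstep (M : nat) (k : seq cmd) (rg : nat -> nat -> int) (m : int -> int) :=
  Config [seq Processor k (rg p) | p <- iota 0 M] m.

Definition state := ((nat -> nat -> int) * (int -> int))%type.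

(** The stack [k] below the command is arbitrary, which makes executions composable. *)
Definition executes b M c (s : state) t M' (s' : state) : Prop :=
  forall k, run b t (lockstep M (c :: k) s.1 s.2) = lockstep M' k s'.1 s'.2.

Definition triple b M (P : state -> Prop) c T M' (Q : state -> Prop) : Prop :=
  forall s, P s -> exists t s', [/\ (t <= T)%N, Q s' & executes b M c s t M' s'].

Definition write_all (M : nat) (fa fv : nat -> int) (m : int -> int) : int -> int :=
  commit [seq (fa p, fv p) | p <- iota 0 M] m.

(** This forgets the priority rule. It is enough because colliding writers agree, or any of their
    values will do, or the cell is never read. *)
Lemma write_all_cases M fa fv m x :
  (exists2 p, (p < M)%N & fa p = x /\ write_all M fa fv m x = fv p) \/
  ((forall p, (p < M)%N -> fa p <> x) /\ write_all M fa fv m x = m x).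
Proof.
rewrite /write_all /commit.
suff : forall s, (exists2 p, p \in s & fa p = x /\
      foldr (fun w v => if w.1 == x then w.2 else v) (m x) [seq (fa p, fv p) | p <- s] = fv p) \/
   ((forall p, p \in s -> fa p <> x) /\
      foldr (fun w v => if w.1 == x then w.2 else v) (m x) [seq (fa p, fv p) | p <- s] = m x).
  move=> /(_ (iota 0 M)) [[p]|[H E]].
    by rewrite mem_iota add0n => pM E; left; exists p.
  by right; split=> // p pM; apply: H; rewrite mem_iota add0n.
elim=> [|p s IH]; first by right.
rewrite /=; case: eqP => [e|ne].
  by left; exists p; rewrite ?mem_head.
case: IH => [[q qs E]|[H E]].
  by left; exists q; rewrite // in_cons qs orbT.
by right; split=> // q; rewrite in_cons => /orP[/eqP->|/H].
Qed.

Lemma write_all_hit M fa fv m p :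
  (p < M)%N -> (forall q, (q < M)%N -> fa q = fa p -> fv q = fv p) ->
  write_all M fa fv m (fa p) = fv p.
Proof.
move=> pM H; case: (write_all_cases M fa fv m (fa p)) => [[q qM [e ->]]|[h _]].
  exact: H.
by have := h p pM.
Qed.

Lemma write_all_miss M fa fv m x :
  (forall p, (p < M)%N -> fa p <> x) -> write_all M fa fv m x = m x.
Proof.
move=> H; case: (write_all_cases M fa fv m x) => [[q qM [e _]]|[_ //]].
by have := H q qM.
Qed.

Lemma lockstep_step b M c k k' rg rg' m (w : nat -> option (int * int)) :
  (forall p, (p < M)%N ->
     proc_step b m (Processor (c :: k) (rg p)) = ([:: Processor k' (rg' p)], w p)) ->
  step b (lockstep M (c :: k) rg m)
  = lockstep M k' rg' (commit (pmap w (iota 0 M)) m).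
Proof.
move=> H; have {}H : {in iota 0 M, forall p,
    proc_step b m (Processor (c :: k) (rg p)) = ([:: Processor k' (rg' p)], w p)}.
  by move=> p; rewrite mem_iota add0n => /H.
have E : [seq proc_step b m p | p <- [seq Processor (c :: k) (rg p) | p <- iota 0 M]]
    = [seq ([:: Processor k' (rg' p)], w p) | p <- iota 0 M].
  by rewrite -map_comp; apply/eq_in_map => p /H.
have -> : step b (lockstep M (c :: k) rg m) =
  let out := [seq ([:: Processor k' (rg' p)], w p) | p <- iota 0 M] in
  Config (flatten [seq o.1 | o <- out]) (commit (pmap (fun o => o.2) out) m).
  by rewrite /step /lockstep; cbn [procs cells]; rewrite E.
rewrite /lockstep /=; congr Config.
  by rewrite -map_comp; elim: (iota 0 M) => [|p s IH] //=; rewrite IH.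
by congr commit; elim: (iota 0 M) => [|p s IH] //=; rewrite IH.
Qed.

Lemma pmap_none (s : seq nat) : pmap (fun _ : nat => None : option (int * int)) s = [::].
Proof. by elim: s. Qed.

Lemma run1 b s : run b 1 s = step b s. Proof. by []. Qed.

Lemma runD b t u s : run b (t + u) s = run b u (run b t s).
Proof. by rewrite /run addnC iterD. Qed.

Fixpoint straight (c : cmd) : bool :=
  match c with
  | CAssign _ _ | CRead _ _ | CWrite _ _ => true
  | CSeq c1 c2 => straight c1 && straight c2
  | _ => false
  end.

Fixpoint duration (c : cmd) : nat :=
  if c is CSeq c1 c2 then (duration c1 + duration c2).+1 else 1.

Fixpoint effect b M (c : cmd) (s : state) : state :=
  match c with
  | CAssign i e => (fun p => upd (s.1 p) i (eval_expr b (s.1 p) e), s.2)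
  | CRead i e => (fun p => upd (s.1 p) i (s.2 (eval_expr b (s.1 p) e)), s.2)
  | CWrite a e => (s.1, write_all M (fun p => eval_expr b (s.1 p) a)
                                    (fun p => eval_expr b (s.1 p) e) s.2)
  | CSeq c1 c2 => effect b M c2 (effect b M c1 s)
  | _ => s
  end.

Lemma executes_seq b M c1 c2 s t1 M1 s1 t2 M2 s2 :
  executes b M c1 s t1 M1 s1 -> executes b M1 c2 s1 t2 M2 s2 ->
  executes b M (CSeq c1 c2) s (t1 + t2).+1 M2 s2.
Proof.
move=> h1 h2 k; rewrite -add1n runD run1.
rewrite (lockstep_step (k' := [:: c1, c2 & k]) (rg' := s.1) (w := fun=> None)) //.
by rewrite pmap_none runD h1 h2.
Qed.

Lemma executes_straight b M c s :
  straight c -> executes b M c s (duration c) M (effect b M c s).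
Proof.
elim: c s => //=.
- move=> i e s _ k; rewrite run1.
  rewrite (lockstep_step (k' := k) (w := fun=> None)
    (rg' := fun p => upd (s.1 p) i (eval_expr b (s.1 p) e))) //.
  by rewrite pmap_none.
- move=> i e s _ k; rewrite run1.
  rewrite (lockstep_step (k' := k) (w := fun=> None)
    (rg' := fun p => upd (s.1 p) i (s.2 (eval_expr b (s.1 p) e)))) //.
  by rewrite pmap_none.
- move=> a e s _ k; rewrite run1.
  rewrite (lockstep_step (k' := k) (rg' := s.1)
    (w := fun p => Some (eval_expr b (s.1 p) a, eval_expr b (s.1 p) e))) //.
- move=> c1 IH1 c2 IH2 s /andP[h1 h2].
  exact: executes_seq (IH1 _ h1) (IH2 _ h2).
Qed.

Lemma triple_straight b M (P Q : state -> Prop) c :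
  straight c -> (forall s, P s -> Q (effect b M c s)) ->
  triple b M P c (duration c) M Q.
Proof.
move=> sc PQ s Ps; exists (duration c), (effect b M c s).
by split; [|exact: PQ|exact: executes_straight].
Qed.

Lemma triple_seq b M1 M2 M3 P Q S c1 c2 T1 T2 :
  triple b M1 P c1 T1 M2 Q -> triple b M2 Q c2 T2 M3 S ->
  triple b M1 P (CSeq c1 c2) (T1 + T2).+1 M3 S.
Proof.
move=> h1 h2 s /h1[t1 [s1 [le1 /h2[t2 [s2 [le2 Ss2 e2]]] e1]]].
exists (t1 + t2).+1, s2; split=> //; first by rewrite ltnS leq_add.
exact: executes_seq e1 e2.
Qed.

(** Every processor must leave the loop in the same round. The number [M i] of processors may vary
    with the round, as it does during activation. *)
Lemma triple_while b (M : nat -> nat) (I : nat -> state -> Prop) e c T r :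
  (forall i s p, (i < r)%N -> I i s -> (p < M i)%N -> eval_expr b (s.1 p) e != 0) ->
  (forall s p, I r s -> (p < M r)%N -> eval_expr b (s.1 p) e = 0) ->
  (forall i, (i < r)%N -> triple b (M i) (I i) c T (M i.+1) (I i.+1)) ->
  triple b (M 0) (I 0) (CWhile e c) (r * T.+1).+1 (M r) (I r).
Proof.
move=> e1 e0 H.
suff G d i : (i + d = r)%N -> triple b (M i) (I i) (CWhile e c) (d * T.+1).+1 (M r) (I r).
  exact: G.
elim: d i => [|d IH] i.
  rewrite addn0 => -> s Is; exists 1%N, s; split=> // k.
  rewrite run1 (lockstep_step (k' := k) (rg' := s.1) (w := fun=> None)) ?pmap_none //.
  by move=> p pM; rewrite /proc_step; cbn [regs todo]; rewrite (e0 _ _ Is pM).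
rewrite addnS -addSn => ir s Is.
have lt : (i < r)%N by rewrite -ir addSn ltnS leq_addr.
have [t1 [s1 [le1 Is1 E1]]] := H i lt s Is.
have [t2 [s2 [le2 Is2 E2]]] := IH _ ir s1 Is1.
exists (t1 + t2).+1, s2; split=> //; first by rewrite mulSn; lia.
move=> k; rewrite -add1n runD run1.
rewrite (lockstep_step (k' := [:: c, CWhile e c & k]) (rg' := s.1) (w := fun=> None)).
  by rewrite pmap_none runD E1 E2.
by move=> p pM; rewrite /proc_step; cbn [regs todo]; rewrite (e1 _ _ _ lt Is pM).
Qed.

(** A triple from one fixed state, so that the postcondition can refer to the initial registers and
    memory. *)
Definition reaches b M c s T M' (Q : state -> Prop) : Prop :=
  exists t s', [/\ (t <= T)%N, Q s' & executes b M c s t M' s'].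

Lemma reaches_seq b M1 M2 M3 Q S c1 c2 T1 T2 s :
  reaches b M1 c1 s T1 M2 Q -> (forall s', Q s' -> reaches b M2 c2 s' T2 M3 S) ->
  reaches b M1 (CSeq c1 c2) s (T1 + T2).+1 M3 S.
Proof.
move=> h1 h2; apply: (@triple_seq b M1 M2 M3 (eq s) Q S) => //.
by move=> _ <-.
Qed.

Lemma reaches_straight b M c s (Q : state -> Prop) :
  straight c -> Q (effect b M c s) -> reaches b M c s (duration c) M Q.
Proof. by move=> sc Qs; exists (duration c), (effect b M c s); split=> //; exact: executes_straight. Qed.

Lemma reaches_weaken b M c s T T' M' (Q Q' : state -> Prop) :
  (forall s', Q s' -> Q' s') -> (T <= T')%N ->
  reaches b M c s T M' Q -> reaches b M c s T' M' Q'.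
Proof.
move=> QQ TT [t [s' [le Qs e]]]; exists t, s'; split=> //; last exact: QQ.
exact: leq_trans TT.
Qed.

(** A child is listed right after its parent, so processor [p] becomes [2 p] and [2 p + 1]. Doubling
    register 1 and adding 1 in the child thus keeps it equal to the position. *)
Lemma executes_fork b M i e s :
  executes b M (CFork i e) s 1 M.*2
    (fun p => if odd p then upd (s.1 p./2) i (eval_expr b (s.1 p./2) e) else s.1 p./2, s.2).
Proof.
move=> k; rewrite run1 /step /lockstep /= -!map_comp; congr Config; last first.
  by elim: (iota 0 M).
have -> : iota 0 M.*2 = flatten [seq [:: p.*2; p.*2.+1] | p <- iota 0 M].
  elim: M => [|M IH] //.
  by rewrite doubleS -addn2 iotaD IH -[M.+1]addn1 iotaD map_cat flatten_cat.
elim: (iota 0 M) => [|p r IH] //=.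
by rewrite odd_double /= !doubleK uphalf_double IH.
Qed.

Lemma lockstep_halted M rg m : halted (lockstep M [::] rg m).
Proof. by rewrite /halted /=; elim: (iota 0 M). Qed.

Lemma run_halted b t M rg m : run b t (lockstep M [::] rg m) = lockstep M [::] rg m.
Proof.
elim: t => [|t IH] //; rewrite -addn1 runD IH run1 /step /lockstep /= -!map_comp.
by congr Config; elim: (iota 0 M) => //= p r ->.
Qed.

(** * The program *)

Declare Scope program_scope.
Delimit Scope program_scope with prog.
Notation "$ i" := (EReg i%N) (at level 1, format "$ i") : program_scope.
Notation "x + y" := (EBin OpAdd x y) : program_scope.
Notation "x - y" := (EBin OpSub x y) : program_scope.
Notation "x * y" := (EBin OpMul x y) : program_scope.
Notation "x / y" := (EBin OpDiv x y) : program_scope.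
Notation "x %% y" := (EBin OpMod x y) : program_scope.
Notation "x < y" := (EBin OpLt x y) : program_scope.
Notation "x == y" := (EBin OpEq x y) : program_scope.
Notation "i ::= e" := (CAssign i%N e%prog) (at level 85, no associativity) : program_scope.
Notation "c1 ;; c2" := (CSeq c1 c2) (at level 90, right associativity) : program_scope.

(* Work arrays live at negative addresses, interleaved with stride 8: 1 holds
   matrix entries and their partial sums, 2 costs, 3 candidate signs, 4 flags. *)
Definition cell (q p : nat) : int := - q%:Z - 8 * p%:Z.

Definition cell_expr (q : nat) (e : expr) : expr :=
  (EConst (- q%:Z) - EConst 8 * e)%prog.

(* Registers: 0 holds n, 1 the processor number (a * N + i) * N + j, 2 to 4 the
   digits a, i and j, 5 the power of two N > n, 6 the number K of classes,
   7 the current number of classes; 14 receives the best candidate a. *)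

Definition sign_prog : cmd := (
  (10 ::= $2 ;; 12 ::= $5 ;; 8 ::= EConst 1) ;;
  CWhile (EConst 1 < $12) (
    8 ::= $8 * (EConst 1 - EConst 2 * (($10 %% EConst 2) * ($11 %% EConst 2))) ;;
    10 ::= $10 / EConst 2 ;; 11 ::= $11 / EConst 2 ;; 12 ::= $12 / EConst 2))%prog.

(** Each selection rebuilds array 1 from the input, since the folds destroy it. *)
Definition place_prog : cmd := (
  (CRead 10 ($3 * $0 + $4) ;;
   CRead 11 ($0 * $0 + $0 + $4) ;;
   11 ::= $11 * $8) ;;
  CWrite (cell_expr 3 $1) $11 ;;
  CWrite (cell_expr 1 $1) (($3 < $0) * ($10 * $11)))%prog.

(** The guard means [lo <= $12], as the language only has strict comparison. All processors add,
    without a bounds check that would break the lockstep; cells whose window does not fit hold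
    meaningless sums. *)
Definition fold_prog (q : nat) (lo : expr) : cmd := (
  CWhile (lo < $12 + EConst 1) (
    (CRead 10 (cell_expr q $1) ;;
     CRead 11 (cell_expr q ($1 + $12))) ;;
    CWrite (cell_expr q $1) ($10 + $11) ;;
    12 ::= $12 / EConst 2))%prog.

(** Register 13 accumulates the share of column [j] in the potential: the terms in single columns
    here, those in class energies and total energy as soon as further folds deliver them. *)
Definition squares_prog : cmd := (
  CRead 10 (cell_expr 1 $1) ;;
  (10 ::= $10 * ($4 < $7) ;;
   10 ::= $10 * $10 ;;
   13 ::= EConst 0 - EConst 2 * $0 * $10 - EConst 4 * $10 * $10) ;;
  CWrite (cell_expr 1 $1) $10 ;;
  12 ::= $5 / EConst 2)%prog.

Definition classes_prog : cmd := (
  CRead 10 (cell_expr 1 $1) ;;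
  (10 ::= $10 * ($4 < $6) ;;
   13 ::= $13 + EConst 5 * $10 * $10) ;;
  CWrite (cell_expr 1 $1) $10 ;;
  12 ::= $5 / EConst 2)%prog.

Definition energy_prog : cmd := (
  CRead 10 (cell_expr 1 $1) ;;
  (10 ::= $10 * ($4 < EConst 1) ;;
   13 ::= $13 + $10 * $10) ;;
  CWrite (cell_expr 2 $1) $13 ;;
  12 ::= $5 * $5 / EConst 2)%prog.

Definition potential_prog : cmd := (
  12 ::= $5 / EConst 2 ;; fold_prog 1 $7 ;;
  squares_prog ;; fold_prog 1 $6 ;;
  classes_prog ;; fold_prog 1 (EConst 1) ;;
  energy_prog ;; fold_prog 2 (EConst 1))%prog.

(** The factor [2 [x < 0] - 1] turns [x] into [- |x|], so that maximising becomes minimising a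
    cost. *)
Definition abs_prog : cmd := (
  CRead 10 (cell_expr 1 $1) ;;
  13 ::= ($4 < EConst 1) * ($10 * (EConst 2 * ($10 < EConst 0) - EConst 1)) ;;
  CWrite (cell_expr 2 $1) $13 ;;
  12 ::= $5 * $5 / EConst 2)%prog.

Definition total_abs_prog : cmd := (
  12 ::= $5 / EConst 2 ;; fold_prog 1 (EConst 1) ;;
  abs_prog ;; fold_prog 2 (EConst 1))%prog.

(* A candidate survives unless another one is strictly cheaper; the survivors
   all write their number to the cell -5, where any winner will do. *)
Definition argmin_prog : cmd := (
  CWrite (cell_expr 4 $3) (EConst 0) ;;
  (CRead 10 (cell_expr 2 ($3 * ($5 * $5))) ;;
   CRead 11 (cell_expr 2 ($4 * ($5 * $5))) ;;
   12 ::= $11 < $10) ;;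
  CWrite ($12 * cell_expr 4 $3 + (EConst 1 - $12) * EConst (-6)) (EConst 1) ;;
  (CRead 12 (cell_expr 4 $3) ;;
   12 ::= $12 == EConst 0) ;;
  CWrite ($12 * EConst (-5) + (EConst 1 - $12) * EConst (-6)) $3 ;;
  CRead 14 (EConst (-5)))%prog.

Definition update_prog : cmd := (
  CRead 10 (cell_expr 3 ($14 * ($5 * $5) + $4)) ;;
  CWrite ($0 * $0 + $0 + $4) $10)%prog.

Definition select_prog (cost : cmd) : cmd := (
  sign_prog ;; place_prog ;; cost ;; argmin_prog ;; update_prog)%prog.

Definition upper_half_prog : cmd := (
  11 ::= $4 %% (EConst 2 * $7) ;; 11 ::= $11 * (EConst 1 - ($11 < $7)))%prog.

(** Every processor makes [K] rounds, although only the first [j mod K] of them double register 11: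
    a guard depending on [j] would break the lockstep. *)
Definition digit_prog : cmd := (
  (12 ::= $4 %% $6 ;; 11 ::= EConst 1 ;; 13 ::= $6) ;;
  CWhile (EConst 0 < $13) (
    11 ::= $11 * (EConst 1 + (EConst 0 < $12)) ;;
    12 ::= $12 - (EConst 0 < $12) ;;
    13 ::= $13 - EConst 1))%prog.

Definition merge_prog : cmd := (
  7 ::= $5 / EConst 2 ;;
  CWhile ($6 < $7 + EConst 1) (
    upper_half_prog ;; select_prog potential_prog ;; 7 ::= $7 / EConst 2))%prog.

Definition output_prog : cmd := (
  CRead 10 (cell_expr 1 ($14 * ($5 * $5) + $3 * $5)) ;;
  11 ::= $3 < $0 ;;
  CWrite ($11 * ($0 * $0 + $3) + (EConst 1 - $11) * EConst (-6))
         (EConst 1 - EConst 2 * ($10 < EConst 0)))%prog.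

Definition fork_prog : cmd := (
  1 ::= EConst 2 * $1 ;; CFork 1 ($1 + EConst 1))%prog.

(** Three forks per doubling of [N] activate [N ^ 3] processors. Register 8 counts the doublings,
    hence ends as [l], and [K] becomes the largest power of two up to [l]. *)
Definition setup_prog : cmd := (
  5 ::= EConst 1 ;;
  CWhile ($5 < $0 + EConst 1) (
    (5 ::= EConst 2 * $5 ;; 8 ::= $8 + EConst 1) ;;
    fork_prog ;; fork_prog ;; fork_prog) ;;
  6 ::= EConst 1 ;;
  CWhile (EConst 2 * $6 < $8 + EConst 1) (6 ::= EConst 2 * $6) ;;
  (2 ::= $1 / ($5 * $5) ;; 3 ::= ($1 / $5) %% $5 ;; 4 ::= $1 %% $5) ;;
  CWrite ($0 * $0 + $0 + $4) ($4 < $0))%prog.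

Definition main_prog : cmd := (
  setup_prog ;; merge_prog ;;
  digit_prog ;; select_prog total_abs_prog ;; output_prog)%prog.

(** * Execution of the parts *)

Definition same_regs M (off : seq nat) (rg rg' : nat -> nat -> int) : Prop :=
  forall p, (p < M)%N -> forall i, i \notin off -> rg' p i = rg p i.

Lemma same_regs_trans M off rg1 rg2 rg3 :
  same_regs M off rg1 rg2 -> same_regs M off rg2 rg3 -> same_regs M off rg1 rg3.
Proof. by move=> h1 h2 p pM i io; rewrite h2 // h1. Qed.

Lemma same_regsW M off off' rg1 rg2 : {subset off <= off'} ->
  same_regs M off rg1 rg2 -> same_regs M off' rg1 rg2.
Proof. by move=> h h1 p pM i io; apply: h1 => //; apply: contra io => /h. Qed.

Lemma same_regs_upd M off rg rg' i v : i \in off ->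
  same_regs M off rg rg' -> same_regs M off rg (fun p => upd (rg' p) i (v p)).
Proof.
move=> io h p pM j jo; rewrite /upd; case: eqP => [ji|_]; last exact: h.
by rewrite ji io in jo.
Qed.

Definition pow2 (e : nat) : nat := (2 ^ e)%N.

Lemma pow2_gt0 e : (0 < pow2 e)%N. Proof. by rewrite /pow2 expn_gt0. Qed.

(** Costs are compared as integers, and the largest, the total potential, is of order [N ^ 8]. The
    bound [512 N ^ 10] leaves room and is exactly what [word_size 9] provides. *)
Definition admissible (n l k b : nat) : Prop :=
  [/\ (0 < n)%N, (n < 2 ^ l)%N, (k <= l)%N, (0 < b)%N & (512 * 2 ^ (10 * l) <= 2 ^ b.-1)%N].

Lemma sum_class K m H p (q : nat -> int) : (p < K)%N -> (H <= m * K)%N ->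
  \sum_(t < m) (if (p + t * K < H)%N then q (p + t * K)%N else 0)
  = \sum_(c < H | (c %% K == p)%N) q c.
Proof.
move=> pK HmK; pose F c := if (c %% K == p)%N && (c < H)%N then q c else 0.
transitivity (\sum_(c < m * K) F c).
  rewrite sum_blocks (bigD1 (Ordinal pK)) //= [X in _ + X]big1 ?addr0 => [|i ip].
    by apply: eq_bigr => t _; rewrite /F addnC modnMDl modn_small // eqxx addnC.
  rewrite big1 // => t _; rewrite /F addnC modnMDl modn_small //.
  by rewrite (_ : (i == p :> nat) = false) //; apply: contraNF ip => /eqP e; apply/eqP/val_inj.
rewrite -(subnKC HmK) big_split_ord /= [X in _ + X]big1 ?addr0 => [|c _].
  by rewrite [RHS]big_mkcond; apply: eq_bigr => c _; rewrite /F ltn_ord andbT.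
by rewrite /F ltnNge leq_addr andbF.
Qed.

(** The identity behind the distributed evaluation of the potential. The total energy is available
    in column 0 only, hence the guards [j < 1]. *)
Lemma potential_columns l k h n (L Q S : nat -> int) V : (k <= h <= l)%N ->
  (forall j, Q j = if (j < 2 ^ h)%N then L j ^+ 2 else 0) ->
  (forall j, S j = if (j < 2 ^ k)%N then \sum_(t < 2 ^ (l - k)) Q (j + t * 2 ^ k)%N else 0) ->
  V = \sum_(j < 2 ^ l) S j ->
  \sum_(j < 2 ^ l) (- 2 * n%:Z * Q j - 4 * Q j * Q j + 5 * S j * S j
    + (if (j < 1)%N then V else 0) * (if (j < 1)%N then V else 0))
  = potential (2 ^ k) n (2 ^ h) L.
Proof.
move=> /andP[kh hl] hQ hS hV.
have cut e (F : nat -> int) : (e <= l)%N ->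
    \sum_(j < 2 ^ l) (if (j < 2 ^ e)%N then F j else 0) = \sum_(j < 2 ^ e) F j.
  move=> el; have le : (2 ^ e <= 2 ^ l)%N by rewrite leq_exp2l.
  rewrite -(subnKC le) big_split_ord /= [X in _ + X]big1 ?addr0 => [|c _].
    by apply: eq_bigr => c _; rewrite ltn_ord.
  by rewrite ltnNge leq_addr.
have SE p : (p < 2 ^ k)%N -> S p = class_energy (2 ^ k) (2 ^ h) L p.
  move=> pk; rewrite hS pk /class_energy -(@sum_class _ (2 ^ (l - k)) _ _ (fun c => L c ^+ 2)) //.
    by apply: eq_bigr => t _; rewrite hQ.
  by rewrite -expnD subnK ?leq_exp2l //; lia.
have VE : V = energy (2 ^ h) L.
  rewrite hV (eq_bigr (fun j : 'I__ => if (j < 2 ^ k)%N then class_energy (2 ^ k) (2 ^ h) L j else 0)).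
    rewrite (cut k (class_energy (2 ^ k) (2 ^ h) L)); last by lia.
    have K0 : (0 < 2 ^ k)%N by rewrite expn_gt0.
    by rewrite /energy (partition_big (fun c : 'I_(2 ^ h) => Ordinal (ltn_pmod c K0)) xpredT).
  by move=> j _; case: ifP => jk; [exact: SE | rewrite hS jk].
rewrite !big_split /= sumrN.
rewrite (eq_bigr (fun j : 'I__ => if (j < 2 ^ h)%N then - 2 * n%:Z * L j ^+ 2 else 0)); last first.
  by move=> j _; rewrite hQ; case: ifP => _; rewrite ?mulr0.
rewrite (cut h (fun j => - 2 * n%:Z * L j ^+ 2)) // -mulr_sumr.
rewrite [X in _ - X](eq_bigr (fun j : 'I__ => if (j < 2 ^ h)%N then 4 * L j ^+ 4 else 0)); last first.
  by move=> j _; rewrite hQ; case: ifP => _; rewrite ?mulr0 //; ring.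
rewrite (cut h (fun j => 4 * L j ^+ 4)) // -mulr_sumr.
rewrite [X in _ + X + _](eq_bigr (fun j : 'I__ => if (j < 2 ^ k)%N then
   5 * class_energy (2 ^ k) (2 ^ h) L j ^+ 2 else 0)); last first.
  by move=> j _; case: ifP => jk; [rewrite SE // expr2 mulrA | rewrite hS jk mulr0].
rewrite (cut k (fun j => 5 * class_energy (2 ^ k) (2 ^ h) L j ^+ 2)) ?(leq_trans kh) // -mulr_sumr.
rewrite [X in _ + X](eq_bigr (fun j : 'I__ => if (j < 2 ^ 0)%N then V ^+ 2 else 0)); last first.
  by move=> j _; rewrite expn0; case: ifP => _; rewrite ?mulr0 // expr2.
rewrite (cut 0%N (fun=> V ^+ 2)) // big_ord1 VE /potential /energy.
ring.
Qed.

(** * Word bounds, processor digits and the specifications of the parts *)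

Section Run.

Variables (n l k b : nat).
Hypothesis (ok : admissible n l k b).

Local Notation N := (pow2 l).
Local Notation K := (pow2 k).
Local Notation M := (pow2 (3 * l)).
Local Notation B := (pow2 b.-1).

Lemma M_eq : M = (N * N * N)%N.
Proof. by rewrite /pow2 -!expnD; congr (2 ^ _)%N; lia. Qed.

Lemma n_lt_N : (n < N)%N. Proof. by case: ok. Qed.

Lemma N_ge2 : (2 <= N)%N.
Proof. by have := n_lt_N; case: ok; lia. Qed.

Lemma N_gt0 : (0 < N)%N. Proof. exact: pow2_gt0. Qed.

Lemma K_le_N : (K <= N)%N. Proof. by rewrite /pow2 leq_exp2l //; case: ok. Qed.

Lemma NN_le_M : (N * N <= M)%N.
Proof. by rewrite M_eq leq_pmulr // N_gt0. Qed.

Lemma N_le_M : (N <= M)%N.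
Proof. by apply: leq_trans NN_le_M; rewrite leq_pmulr // N_gt0. Qed.

Lemma word_bound : (512 * (N * N * N * N * N * N * N * N * N * N) <= B)%N.
Proof.
case: ok => _ _ _ _; apply: leq_trans; rewrite leq_mul2l /=.
by rewrite /pow2 -!expnD; apply/eq_leq; congr (2 ^ _)%N; lia.
Qed.

Lemma word_boundM : (64 * M + 64 <= B)%N.
Proof.
rewrite M_eq; apply: leq_trans word_bound; have := N_ge2.
move: (N) (B) => u w u2.
have : (1 <= u * u * u)%N by rewrite !muln_gt0; lia.
move: (u * u * u)%N => v v1.
have : (v <= v * u * u * u * u * u * u * u)%N by rewrite -!mulnA leq_pmulr // !muln_gt0; lia.
move: (v * u * u * u * u * u * u * u)%N => ?; lia.
Qed.

Lemma word_bound8 : (64 * (N * N * N * N * N * N * N * N) <= B)%N.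
Proof.
apply: leq_trans word_bound; have := N_ge2; move: (N) (B) => u w u2.
move: (u * u * u * u * u * u * u * u)%N => v.
have : (v <= v * u * u)%N by rewrite -!mulnA leq_pmulr // !muln_gt0; lia.
move: (v * u * u)%N => ?; lia.
Qed.

Lemma word_int (z : int) : `|z| < B%:Z -> to_word b z = z.
Proof.
move=> h; apply: to_word_small; last by case: ok.
have -> : (2 : int) ^+ b.-1 = B%:Z by rewrite -natz natrX.
by apply/andP; split; lia.
Qed.

Lemma word_const z : `|z| <= 64 -> to_word b z = z.
Proof.
move=> h; apply: word_int; have := word_boundM; have := pow2_gt0 (3 * l).
by move: (M) (B); lia.
Qed.

Lemma word_bool (c : bool) : to_word b (if c then 1 else 0) = if c then 1 else 0.
Proof. by case: c; rewrite word_const. Qed.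

Lemma wordM (m : nat) : (m <= 2 * M)%N -> to_word b m%:Z = m%:Z.
Proof.
by move=> h; apply: word_int; have := word_boundM; move: (M) (B) h; lia.
Qed.

Lemma wordN (m : nat) : (m <= N)%N -> to_word b m%:Z = m%:Z.
Proof.
move=> h; apply: wordM; apply: leq_trans h _; apply: leq_trans N_le_M _.
exact: leq_pmull.
Qed.

Definition A_ (p : nat) := (p %/ (N * N))%N.
Definition I_ (p : nat) := ((p %/ N) %% N)%N.
Definition J_ (p : nat) := (p %% N)%N.
Definition idx (a i j : nat) := ((a * N + i) * N + j)%N.

Lemma A_lt p : (p < M)%N -> (A_ p < N)%N.
Proof. by rewrite M_eq -mulnA => h; rewrite /A_ ltn_divLR // muln_gt0 N_gt0. Qed.

Lemma I_lt p : (I_ p < N)%N. Proof. exact/ltn_pmod/N_gt0. Qed.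
Lemma J_lt p : (J_ p < N)%N. Proof. exact/ltn_pmod/N_gt0. Qed.

Lemma idxK p : idx (A_ p) (I_ p) (J_ p) = p.
Proof.
rewrite /idx /A_ /I_ /J_ divnMA -divn_eq -divn_eq //.
Qed.

Lemma idx_lt a i j : (a < N)%N -> (i < N)%N -> (j < N)%N -> (idx a i j < M)%N.
Proof. rewrite M_eq /idx; nia. Qed.

Lemma A_idx a i j : (i < N)%N -> (j < N)%N -> A_ (idx a i j) = a.
Proof.
move=> iN jN; rewrite /A_ /idx divnMA divnMDl ?N_gt0 // (divn_small jN) addn0.
by rewrite divnMDl ?N_gt0 // (divn_small iN) addn0.
Qed.

Lemma I_idx a i j : (i < N)%N -> (j < N)%N -> I_ (idx a i j) = i.
Proof.
move=> iN jN; rewrite /I_ /idx divnMDl ?N_gt0 // (divn_small jN) addn0.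
by rewrite modnMDl modn_small.
Qed.

Lemma J_idx a i j : (j < N)%N -> J_ (idx a i j) = j.
Proof. by move=> jN; rewrite /J_ /idx modnMDl modn_small. Qed.

Record env_at (r : nat -> int) (p : nat) : Prop := EnvAt {
  env0 : r 0%N = n%:Z; env1 : r 1%N = p%:Z; env2 : r 2%N = (A_ p)%:Z;
  env3 : r 3%N = (I_ p)%:Z; env4 : r 4%N = (J_ p)%:Z;
  env5 : r 5%N = N%:Z; env6 : r 6%N = K%:Z }.

Definition env (rg : nat -> nat -> int) := forall p, (p < M)%N -> env_at (rg p) p.

Lemma env_same off rg rg' : all (fun i => 6 < i)%N off ->
  same_regs M off rg rg' -> env rg -> env rg'.
Proof.
move=> ho hs he p pM; have [? ? ? ? ? ? ?] := he p pM.
have h i : (i <= 6)%N -> rg' p i = rg p i.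
  move=> i6; apply: hs => //; apply/negP => io.
  by move/allP: ho => /(_ _ io); rewrite ltnNge i6.
by split; rewrite h.
Qed.

Lemma eval_cell q e r p : raw_expr b r e = p%:Z -> (q < 8)%N -> (p < 2 * M)%N ->
  eval_expr b r (cell_expr q e) = cell q p.
Proof.
move=> he q8 pM; rewrite evalE /= he word_int //.
by have := word_boundM; move: (M) (B) pM; lia.
Qed.

Lemma eval_own_cell q r p : env_at r p -> (p < M)%N -> (q < 8)%N ->
  eval_expr b r (cell_expr q (EReg 1)) = cell q p.
Proof.
move=> e pM q8; apply: eval_cell => //; first exact: env1 e.
by apply: leq_trans pM _; rewrite leq_pmull.
Qed.

Lemma cell_inj q q' p p' : (q < 8)%N -> (q' < 8)%N -> cell q p = cell q' p' -> q = q' /\ p = p'.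
Proof. rewrite /cell; lia. Qed.

Lemma sign_spec s (x : nat -> nat) :
  env s.1 -> (forall p, (p < M)%N -> s.1 p 11 = (x p)%:Z /\ (x p < N)%N) ->
  reaches b M sign_prog s (10 * l + 10) M (fun s' =>
    [/\ s'.2 = s.2, same_regs M [:: 8; 10; 11; 12] s.1 s'.1
      & forall p, (p < M)%N -> s'.1 p 8 = walsh l (A_ p) (x p)]).
Proof.
move=> he hx.
(* The accumulated sign times the Walsh function of the unread bits is constant. *)
pose I (u : nat) (s' : state) := [/\ s'.2 = s.2,
  same_regs M [:: 8; 10; 11; 12] s.1 s'.1 &
  forall p, (p < M)%N -> [/\ s'.1 p 10 = (A_ p %/ 2 ^ u)%N%:Z,
    s'.1 p 11 = (x p %/ 2 ^ u)%N%:Z, s'.1 p 12 = (2 ^ (l - u))%N%:Z,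
    s'.1 p 8 = 1 \/ s'.1 p 8 = -1 &
    s'.1 p 8 * walsh (l - u) (A_ p %/ 2 ^ u) (x p %/ 2 ^ u) = walsh l (A_ p) (x p)]].
apply: (@reaches_weaken _ _ _ _ (5 + (l * 8).+1).+1 _ _ (I l)); last 1 first.
- apply: (reaches_seq (Q := I 0%N)).
    apply: reaches_straight => //; split=> //; first by do !apply: same_regs_upd.
    move=> p pM; have [xp xN] := hx p pM; rewrite /= /upd /= !evalE !divn1 subn0.
    rewrite (env2 (he p pM)) (env5 (he p pM)) xp word_const //.
    by split; [| | | left | rewrite mul1r].
  move=> s1 Is1; apply: (triple_while (M := fun=> M)) Is1.
  + move=> u s2 p ul [_ _ h2] pM; have [_ _ h12 _ _] := h2 p pM.
    rewrite !evalE /= !evalE h12 word_bool word_const // ltz_nat.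
    by rewrite -{1}(expn0 2) ltn_exp2l // subn_gt0 ul.
  + move=> s2 p [_ _ h2] pM; have [_ _ h12 _ _] := h2 p pM.
    by rewrite !evalE /= !evalE h12 subnn word_bool word_const.
  move=> u ul; apply: triple_straight => // s2 [m2 rs2 h2].
  split=> //; first by do !apply: same_regs_upd.
  move=> p pM; have [h10 h11 h12 h8 hw] := h2 p pM; rewrite /= /upd /=.
  have [xp xN] := hx p pM; have aN := A_lt pM.
  rewrite !evalE /= !evalE !(word_const (z := 2)) // h10 h11 h12.
  rewrite !divz_nat !modz_nat !modn2.
  rewrite -[(1 + 1)%N]/2%N.
  have half m : (m %/ 2 ^ u %/ 2 = m %/ 2 ^ u.+1)%N by rewrite -divnMA -expnSr.
  have lu : (l - u = (l - u.+1).+1)%N by lia.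
  have e3 : (2 ^ (l - u) %/ 2 = 2 ^ (l - u.+1))%N by rewrite lu expnS mulKn.
  rewrite !half e3.
  have aM m : (m < N)%N -> (m %/ 2 ^ u.+1 <= N)%N.
    by move=> mN; apply: leq_trans (leq_div _ _) (ltnW mN).
  rewrite !wordN ?aM //; last by rewrite leq_exp2l // leq_subr.
  move: hw; rewrite lu /= -!divn2 !half => <-.
  by case: h8 => ->; case: (odd _); case: (odd _); rewrite word_const //;
    split=> //; (try by [left | right]); rewrite /=; ring.
- by move=> s' [m' rs' h']; split=> // p pM; have [_ _ _ _] := h' p pM; rewrite subnn /= mulr1.
- lia.
Qed.

(** The frame condition on memory, counterpart of [same_regs]: only work arrays in [qs] may
    change. *)
Definition only (qs : seq nat) (m m' : int -> int) : Prop :=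
  forall x, (forall q p, q \in qs -> (p < M)%N -> x <> cell q p) -> m' x = m x.

Lemma only_trans qs m1 m2 m3 : only qs m1 m2 -> only qs m2 m3 -> only qs m1 m3.
Proof. by move=> h1 h2 x hx; rewrite h2 // h1. Qed.

Lemma onlyW qs qs' m m' : {subset qs <= qs'} -> only qs m m' -> only qs' m m'.
Proof. by move=> h h1 x hx; apply: h1 => q p /h; exact: hx. Qed.

Lemma only_nat qs m m' (x : nat) : only qs m m' -> 0%N \notin qs -> m' x%:Z = m x%:Z.
Proof.
move=> h q0; apply: h => q p qq pM; have : q != 0%N by apply: contraNneq q0 => <-.
rewrite /cell; lia.
Qed.

Lemma only_cell qs m m' q p : only qs m m' ->
  q \notin qs -> (q < 8)%N -> all (fun i => i < 8)%N qs ->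
  m' (cell q p) = m (cell q p).
Proof.
move=> h qq q8 /allP h8; apply: h => q' p' q'q _ /cell_inj[] //; first exact: h8.
by move=> e _; move: qq; rewrite e q'q.
Qed.

Lemma write_cell q fa fv m p : (q < 8)%N -> (forall p, (p < M)%N -> fa p = cell q p) ->
  (p < M)%N -> write_all M fa fv m (cell q p) = fv p.
Proof.
move=> q8 h pM; rewrite -(h p pM) write_all_hit // => p' p'M.
by rewrite !h // => /cell_inj[] // _ ->.
Qed.

Lemma only_write q fa fv m : (forall p, (p < M)%N -> fa p = cell q p) ->
  only [:: q] m (write_all M fa fv m).
Proof.
move=> h x hx; apply: write_all_miss => p pM; rewrite h // => e.
by apply: (hx q p); rewrite ?inE.
Qed.

Lemma reaches_write q a e v s : (q < 8)%N ->
  (forall p, (p < M)%N -> eval_expr b (s.1 p) a = cell q p) ->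
  (forall p, (p < M)%N -> eval_expr b (s.1 p) e = v p) ->
  reaches b M (CWrite a e) s 1 M (fun s' =>
    [/\ s'.1 = s.1, only [:: q] s.2 s'.2
      & forall p, (p < M)%N -> s'.2 (cell q p) = v p]).
Proof.
move=> q8 ha hv; apply: reaches_straight => //; split=> //=.
  exact: only_write.
by move=> p pM; rewrite write_cell // hv.
Qed.

Lemma reaches_read i a w s :
  (forall p, (p < M)%N -> eval_expr b (s.1 p) a = w p) ->
  reaches b M (CRead i a) s 1 M (fun s' =>
    [/\ s'.2 = s.2, same_regs M [:: i] s.1 s'.1
      & forall p, (p < M)%N -> s'.1 p i = s.2 (w p)]).
Proof.
move=> ha; apply: reaches_straight => //; split=> //=.
  by apply: same_regs_upd; rewrite ?inE.
by move=> p pM; rewrite /upd eqxx ha.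
Qed.

Lemma reaches_assign i e v s :
  (forall p, (p < M)%N -> eval_expr b (s.1 p) e = v p) ->
  reaches b M (CAssign i e) s 1 M (fun s' =>
    [/\ s'.2 = s.2, same_regs M [:: i] s.1 s'.1
      & forall p, (p < M)%N -> s'.1 p i = v p]).
Proof.
move=> ha; apply: reaches_straight => //; split=> //=.
  by apply: same_regs_upd; rewrite ?inE.
by move=> p pM; rewrite /upd eqxx ha.
Qed.

Variable (A : nat -> nat -> int).

Definition input_ok (m : int -> int) : Prop :=
  forall i j, (i < n)%N -> (j < n)%N -> m (i * n + j)%N%:Z = A i j.

Definition signs_ok (y : nat -> int) (m : int -> int) : Prop :=
  forall j, (j < N)%N -> m (n * n + n + j)%N%:Z = y j.

Definition padded (i j : nat) : int := if (i < n)%N && (j < n)%N then A i j else 0.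

Lemma idx_small i j : (i < N)%N -> (j < N)%N -> (i * n + j <= 2 * M)%N.
Proof.
move=> iN jN; have := n_lt_N; have := NN_le_M.
by move: (N) (M) iN jN => u v iN jN; nia.
Qed.

Lemma offset_small j : (j < N)%N -> (n * n + n + j <= 2 * M)%N.
Proof.
move=> jN; have := n_lt_N; have := NN_le_M; have := N_ge2.
by move: (N) (M) jN => u v jN; nia.
Qed.

Lemma place_spec s y (sg : nat -> int) :
  env s.1 -> input_ok s.2 -> signs_ok y s.2 ->
  (forall j, (n <= j)%N -> y j = 0) ->
  (forall p, (p < M)%N -> s.1 p 8 = sg p) ->
  reaches b M place_prog s 9 M (fun s' =>
    [/\ same_regs M [:: 10; 11] s.1 s'.1, only [:: 1%N; 3%N] s.2 s'.2,
      forall p, (p < M)%N ->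
        s'.2 (cell 1 p) = to_word b (padded (I_ p) (J_ p) * (y (J_ p) * sg p))
      & forall p, (p < M)%N -> s'.2 (cell 3 p) = to_word b (y (J_ p) * sg p)]).
Proof.
move=> he hA hy y0 h8.
apply: (@reaches_weaken _ _ _ _ (5 + (1 + 1).+1).+1 _ _ _ _ (fun s' h => h)) => //.
apply: (reaches_seq (Q := fun s1 => [/\ same_regs M [:: 10; 11] s.1 s1.1, s1.2 = s.2,
    forall p, (p < M)%N -> s1.1 p 10 = s.2 (I_ p * n + J_ p)%N%:Z &
    forall p, (p < M)%N -> s1.1 p 11 = to_word b (y (J_ p) * sg p)])).
  apply: reaches_straight => //; split=> //=.
  - by do !apply: same_regs_upd.
  - move=> p pM; have e := he p pM; rewrite /upd /= evalE /= (env3 e) (env0 e) (env4 e).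
    by rewrite -!PoszM -!PoszD wordM // idx_small ?I_lt ?J_lt.
  - move=> p pM; have e := he p pM; rewrite /upd /= !evalE /= (env0 e) (env4 e) h8 //.
    by rewrite -!PoszM -!PoszD wordM ?offset_small ?J_lt // hy ?J_lt.
move=> s1 [rs1 m1 h10 h11].
have he1 : env s1.1 by apply: env_same rs1 he.
apply: (reaches_seq (Q := fun s2 => [/\ s2.1 = s1.1, only [:: 3%N] s.2 s2.2 &
    forall p, (p < M)%N -> s2.2 (cell 3 p) = to_word b (y (J_ p) * sg p)])).
  rewrite -m1; apply: reaches_write => // p pM.
    exact: eval_own_cell (he1 p pM) pM _.
move=> s2 [rs2 o2 h3].
have hw := @reaches_write 1 (cell_expr 1 (EReg 1))
   (EBin OpMul (EBin OpLt (EReg 3) (EReg 0)) (EBin OpMul (EReg 10) (EReg 11)))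
   (fun p => to_word b (padded (I_ p) (J_ p) * (y (J_ p) * sg p))) s2.
apply: reaches_weaken (hw _ _ _) => // [s3 [rs3 o3 h1]|p pM|p pM].
- split=> //; first by rewrite rs3 rs2.
  + apply: only_trans (onlyW _ o2) (onlyW _ o3) => q; rewrite !inE => ->; rewrite ?orbT //.
  + by move=> p pM; rewrite (only_cell p o3) // h3.
- by rewrite rs2; exact: eval_own_cell (he1 p pM) pM _.
rewrite !evalE /= !evalE rs2 (env3 (he1 p pM)) (env0 (he1 p pM)) h10 // h11 // ltz_nat.
rewrite mulrA to_wordMr /padded; congr to_word.
(* Whatever was read outside the matrix is cancelled: for rows beyond [n] by the comparison, for
   columns beyond [n] by the sign 0. *)
have [iN|iN] := ltnP (I_ p) n; last by rewrite !mul0r.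
have [jN|jN] := ltnP (J_ p) n; last by rewrite y0 // !(mul0r, mulr0).
by rewrite hA // mul1r.
Qed.

(** Adding in place is safe because all processors finish reading before any of them writes. The
    condition on [p] says that its window ends before [M]; sums hold modulo [2 ^ b]. *)
Lemma fold_spec q lo e f (X : nat -> int) s :
  (0 < q < 8)%N -> (f <= e <= 2 * l)%N -> env s.1 ->
  (forall p, (p < M)%N -> s.1 p 12 = (2 ^ e %/ 2)%N%:Z) ->
  (forall rg, same_regs M [:: 10; 11; 12] s.1 rg ->
     forall p, (p < M)%N -> eval_expr b (rg p) lo = (2 ^ f)%N%:Z) ->
  (forall p, (p < M)%N -> s.2 (cell q p) = to_word b (X p)) ->
  reaches b M (fold_prog q lo) s (20 * l + 1) M (fun s' =>
    [/\ same_regs M [:: 10; 11; 12] s.1 s'.1, only [:: q] s.2 s'.2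
      & forall p, (p + (2 ^ (e - f)).-1 * 2 ^ f < M)%N ->
          s'.2 (cell q p) = to_word b (\sum_(t < 2 ^ (e - f)) X (p + t * 2 ^ f)%N)]).
Proof.
move=> /andP[q0 q8] /andP[fe el] he h12 hlo hX.
pose I u (s' : state) := [/\ same_regs M [:: 10; 11; 12] s.1 s'.1, only [:: q] s.2 s'.2,
  forall p, (p < M)%N -> s'.1 p 12 = (2 ^ (e - u) %/ 2)%N%:Z
  & forall p, (p + (2 ^ u).-1 * 2 ^ (e - u) < M)%N ->
      s'.2 (cell q p) = to_word b (\sum_(t < 2 ^ u) X (p + t * 2 ^ (e - u))%N)].
have eN u : (2 ^ (e - u) <= M)%N by rewrite /pow2 leq_exp2l //; lia.
apply: (@reaches_weaken _ _ _ _ ((e - f) * 9.+1).+1 _ _ (I (e - f)%N)).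
- move=> s' [h1 h2 h3 h4]; split=> // p pM; have ff : (e - (e - f) = f)%N by lia.
  by have := h4 p; rewrite ff; apply.
- lia.
have I0 : I 0%N s.
  split=> //; first by move=> p pM; rewrite subn0 h12.
  by move=> p; rewrite expn0 mul0n addn0 => pM; rewrite hX // big_ord1 mul0n addn0.
apply: (triple_while (M := fun=> M)) I0.
- move=> u s1 p ul [rs o h3 _] pM.
  rewrite evalE /= (hlo _ rs p pM) evalE /= (h3 p pM) word_bool -PoszD.
  rewrite wordM; last first.
    by apply: leq_trans (leq_add (leq_div _ _) (pow2_gt0 (3 * l))) _; rewrite mul2n -addnn leq_add2r.
  have -> : (e - u = (e - u).-1.+1)%N by lia.
  rewrite expnS mulKn // ltz_nat addn1 ltnS leq_exp2l //.
  by rewrite ifT //; lia.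
- move=> s1 p [rs o h3 _] pM.
  rewrite evalE /= (hlo _ rs p pM) evalE /= (h3 p pM) word_bool -PoszD.
  rewrite wordM; last first.
    by apply: leq_trans (leq_add (leq_div _ _) (pow2_gt0 (3 * l))) _; rewrite mul2n -addnn leq_add2r.
  rewrite ltz_nat addn1 ltnS (_ : e - (e - f) = f)%N; last by lia.
  by rewrite leqNgt (ltn_Pdiv) // expn_gt0.
move=> u ul s1 [rs o h3 h4].
have eu : (e - u = (e - u.+1).+1)%N by lia.
have half : (2 ^ (e - u) %/ 2 = 2 ^ (e - u.+1))%N by rewrite eu expnS mulKn.
set h := (2 ^ (e - u.+1))%N in half *.
have hM : (h <= M)%N by apply: eN.
have he1 : env s1.1 by apply: env_same rs he.
apply: (@reaches_weaken _ _ _ _ (3 + (1 + 1).+1).+1 _ _ _ _ (fun s' hh => hh)) => //.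
apply: (reaches_seq (Q := fun s2 => [/\ same_regs M [:: 10; 11; 12] s.1 s2.1, s2.2 = s1.2,
   forall p, (p < M)%N -> s2.1 p 12 = h%:Z,
   forall p, (p < M)%N -> s2.1 p 10 = s1.2 (cell q p)
   & forall p, (p < M)%N -> s2.1 p 11 = s1.2 (cell q (p + h))])).
  apply: reaches_straight => //; split=> //=.
  - by do !apply: same_regs_upd.
  - by move=> p pM; rewrite /upd /= h3 // half.
  - by move=> p pM; rewrite /upd /= (eval_own_cell (he1 p pM)).
  move=> p pM; rewrite /upd /= (@eval_cell q _ _ (p + h)%N) //.
    by rewrite /= (env1 (he1 p pM)) h3 // half.
  by rewrite mul2n -addnn; apply: leq_trans (leq_add pM hM).
move=> s2 [rs2 m2 r12 r10 r11].
have he2 : env s2.1 by apply: env_same rs2 he.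
apply: (reaches_seq (Q := fun s3 => [/\ s3.1 = s2.1, only [:: q] s1.2 s3.2
   & forall p, (p < M)%N -> s3.2 (cell q p)
       = to_word b (s1.2 (cell q p) + s1.2 (cell q (p + h)))])).
  rewrite -m2; apply: reaches_write => // p pM; first exact: eval_own_cell (he2 p pM) pM _.
  by rewrite evalE /= r10 // r11 // m2.
move=> s3 [rs3 o3 h5].
apply: reaches_straight => //; split=> /=.
- by apply: same_regs_upd => //; rewrite rs3.
- exact: only_trans o o3.
- move=> p pM; rewrite /upd /= rs3 evalE /= evalE r12 // evalE (word_const (z := 2)) //.
  by rewrite divz_nat wordM // (leq_trans (leq_div _ _)) // (leq_trans hM) // leq_pmull.
move=> p.
have e2 : (2 ^ u.+1 = (2 ^ u).*2)%N by rewrite expnS mul2n.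
have eh : (2 ^ (e - u) = h.*2)%N by rewrite eu expnS mul2n.
have u0 : (0 < 2 ^ u)%N by rewrite expn_gt0.
rewrite -/h e2 => pM.
have hh p' : (p' <= p + h)%N -> (p' + (2 ^ u).-1 * 2 ^ (e - u) < M)%N.
  move=> p'p; apply: leq_ltn_trans pM; rewrite eh.
  apply: leq_trans (leq_add p'p (leqnn _)) _; move: (2 ^ u)%N u0 => [//|v] _.
  by rewrite /= -addnA leq_add2l; lia.
rewrite h5; last first.
  by apply: leq_ltn_trans (hh p _); rewrite ?leq_addr.
rewrite !h4 ?hh ?leq_addr // to_wordDl to_wordDr (sum_parity _ (fun t => X (p + t * h)%N)).
rewrite big_split /=; congr (to_word b (_ + _)); apply: eq_bigr => t _; congr X; rewrite eh; lia.
Qed.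

(** A shift that stays inside a row changes only the last digit, so folds over columns mix neither
    rows nor candidates. *)
Lemma window p u : (p < M)%N -> (J_ p + u < N)%N ->
  [/\ (p + u < M)%N, A_ (p + u) = A_ p, I_ (p + u) = I_ p & J_ (p + u) = J_ p + u]%N.
Proof.
move=> pM Ju; have e : (p + u = idx (A_ p) (I_ p) (J_ p + u))%N.
  by rewrite -{1}(idxK p) /idx addnA.
rewrite e A_idx ?I_idx ?J_idx ?I_lt //; split=> //.
by rewrite idx_lt ?A_lt ?I_lt.
Qed.

Lemma fold_columns lo f (X : nat -> nat -> nat -> int) s :
  (f <= l)%N -> env s.1 ->
  (forall p, (p < M)%N -> s.1 p 12 = (N %/ 2)%N%:Z) ->
  (forall rg, same_regs M [:: 10; 11; 12] s.1 rg ->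
     forall p, (p < M)%N -> eval_expr b (rg p) lo = (2 ^ f)%N%:Z) ->
  (forall p, (p < M)%N -> s.2 (cell 1 p) = to_word b (X (A_ p) (I_ p) (J_ p))) ->
  reaches b M (fold_prog 1 lo) s (20 * l + 1) M (fun s' =>
    [/\ same_regs M [:: 10; 11; 12] s.1 s'.1, only [:: 1%N] s.2 s'.2
      & forall p, (p < M)%N -> (J_ p < 2 ^ f)%N ->
          s'.2 (cell 1 p) =
          to_word b (\sum_(t < 2 ^ (l - f)) X (A_ p) (I_ p) (J_ p + t * 2 ^ f)%N)]).
Proof.
move=> fl he h12 hlo hX.
have lM : (f <= l <= 2 * l)%N by rewrite fl leq_pmull.
apply: reaches_weaken (fold_spec (X := fun p => X (A_ p) (I_ p) (J_ p)) _ lM he h12 hlo hX) => //.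
move=> s' [rs o h]; split=> // p pM Jf.
have win t : (t < 2 ^ (l - f))%N -> (J_ p + t * 2 ^ f < N)%N.
  have e : (N = 2 ^ (l - f) * 2 ^ f)%N by rewrite /pow2 -expnD subnK.
  rewrite e => tl; apply: (@leq_trans (t.+1 * 2 ^ f)); last by rewrite leq_mul2r tl orbT.
  by rewrite mulSnr addnC ltn_add2l.
have last : ((2 ^ (l - f)).-1 < 2 ^ (l - f))%N by rewrite prednK // expn_gt0.
rewrite h; last by have [] := window pM (win _ last).
congr (to_word b _); apply: eq_bigr => t _.
by have [_ -> -> ->] := window pM (win t (ltn_ord t)).
Qed.

Lemma half_small m : (m <= M)%N -> to_word b (m%:Z %/ to_word b 2)%Z = (m %/ 2)%N%:Z.
Proof.
move=> h; rewrite (word_const (z := 2)) // divz_nat wordM //.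
by apply: leq_trans (leq_div _ _) (leq_trans h _); rewrite leq_pmull.
Qed.

Lemma squares_spec s h (X : nat -> nat -> nat -> int) :
  env s.1 -> (h <= l)%N -> (forall p, (p < M)%N -> s.1 p 7 = (2 ^ h)%N%:Z) ->
  (forall p, (p < M)%N -> (J_ p < 2 ^ h)%N ->
     s.2 (cell 1 p) = to_word b (X (A_ p) (I_ p) (J_ p))) ->
  let Q a i j := if (j < 2 ^ h)%N then X a i j ^+ 2 else 0 in
  reaches b M squares_prog s 11 M (fun s' =>
    [/\ same_regs M [:: 10; 12; 13] s.1 s'.1, only [:: 1%N] s.2 s'.2,
      forall p, (p < M)%N -> s'.1 p 12 = (N %/ 2)%N%:Z,
      forall p, (p < M)%N -> s'.2 (cell 1 p) = to_word b (Q (A_ p) (I_ p) (J_ p))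
      & forall p, (p < M)%N -> let q := Q (A_ p) (I_ p) (J_ p) in
          s'.1 p 13 = to_word b (- 2 * n%:Z * q - 4 * q * q)]).
Proof.
move=> he hl h7 hX Q; apply: (@reaches_weaken _ _ _ _ (1 + (5 + (1 + 1).+1).+1).+1 _ _ _ _ (fun s' hh => hh)) => //.
apply: reaches_seq; first by apply: (@reaches_read _ _ (cell 1)) => p pM; exact: eval_own_cell (he p pM) pM _.
move=> s1 [m1 rs1 r10]; have he1 : env s1.1 by apply: env_same rs1 he.
have h7' p : (p < M)%N -> s1.1 p 7 = (2 ^ h)%N%:Z by move=> pM; rewrite rs1 // h7.
have v10 p : (p < M)%N -> to_word b (s1.1 p 10 * (if (J_ p)%:Z < (2 ^ h)%N%:Z then 1 else 0))
     = to_word b (if (J_ p < 2 ^ h)%N then X (A_ p) (I_ p) (J_ p) else 0).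
  move=> pM; rewrite r10 // ltz_nat; case: ifP => Jh; rewrite ?mulr0 // mulr1 hX //.
  exact: to_word_id.
have sq p : (p < M)%N ->
    to_word b (to_word b (s1.1 p 10 * (if (J_ p)%:Z < (2 ^ h)%N%:Z then 1 else 0)) *
       to_word b (s1.1 p 10 * (if (J_ p)%:Z < (2 ^ h)%N%:Z then 1 else 0)))
    = to_word b (Q (A_ p) (I_ p) (J_ p)).
  move=> pM; rewrite v10 // to_wordMl to_wordMr /Q; congr (to_word b _).
  by case: ifP => _; rewrite ?mulr0 // expr2.
apply: (reaches_seq (Q := fun s2 => [/\ same_regs M [:: 10; 12; 13] s.1 s2.1, s2.2 = s.2,
   forall p, (p < M)%N -> s2.1 p 10 = to_word b (Q (A_ p) (I_ p) (J_ p))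
   & forall p, (p < M)%N -> let q := Q (A_ p) (I_ p) (J_ p) in
          s2.1 p 13 = to_word b (- 2 * n%:Z * q - 4 * q * q)])).
  apply: reaches_straight => //; split=> //=.
  - by do !apply: same_regs_upd => //; apply: same_regsW rs1 => j; rewrite !inE => ->.
  - by move=> p pM; rewrite /upd /= !evalE /= !evalE (env4 (he1 p pM)) h7' // sq.
  move=> p pM; rewrite /upd /= !evalE /= !evalE (env4 (he1 p pM)) h7' // (env0 (he1 p pM)) sq // sub0r !mulNr.
  by drop_words.
move=> s2 [rs2 m2 r10' r13]; have he2 : env s2.1 by apply: env_same rs2 he.
apply: reaches_seq.
  apply: (@reaches_write 1 _ _ (fun p => to_word b (Q (A_ p) (I_ p) (J_ p)))) => // p pM.
  exact: eval_own_cell (he2 p pM) pM _.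
move=> s3 [rs3 o3 w3]; rewrite m2 in o3.
have hN p : (p < M)%N -> eval_expr b (s3.1 p) (EBin OpDiv (EReg 5) (EConst 2)) = (N %/ 2)%N%:Z.
  by move=> pM; rewrite evalE /= !evalE rs3 (env5 (he2 p pM)) half_small // N_le_M.
apply: reaches_weaken (reaches_assign 12 hN) => // s4 [m4 rs4 r12].
split=> //.
- apply: same_regs_trans rs2 _; rewrite -rs3; apply: same_regsW rs4 => j.
  by rewrite !inE => ->; rewrite orbT.
- by rewrite m4.
- by move=> p pM; rewrite m4 w3.
- by move=> p pM; rewrite rs4 // rs3 r13.
Qed.

Lemma classes_spec s f (X : nat -> nat -> nat -> int) (R : nat -> int) :
  env s.1 -> f = k ->
  (forall p, (p < M)%N -> s.1 p 13 = to_word b (R p)) ->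
  (forall p, (p < M)%N -> (J_ p < 2 ^ f)%N ->
     s.2 (cell 1 p) = to_word b (X (A_ p) (I_ p) (J_ p))) ->
  let S a i j := if (j < 2 ^ f)%N then X a i j else 0 in
  reaches b M classes_prog s 9 M (fun s' =>
    [/\ same_regs M [:: 10; 12; 13] s.1 s'.1, only [:: 1%N] s.2 s'.2,
      forall p, (p < M)%N -> s'.1 p 12 = (N %/ 2)%N%:Z,
      forall p, (p < M)%N -> s'.2 (cell 1 p) = to_word b (S (A_ p) (I_ p) (J_ p))
      & forall p, (p < M)%N -> let q := S (A_ p) (I_ p) (J_ p) in
          s'.1 p 13 = to_word b (R p + 5 * q * q)]).
Proof.
move=> he -> h13 hX S; apply: (@reaches_weaken _ _ _ _ (1 + (3 + (1 + 1).+1).+1).+1 _ _ _ _ (fun s' hh => hh)) => //.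
apply: reaches_seq; first by apply: (@reaches_read _ _ (cell 1)) => p pM; exact: eval_own_cell (he p pM) pM _.
move=> s1 [m1 rs1 r10]; have he1 : env s1.1 by apply: env_same rs1 he.
have v10 p : (p < M)%N -> to_word b (s1.1 p 10 * (if (J_ p)%:Z < K%:Z then 1 else 0))
     = to_word b (S (A_ p) (I_ p) (J_ p)).
  move=> pM; rewrite r10 // ltz_nat /S -/(pow2 k); case: ifP => Jh; rewrite ?mulr0 // mulr1 hX //.
  exact: to_word_id.
apply: (reaches_seq (Q := fun s2 => [/\ same_regs M [:: 10; 12; 13] s.1 s2.1, s2.2 = s.2,
   forall p, (p < M)%N -> s2.1 p 10 = to_word b (S (A_ p) (I_ p) (J_ p))
   & forall p, (p < M)%N -> let q := S (A_ p) (I_ p) (J_ p) in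
          s2.1 p 13 = to_word b (R p + 5 * q * q)])).
  apply: reaches_straight => //; split=> //=.
  - by do !apply: same_regs_upd => //; apply: same_regsW rs1 => j; rewrite !inE => ->.
  - by move=> p pM; rewrite /upd /= !evalE /= !evalE (env4 (he1 p pM)) (env6 (he1 p pM)) v10.
  move=> p pM; rewrite /upd /= !evalE /= !evalE (env4 (he1 p pM)) (env6 (he1 p pM)) v10 // rs1 // h13 //.
  by drop_words.
move=> s2 [rs2 m2 r10' r13]; have he2 : env s2.1 by apply: env_same rs2 he.
apply: reaches_seq.
  apply: (@reaches_write 1 _ _ (fun p => to_word b (S (A_ p) (I_ p) (J_ p)))) => // p pM.
  exact: eval_own_cell (he2 p pM) pM _.
move=> s3 [rs3 o3 w3]; rewrite m2 in o3.
have hN p : (p < M)%N -> eval_expr b (s3.1 p) (EBin OpDiv (EReg 5) (EConst 2)) = (N %/ 2)%N%:Z.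
  by move=> pM; rewrite evalE /= !evalE rs3 (env5 (he2 p pM)) half_small // N_le_M.
apply: reaches_weaken (reaches_assign 12 hN) => // s4 [m4 rs4 r12].
split=> //.
- apply: same_regs_trans rs2 _; rewrite -rs3; apply: same_regsW rs4 => j.
  by rewrite !inE => ->; rewrite orbT.
- by rewrite m4.
- by move=> p pM; rewrite m4 w3.
- by move=> p pM; rewrite rs4 // rs3 r13.
Qed.

Lemma NN_word p r : (p < M)%N -> env_at r p ->
  eval_expr b r (EBin OpDiv (EBin OpMul (EReg 5) (EReg 5)) (EConst 2)) = (2 ^ (2 * l) %/ 2)%N%:Z.
Proof.
move=> pM e; rewrite evalE /= !evalE /= (env5 e) -PoszM (wordM (m := N * N)).
  by rewrite half_small ?NN_le_M // /pow2 -expnD mul2n -addnn.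
by apply: leq_trans NN_le_M _; rewrite leq_pmull.
Qed.

Lemma energy_spec s (X : nat -> nat -> nat -> int) (R : nat -> int) :
  env s.1 ->
  (forall p, (p < M)%N -> s.1 p 13 = to_word b (R p)) ->
  (forall p, (p < M)%N -> (J_ p < 1)%N ->
     s.2 (cell 1 p) = to_word b (X (A_ p) (I_ p) (J_ p))) ->
  reaches b M energy_prog s 9 M (fun s' =>
    [/\ same_regs M [:: 10; 12; 13] s.1 s'.1, only [:: 2%N] s.2 s'.2,
      forall p, (p < M)%N -> s'.1 p 12 = (2 ^ (2 * l) %/ 2)%N%:Z
      & forall p, (p < M)%N ->
          let q := if (J_ p < 1)%N then X (A_ p) (I_ p) (J_ p) else 0 in
          s'.2 (cell 2 p) = to_word b (R p + q * q)]).
Proof.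
move=> he h13 hX; apply: (@reaches_weaken _ _ _ _ (1 + (3 + (1 + 1).+1).+1).+1 _ _ _ _ (fun s' hh => hh)) => //.
apply: reaches_seq; first by apply: (@reaches_read _ _ (cell 1)) => p pM; exact: eval_own_cell (he p pM) pM _.
move=> s1 [m1 rs1 r10]; have he1 : env s1.1 by apply: env_same rs1 he.
pose S a i j := if (j < 1)%N then X a i j else 0.
have v10 p : (p < M)%N -> to_word b (s1.1 p 10 * (if (J_ p)%:Z < 1 then 1 else 0))
     = to_word b (S (A_ p) (I_ p) (J_ p)).
  move=> pM; rewrite r10 // ltz_nat /S; case: ifP => Jh; rewrite ?mulr0 // mulr1 hX //.
  exact: to_word_id.
apply: (reaches_seq (Q := fun s2 => [/\ same_regs M [:: 10; 12; 13] s.1 s2.1, s2.2 = s.2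
   & forall p, (p < M)%N -> let q := S (A_ p) (I_ p) (J_ p) in
          s2.1 p 13 = to_word b (R p + q * q)])).
  apply: reaches_straight => //; split=> //=.
    by do !apply: same_regs_upd => //; apply: same_regsW rs1 => j; rewrite !inE => ->.
  move=> p pM; rewrite /upd /= !evalE /= !evalE (env4 (he1 p pM)) (word_const (z := 1)) // v10 // rs1 // h13 //.
  by drop_words.
move=> s2 [rs2 m2 r13]; have he2 : env s2.1 by apply: env_same rs2 he.
apply: reaches_seq.
  apply: (@reaches_write 2 _ _ (fun p => let q := S (A_ p) (I_ p) (J_ p) in to_word b (R p + q * q))) => // p pM.
  exact: eval_own_cell (he2 p pM) pM _.
move=> s3 [rs3 o3 w3]; rewrite m2 in o3.
have hN p : (p < M)%N -> eval_expr b (s3.1 p) (EBin OpDiv (EBin OpMul (EReg 5) (EReg 5)) (EConst 2))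
    = (2 ^ (2 * l) %/ 2)%N%:Z.
  by move=> pM; rewrite rs3; exact: NN_word pM (he2 p pM).
apply: reaches_weaken (reaches_assign 12 hN) => // s4 [m4 rs4 r12].
split=> //.
- apply: same_regs_trans rs2 _; rewrite -rs3; apply: same_regsW rs4 => j.
  by rewrite !inE => ->; rewrite orbT.
- by rewrite m4.
- by move=> p pM; rewrite m4 w3.
Qed.

(** Starting with stride [N * N / 2], the same fold sums over both lower digits of the processor
    number. *)
Lemma fold_rows (R : nat -> nat -> nat -> int) s :
  env s.1 ->
  (forall p, (p < M)%N -> s.1 p 12 = (2 ^ (2 * l) %/ 2)%N%:Z) ->
  (forall p, (p < M)%N -> s.2 (cell 2 p) = to_word b (R (A_ p) (I_ p) (J_ p))) ->
  reaches b M (fold_prog 2 (EConst 1)) s (20 * l + 1) M (fun s' =>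
    [/\ same_regs M [:: 10; 11; 12] s.1 s'.1, only [:: 2%N] s.2 s'.2
      & forall a, (a < N)%N -> s'.2 (cell 2 (a * (N * N))) =
          to_word b (\sum_(i < N) \sum_(j < N) R a i j)]).
Proof.
move=> he h12 hR.
have hlo rg : same_regs M [:: 10; 11; 12] s.1 rg ->
    forall p, (p < M)%N -> eval_expr b (rg p) (EConst 1) = (2 ^ 0)%N%:Z.
  by move=> _ p _; rewrite evalE word_const.
have := fold_spec (X := fun p => R (A_ p) (I_ p) (J_ p)) (q := 2) isT _ he h12 hlo hR.
rewrite leqnn => /(_ isT).
apply: reaches_weaken => // s' [rs o h]; split=> // a aN.
have e2 : (2 ^ (2 * l - 0) = N * N)%N by rewrite subn0 mul2n -addnn expnD.
rewrite h; last first.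
  rewrite e2 muln1 M_eq -mulnA; have NN0 : (0 < N * N)%N by rewrite muln_gt0 N_gt0.
  apply: (@leq_trans (a.+1 * (N * N))); last by rewrite leq_mul2r aN orbT.
  by rewrite mulSnr ltn_add2l prednK.
congr (to_word b _); rewrite e2.
rewrite (sum_blocks N N (fun t => R (A_ (a * (N * N) + t * 1)) (I_ (a * (N * N) + t * 1)) (J_ (a * (N * N) + t * 1)))).
rewrite exchange_big; apply: eq_bigr => i _; apply: eq_bigr => j _.
have -> : (a * (N * N) + (j + i * N) * 1 = idx a i j)%N by rewrite /idx; ring.
by rewrite A_idx ?I_idx ?J_idx.
Qed.

(** Array entries undergo ring operations only, so intermediate values may wrap around; no bound on
    them is required before the costs are compared. *)
Lemma potential_spec s h (Y : nat -> nat -> int) :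
  env s.1 -> (k <= h <= l)%N -> (forall p, (p < M)%N -> s.1 p 7 = (2 ^ h)%N%:Z) ->
  (forall p, (p < M)%N ->
     s.2 (cell 1 p) = to_word b (padded (I_ p) (J_ p) * Y (A_ p) (J_ p))) ->
  reaches b M potential_prog s (80 * l + 50) M (fun s' =>
    [/\ same_regs M [:: 10; 11; 12; 13] s.1 s'.1, only [:: 1%N; 2%N] s.2 s'.2
      & forall a, (a < N)%N -> s'.2 (cell 2 (a * (N * N))) =
          to_word b (total_potential l k n h padded (Y a))]).
Proof.
move=> he /andP[kh hl] h7 hX.
pose T := (1 + ((20 * l + 1) + (11 + ((20 * l + 1) + (9 + ((20 * l + 1) +
   (9 + (20 * l + 1)).+1).+1).+1).+1).+1).+1).+1%N.
apply: (@reaches_weaken _ _ _ _ T _ _ _ _ (fun s' hh => hh)); first by rewrite /T; lia.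
have sub3 : {subset [:: 10; 11; 12] <= [:: 10; 11; 12; 13]}%N.
  by move=> j; rewrite !inE => /or3P[] ->; rewrite ?orbT.
have sub3' : {subset [:: 10; 12; 13] <= [:: 10; 11; 12; 13]}%N.
  by move=> j; rewrite !inE => /or3P[] ->; rewrite ?orbT.
have o1 : {subset [:: 1%N] <= [:: 1%N; 2%N]} by move=> j; rewrite !inE => ->.
have o2 : {subset [:: 2%N] <= [:: 1%N; 2%N]} by move=> j; rewrite !inE => ->; rewrite orbT.
have hN p : (p < M)%N -> eval_expr b (s.1 p) (EBin OpDiv (EReg 5) (EConst 2)) = (N %/ 2)%N%:Z.
  by move=> pM; rewrite evalE /= !evalE (env5 (he p pM)) half_small // N_le_M.
apply: reaches_seq; first exact: (reaches_assign 12 hN).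
move=> s1 [m1 rs1 r1]; rewrite -m1 in hX *.
have {}rs1 : same_regs M [:: 10; 11; 12; 13] s.1 s1.1.
  by apply: same_regsW rs1 => j; rewrite !inE => ->; rewrite ?orbT.
have he1 : env s1.1 by apply: env_same rs1 he.
have lo7 rg : same_regs M [:: 10; 11; 12] s1.1 rg ->
    forall p, (p < M)%N -> eval_expr b (rg p) (EReg 7) = (2 ^ h)%N%:Z.
  by move=> hs p pM; rewrite evalE hs // rs1 // h7.
apply: reaches_seq.
  exact: (fold_columns (X := fun a i j => padded i j * Y a j) hl he1 r1 lo7 hX).
move=> s2 [rs2 om2 w2]; rewrite -/(merged _ _ _ _) in w2.
have he2 : env s2.1 by apply: env_same rs2 he1.
have h72 p : (p < M)%N -> s2.1 p 7 = (2 ^ h)%N%:Z by move=> pM; rewrite rs2 // rs1 // h7.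
pose T1 a i j := merged l h (padded i) (Y a) j.
pose Q a i j := if (j < 2 ^ h)%N then T1 a i j ^+ 2 else 0.
apply: reaches_seq; first exact: (squares_spec (X := T1) he2 hl h72 w2).
move=> s3 [rs3 om3 r3 w3 v3]; have he3 : env s3.1 by apply: env_same rs3 he2.
have lo6 rg : same_regs M [:: 10; 11; 12] s3.1 rg ->
    forall p, (p < M)%N -> eval_expr b (rg p) (EReg 6) = (2 ^ k)%N%:Z.
  by move=> hs p pM; rewrite evalE hs // (env6 (he3 p pM)).
have kl : (k <= l)%N by apply: leq_trans kh hl.
apply: reaches_seq; first exact: (fold_columns (X := Q) kl he3 r3 lo6 w3).
move=> s4 [rs4 om4 w4]; have he4 : env s4.1 by apply: env_same rs4 he3.
pose R p := - 2 * n%:Z * Q (A_ p) (I_ p) (J_ p)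
   - 4 * Q (A_ p) (I_ p) (J_ p) * Q (A_ p) (I_ p) (J_ p).
have v4 p : (p < M)%N -> s4.1 p 13 = to_word b (R p) by move=> pM; rewrite rs4 // v3.
pose S0 a i j := \sum_(t < 2 ^ (l - k)) Q a i (j + t * 2 ^ k)%N.
pose S a i j := if (j < 2 ^ k)%N then S0 a i j else 0.
apply: reaches_seq; first exact: (classes_spec (X := S0) he4 (erefl k) v4 w4).
move=> s5 [rs5 om5 r5 w5 v5]; have he5 : env s5.1 by apply: env_same rs5 he4.
have lo1 rg : same_regs M [:: 10; 11; 12] s5.1 rg ->
    forall p, (p < M)%N -> eval_expr b (rg p) (EConst 1) = (2 ^ 0)%N%:Z.
  by move=> _ p _; rewrite evalE word_const.
apply: reaches_seq; first exact: (fold_columns (X := S) (leq0n l) he5 r5 lo1 w5).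
move=> s6 [rs6 om6 w6]; have he6 : env s6.1 by apply: env_same rs6 he5.
pose R' p := R p + 5 * S (A_ p) (I_ p) (J_ p) * S (A_ p) (I_ p) (J_ p).
have v6 p : (p < M)%N -> s6.1 p 13 = to_word b (R' p) by move=> pM; rewrite rs6 // v5.
pose V a i j := \sum_(t < 2 ^ (l - 0)) S a i (j + t * 2 ^ 0)%N.
apply: reaches_seq; first exact: (energy_spec (X := V) he6 v6 w6).
move=> s7 [rs7 om7 r7 w7]; have he7 : env s7.1 by apply: env_same rs7 he6.
pose F a i j := - 2 * n%:Z * Q a i j - 4 * Q a i j * Q a i j + 5 * S a i j * S a i j
    + (if (j < 1)%N then V a i j else 0) * (if (j < 1)%N then V a i j else 0).
apply: reaches_weaken (fold_rows (R := F) he7 r7 w7) => //.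
move=> s8 [rs8 om8 w8]; split.
- apply: same_regs_trans rs1 _; apply: same_regs_trans (same_regsW sub3 rs2) _.
  apply: same_regs_trans (same_regsW sub3' rs3) _; apply: same_regs_trans (same_regsW sub3 rs4) _.
  apply: same_regs_trans (same_regsW sub3' rs5) _; apply: same_regs_trans (same_regsW sub3 rs6) _.
  exact: same_regs_trans (same_regsW sub3' rs7) (same_regsW sub3 rs8).
- apply: only_trans (onlyW o1 om2) _; apply: only_trans (onlyW o1 om3) _.
  apply: only_trans (onlyW o1 om4) _; apply: only_trans (onlyW o1 om5) _.
  apply: only_trans (onlyW o1 om6) _; exact: only_trans (onlyW o2 om7) (onlyW o2 om8).
move=> a aN; rewrite w8 //; congr (to_word b _); apply: eq_bigr => i _.
rewrite /F -(@potential_columns l k h n _ (Q a i) (S a i) (V a i 0%N)) ?kh //.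
- apply: eq_bigr => j _; congr (_ + _ * _); case: ifP => // j1;
    by rewrite (_ : nat_of_ord j = 0%N) //; apply/eqP; rewrite -leqn0 -ltnS.
- by rewrite /V subn0; apply: eq_bigr => t _; rewrite expn0 muln1.
Qed.

(** Needed for the sign test on row sums, which a wrapped value would falsify. *)
Lemma row_sum_bound (Y : nat -> int) i :
  (forall i j, (i < n)%N -> (j < n)%N -> `|A i j| <= 1) -> (forall j, `|Y j| <= 1) ->
  `|row_sum l (padded i) Y| <= N%:Z.
Proof.
move=> hA hY; apply: (le_trans (ler_norm_sum _ _ _)).
apply: (@le_trans _ _ (\sum_(j < N) 1)).
  apply: ler_sum => j _; rewrite normrM -[leRHS]mulr1; apply: ler_pM => //.
  by rewrite /padded; case: ifP => [/andP[? ?]|_]; rewrite ?hA // normr0.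
by rewrite sumr_const card_ord natz.
Qed.

Lemma total_abs_spec s (Y : nat -> nat -> int) :
  env s.1 -> (forall i j, (i < n)%N -> (j < n)%N -> `|A i j| <= 1) ->
  (forall a j, `|Y a j| <= 1) ->
  (forall p, (p < M)%N ->
     s.2 (cell 1 p) = to_word b (padded (I_ p) (J_ p) * Y (A_ p) (J_ p))) ->
  reaches b M total_abs_prog s (40 * l + 20) M (fun s' =>
    [/\ same_regs M [:: 10; 11; 12; 13] s.1 s'.1, only [:: 1%N; 2%N] s.2 s'.2,
      forall a, (a < N)%N -> s'.2 (cell 2 (a * (N * N))) =
          to_word b (- total_abs l padded (Y a))
      & forall a i, (a < N)%N -> (i < N)%N -> s'.2 (cell 1 (idx a i 0)) =
          row_sum l (padded i) (Y a)]).
Proof.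
move=> he hA hY hX.
pose T := (1 + ((20 * l + 1) + ((1 + (1 + (1 + 1).+1).+1).+1 + (20 * l + 1)).+1).+1).+1%N.
apply: (@reaches_weaken _ _ _ _ T _ _ _ _ (fun s' hh => hh)); first by rewrite /T; lia.
have sub3 : {subset [:: 10; 11; 12] <= [:: 10; 11; 12; 13]}%N.
  by move=> j; rewrite !inE => /or3P[] ->; rewrite ?orbT.
have o1 : {subset [:: 1%N] <= [:: 1%N; 2%N]} by move=> j; rewrite !inE => ->.
have o2 : {subset [:: 2%N] <= [:: 1%N; 2%N]} by move=> j; rewrite !inE => ->; rewrite orbT.
have hN p : (p < M)%N -> eval_expr b (s.1 p) (EBin OpDiv (EReg 5) (EConst 2)) = (N %/ 2)%N%:Z.
  by move=> pM; rewrite evalE /= !evalE (env5 (he p pM)) half_small // N_le_M.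
apply: reaches_seq; first exact: (reaches_assign 12 hN).
move=> s1 [m1 rs1 r1]; rewrite -m1 in hX *.
have {}rs1 : same_regs M [:: 10; 11; 12; 13] s.1 s1.1.
  by apply: same_regsW rs1 => j; rewrite !inE => ->; rewrite ?orbT.
have he1 : env s1.1 by apply: env_same rs1 he.
have lo1 rg : same_regs M [:: 10; 11; 12] s1.1 rg ->
    forall p, (p < M)%N -> eval_expr b (rg p) (EConst 1) = (2 ^ 0)%N%:Z.
  by move=> _ p _; rewrite evalE word_const.
apply: reaches_seq.
  exact: (fold_columns (X := fun a i j => padded i j * Y a j) (leq0n l) he1 r1 lo1 hX).
move=> s2 [rs2 om2 w2]; have he2 : env s2.1 by apply: env_same rs2 he1.
have {}w2 p : (p < M)%N -> (J_ p < 1)%N -> s2.2 (cell 1 p) = row_sum l (padded (I_ p)) (Y (A_ p)).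
  move=> pM J0; rewrite w2 // subn0 -[RHS]word_int; last first.
    apply: le_lt_trans (row_sum_bound _ hA (hY _)) _.
    by rewrite ltz_nat; have := word_boundM; have := N_le_M; move: (N) (M) (B); lia.
  congr (to_word b _); apply: eq_bigr => t _; rewrite expn0 muln1.
  by rewrite (_ : J_ p = 0%N) //; apply/eqP; rewrite -leqn0 -ltnS.
pose F a i j := if (j < 1)%N then - `|row_sum l (padded i) (Y a)| else 0.
apply: (reaches_seq (Q := fun s3 => [/\ same_regs M [:: 10; 11; 12; 13] s2.1 s3.1,
    only [:: 2%N] s2.2 s3.2, forall p, (p < M)%N -> s3.1 p 12 = (2 ^ (2 * l) %/ 2)%N%:Z
    & forall p, (p < M)%N -> s3.2 (cell 2 p) = to_word b (F (A_ p) (I_ p) (J_ p))])).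
  apply: reaches_seq; first by apply: (@reaches_read _ _ (cell 1)) => p pM; exact: eval_own_cell (he2 p pM) pM _.
  move=> s3 [m3 rs3 r3].
  have {}rs3 : same_regs M [:: 10; 11; 12; 13] s2.1 s3.1.
    by apply: same_regsW rs3 => j; rewrite !inE => ->; rewrite ?orbT.
  have he3 : env s3.1 by apply: env_same rs3 he2.
  apply: reaches_seq.
    apply: (@reaches_assign _ _ (fun p => to_word b (F (A_ p) (I_ p) (J_ p)))) => p pM.
    rewrite evalE /= !evalE (env4 (he3 p pM)) !(word_const (z := 1)) // ltz_nat.
    rewrite !(word_const (z := 0)) // /F; case: ifP => J0; last by rewrite mul0r.
    rewrite r3 // w2 //; congr (to_word b _); rewrite mul1r.
    by case: (ltP (row_sum _ _ _) 0) => h; [rewrite ltr0_norm | rewrite ger0_norm] => //; ring.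
  move=> s4 [m4 rs4 r4].
  have {}rs4 : same_regs M [:: 10; 11; 12; 13] s2.1 s4.1.
    apply: same_regs_trans rs3 _.
    by apply: same_regsW rs4 => j; rewrite !inE => ->; rewrite ?orbT.
  have he4 : env s4.1 by apply: env_same rs4 he2.
  apply: reaches_seq.
    apply: (@reaches_write 2 _ _ (fun p => to_word b (F (A_ p) (I_ p) (J_ p)))) => // p pM.
    exact: eval_own_cell (he4 p pM) pM _.
  move=> s5 [rs5 o5 w5]; rewrite m4 m3 in o5.
  have hNN p : (p < M)%N -> eval_expr b (s5.1 p) (EBin OpDiv (EBin OpMul (EReg 5) (EReg 5)) (EConst 2))
      = (2 ^ (2 * l) %/ 2)%N%:Z.
    by move=> pM; rewrite rs5; exact: NN_word pM (he4 p pM).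
  apply: reaches_weaken (reaches_assign 12 hNN) => // s6 [m6 rs6 r6]; rewrite m6; split=> //.
  apply: same_regs_trans rs4 _; rewrite -rs5.
  by apply: same_regsW rs6 => j; rewrite !inE => ->; rewrite ?orbT.
move=> s3 [rs3 om3 r3 w3]; have he3 : env s3.1 by apply: env_same rs3 he2.
apply: reaches_weaken (fold_rows he3 r3 w3) => // s4 [rs4 om4 w4]; split.
- apply: same_regs_trans rs1 _; apply: same_regs_trans (same_regsW sub3 rs2) _.
  exact: same_regs_trans rs3 (same_regsW sub3 rs4).
- apply: only_trans (onlyW o1 om2) _; exact: only_trans (onlyW o2 om3) (onlyW o2 om4).
- move=> a aN; rewrite w4 // /total_abs -sumrN; congr (to_word b _); apply: eq_bigr => i _.
  rewrite (bigD1 (Ordinal N_gt0)) //= big1 ?addr0 // => j j0.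
  by rewrite /F ltnS leqn0 (negbTE (_ : j != 0%N :> nat)).
move=> a i aN iN; have pM := idx_lt aN iN N_gt0.
rewrite (only_cell _ om4) // (only_cell _ om3) // w2 ?J_idx ?N_gt0 //.
by rewrite I_idx ?A_idx ?N_gt0.
Qed.

Lemma minimizer_exists (c : nat -> int) : exists a, minimizer l c a.
Proof.
pose a := [arg min_(i < Ordinal N_gt0) c (nat_of_ord i)]%O.
exists a; split; first exact: ltn_ord.
move=> i iN; rewrite /a; case: arg_minP => // j _ /(_ (Ordinal iN)); exact.
Qed.

Lemma argmin_spec s (c : nat -> int) :
  env s.1 -> (forall a, (a < N)%N -> s.2 (cell 2 (a * (N * N))) = c a) ->
  reaches b M argmin_prog s 20 M (fun s' =>
    [/\ same_regs M [:: 10; 11; 12; 14] s.1 s'.1, only [:: 4%N; 5%N; 6%N] s.2 s'.2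
      & exists2 a, minimizer l c a & forall p, (p < M)%N -> s'.1 p 14 = a%:Z]).
Proof.
move=> he hc.
pose T := (1 + (5 + (1 + (3 + (1 + 1).+1).+1).+1).+1).+1%N.
apply: (@reaches_weaken _ _ _ _ T _ _ _ _ (fun s' hh => hh)) => //.
have I_small p : (I_ p < 2 * M)%N.
  by apply: leq_trans (I_lt p) (leq_trans N_le_M _); rewrite leq_pmull.
have four p r : env_at r p -> eval_expr b r (cell_expr 4 (EReg 3)) = cell 4 (I_ p).
  by move=> e; apply: eval_cell => //; exact: env3 e.
have NN_small i : (i < N)%N -> (i * (N * N) < 2 * M)%N.
  move=> iN; apply: (@leq_trans M); last by rewrite leq_pmull.
  by rewrite M_eq -mulnA ltn_mul2r iN muln_gt0 N_gt0.
have sq r p : env_at r p -> r 5 * r 5 = (N * N)%N%:Z by move=> e; rewrite (env5 e).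
apply: (reaches_seq (Q := fun s1 => [/\ s1.1 = s.1, only [:: 4%N; 5%N; 6%N] s.2 s1.2
    & forall i, (i < N)%N -> s1.2 (cell 4 i) = 0])).
  apply: reaches_straight => //; split=> //=.
    move=> x hx; apply: write_all_miss => p pM; rewrite (four p _ (he p pM)) => e.
    apply: (hx 4%N (I_ p)) => //; exact: leq_trans (I_lt p) N_le_M.
  move=> i iN; case: (write_all_cases M (fun p => eval_expr b (s.1 p) (cell_expr 4 (EReg 3)))
     (fun p => eval_expr b (s.1 p) (EConst 0)) s.2 (cell 4 i)) => [[p pM [_ ->]]|[h _]].
    by rewrite evalE word_const.
  have iM := idx_lt N_gt0 iN N_gt0.
  by case: (h _ iM); rewrite (four _ _ (he _ iM)) I_idx ?N_gt0.
move=> s1 [rs1 o1 w1].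
have he1 : env s1.1 by rewrite rs1.
have c1 a : (a < N)%N -> s1.2 (cell 2 (a * (N * N))) = c a.
  by move=> aN; rewrite (only_cell _ o1) // hc.
apply: (reaches_seq (Q := fun s2 => [/\ same_regs M [:: 10; 11; 12; 14] s.1 s2.1, s2.2 = s1.2
    & forall p, (p < M)%N -> s2.1 p 12 = if c (J_ p) < c (I_ p) then 1 else 0])).
  apply: reaches_straight => //; split=> //=.
    by rewrite rs1; do !apply: same_regs_upd.
  move=> p pM; have e := he1 p pM; rewrite /upd /=.
  rewrite (@eval_cell 2 ($3 * ($5 * $5))%prog _ (I_ p * (N * N))) ?NN_small ?I_lt //; last first.
    by rewrite /= (env3 e) (sq _ _ e) -PoszM.
  rewrite (@eval_cell 2 ($4 * ($5 * $5))%prog _ (J_ p * (N * N))) ?NN_small ?J_lt //; last first.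
    by rewrite /= (env4 e) (sq _ _ e) -PoszM.
  by rewrite evalE /= !evalE /= !c1 ?I_lt ?J_lt // word_bool.
move=> s2 [rs2 m2 r2]; have he2 : env s2.1 by apply: env_same rs2 he.
have sel (u : bool) q : (q < M)%N -> to_word b
   ((if u then 1 else 0) * (- (4%:Z) - 8 * q%:Z) + (1 - (if u then 1 else 0)) * -6)
   = if u then cell 4 q else cell 6 0.
  move=> qM; case: u.
    rewrite mul1r subrr mul0r addr0 word_int // /cell.
    by have := word_boundM; move: (M) (B) qM; lia.
  by rewrite mul0r add0r subr0 mul1r word_const.
have I_M p : (I_ p < M)%N by apply: leq_trans (I_lt p) N_le_M.
have adr p : (p < M)%N -> eval_expr b (s2.1 p)
    ($12 * cell_expr 4 $3 + (EConst 1 - $12) * EConst (-6))%prog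
    = if c (J_ p) < c (I_ p) then cell 4 (I_ p) else cell 6 0.
  by move=> pM; rewrite evalE /= r2 // (env3 (he2 p pM)) sel.
apply: (reaches_seq (Q := fun s3 => [/\ s3.1 = s2.1, only [:: 4%N; 5%N; 6%N] s.2 s3.2
    & forall i, (i < N)%N -> s3.2 (cell 4 i) = 0 <-> forall j, (j < N)%N -> c i <= c j])).
  apply: reaches_straight => //; split=> //=.
    apply: only_trans o1 _; rewrite -m2 => x hx.
    apply: write_all_miss => p pM; rewrite adr // => e.
    move: e; case: ifP => _ e; [apply: (hx 4%N (I_ p)) | apply: (hx 6%N 0%N)] => //.
    exact: pow2_gt0.
  move=> i iN; have iM : (i < M)%N by apply: leq_trans iN N_le_M.
  set fa := fun p : nat => _; set fv := fun p : nat => eval_expr b (s2.1 p) (EConst 1).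
  case: (write_all_cases M fa fv s2.2 (cell 4 i)) => [[p pM [ep ->]]|[h ->]].
    rewrite /fv evalE word_const //; split=> // H.
    move: ep; rewrite /fa adr //; case: ifP => [lt|_]; last by rewrite /cell; lia.
    by move=> /cell_inj[] // _ ei; move: lt; rewrite ei ltNge H // J_lt.
  rewrite m2 w1 //; split=> // _ j jN; rewrite leNgt; apply/negP => lt.
  have qM := idx_lt N_gt0 iN jN; apply: (h _ qM).
  by rewrite /fa adr // I_idx ?J_idx ?lt.
move=> s3 [rs3 o3 w3]; have he3 : env s3.1 by rewrite rs3.
apply: (reaches_seq (Q := fun s4 => [/\ same_regs M [:: 10; 11; 12; 14] s.1 s4.1, s4.2 = s3.2
    & forall p, (p < M)%N -> s4.1 p 12 = if s3.2 (cell 4 (I_ p)) == 0 then 1 else 0])).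
  apply: reaches_straight => //; split=> //=.
    by rewrite rs3; do !apply: same_regs_upd.
  move=> p pM; rewrite /upd /= (four _ _ (he3 p pM)).
  by rewrite evalE /= !evalE /= (word_const (z := 0)) // word_bool.
move=> s4 [rs4 m4 r4]; have he4 : env s4.1 by apply: env_same rs4 he.
have adr5 p : (p < M)%N -> eval_expr b (s4.1 p)
    ($12 * EConst (-5) + (EConst 1 - $12) * EConst (-6))%prog
    = if s3.2 (cell 4 (I_ p)) == 0 then cell 5 0 else cell 6 0.
  by move=> pM; rewrite evalE /= r4 //; case: ifP => _; rewrite word_const.
apply: (reaches_seq (Q := fun s5 => [/\ s5.1 = s4.1, only [:: 4%N; 5%N; 6%N] s.2 s5.2
    & exists2 a, minimizer l c a & s5.2 (cell 5 0) = a%:Z])).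
  apply: reaches_straight => //; split=> //=.
    apply: only_trans o3 _; rewrite -m4 => x hx.
    apply: write_all_miss => p pM; rewrite adr5 // => e.
    by move: e; case: ifP => _ e; [apply: (hx 5%N 0%N) | apply: (hx 6%N 0%N)] => //;
      exact: pow2_gt0.
  set fv := fun p : nat => eval_expr b (s4.1 p) $3%prog.
  set fa := fun p : nat => eval_expr b (s4.1 p)
    ($12 * EConst (-5) + (EConst 1 - $12) * EConst (-6))%prog.
  case: (write_all_cases M fa fv s4.2 (cell 5 0)) => [[p pM [ep ->]]|[h _]].
    exists (I_ p); last by rewrite /fv evalE (env3 (he4 p pM)).
    split; first exact: I_lt.
    move: ep; rewrite /fa adr5 //; case: eqP => [/w3 H _|_]; last by rewrite /cell; lia.
    by apply: H; exact: I_lt.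
  (* Cell -5 is written at all because the flag of a minimizer is never raised. *)
  have [a [aN amin]] := minimizer_exists c.
  have qM := idx_lt N_gt0 aN N_gt0; case: (h _ qM).
  rewrite /fa adr5 // I_idx ?N_gt0 // ifT //; apply/eqP.
  by apply/w3.
move=> s5 [rs5 o5 [a amin ha]].
have r5 p : (p < M)%N -> eval_expr b (s5.1 p) (EConst (-5)) = cell 5 0.
  by move=> pM; rewrite evalE word_const.
apply: reaches_weaken (reaches_read 14 r5) => // s6 [m6 rs6 r6]; split.
- apply: same_regs_trans rs4 _; rewrite -rs5; apply: same_regsW rs6 => j.
  by rewrite !inE => ->; rewrite !orbT.
- by rewrite m6.
- by exists a => // p pM; rewrite r6.
Qed.

Lemma update_spec s a (Y : nat -> nat -> int) :
  env s.1 -> (a < N)%N -> input_ok s.2 ->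
  (forall p, (p < M)%N -> s.1 p 14 = a%:Z) ->
  (forall p, (p < M)%N -> s.2 (cell 3 p) = Y (A_ p) (J_ p)) ->
  reaches b M update_prog s 3 M (fun s' =>
    [/\ same_regs M [:: 10] s.1 s'.1, input_ok s'.2, signs_ok (Y a) s'.2
      & forall q p, (0 < q)%N -> s'.2 (cell q p) = s.2 (cell q p)]).
Proof.
move=> he aN hA h14 hY.
have adr p : (p < M)%N ->
    eval_expr b (s.1 p) (cell_expr 3 ($14 * ($5 * $5) + $4)%prog) = cell 3 (idx a 0 (J_ p)).
  move=> pM; apply: eval_cell => //.
    by rewrite /= h14 // (env4 (he p pM)) (env5 (he p pM)) /idx addn0 PoszD !PoszM mulrA.
  by apply: leq_trans (idx_lt aN N_gt0 (J_lt p)) _; rewrite leq_pmull.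
apply: (@reaches_weaken _ _ _ _ (1 + 1).+1 _ _ _ _ (fun s' hh => hh)) => //.
apply: reaches_seq; first exact: (reaches_read 10 adr).
move=> s1 [m1 rs1 r1]; have he1 : env s1.1 by apply: env_same rs1 he.
have {}r1 p : (p < M)%N -> s1.1 p 10 = Y a (J_ p).
  move=> pM; rewrite r1 // hY ?idx_lt ?N_gt0 ?J_lt //.
  by rewrite A_idx ?J_idx ?N_gt0 ?J_lt.
have adr1 p : (p < M)%N -> eval_expr b (s1.1 p) ($0 * $0 + $0 + $4)%prog = (n * n + n + J_ p)%N%:Z.
  move=> pM; rewrite evalE /= (env0 (he1 p pM)) (env4 (he1 p pM)).
  by rewrite -!PoszM -!PoszD wordM ?offset_small ?J_lt.
set fa := fun p => eval_expr b (s1.1 p) ($0 * $0 + $0 + $4)%prog.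
set fv := fun p => eval_expr b (s1.1 p) $10%prog.
apply: reaches_straight => //; split=> //=.
- move=> i j ni nj; rewrite -hA // -m1; apply: write_all_miss => p pM.
  by rewrite adr1 // => -[]; nia.
- move=> j jN; have qM := idx_lt N_gt0 N_gt0 jN.
  case: (write_all_cases M fa fv s1.2 (n * n + n + j)%N%:Z) => [[p pM [ep ->]]|[h _]].
    by move: ep; rewrite /fa adr1 // => -[] /addnI <-; rewrite /fv evalE r1.
  by case: (h _ qM); rewrite /fa adr1 // J_idx.
- move=> q p q0; rewrite -m1; apply: write_all_miss => p' pM.
  by rewrite adr1 // /cell; lia.
Qed.

Lemma signed_bound x y a j : (forall j, `|y j| <= 1) -> `|signed l x y a j| <= 1.
Proof.
move=> hy; rewrite /signed normrM (_ : `|walsh l a (x j)| = 1) ?mulr1 //.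
by have := walsh_sqr l a (x j); move: (walsh l a (x j)); nia.
Qed.

(** Common to the merging rounds and the final search. [E] carries what the cost program leaves in
    memory besides the costs; array 1 survives to the end, and the output step reads the row sums
    there. *)
Lemma select_spec cp Tc s y (x : nat -> nat) (c : nat -> int) (E : (int -> int) -> Prop) :
  env s.1 -> input_ok s.2 -> signs_ok y s.2 ->
  (forall j, (n <= j)%N -> y j = 0) -> (forall j, `|y j| <= 1) ->
  (forall j, (x j < N)%N) -> (forall p, (p < M)%N -> s.1 p 11 = (x (J_ p))%:Z) ->
  (forall s1, env s1.1 -> same_regs M [:: 8; 10; 11; 12] s.1 s1.1 ->
     (forall p, (p < M)%N ->
        s1.2 (cell 1 p) = to_word b (padded (I_ p) (J_ p) * signed l x y (A_ p) (J_ p))) ->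
     reaches b M cp s1 Tc M (fun s2 =>
       [/\ same_regs M [:: 10; 11; 12; 13] s1.1 s2.1, only [:: 1%N; 2%N] s1.2 s2.2,
         forall a, (a < N)%N -> s2.2 (cell 2 (a * (N * N))) = c a & E s2.2])) ->
  reaches b M (select_prog cp) s (10 * l + 50 + Tc) M (fun s' =>
    [/\ same_regs M [:: 8; 10; 11; 12; 13; 14] s.1 s'.1, input_ok s'.2,
      exists2 m, E m & forall p, s'.2 (cell 1 p) = m (cell 1 p)
      & exists a, [/\ minimizer l c a, forall p, (p < M)%N -> s'.1 p 14 = a%:Z
                    & signs_ok (signed l x y a) s'.2]]).
Proof.
move=> he hA hy y0 y1 xN h11 hc.
apply: (@reaches_weaken _ _ _ _ ((10 * l + 10) + (9 + (Tc + (20 + 3).+1).+1).+1).+1 _ _ _ _ (fun s' hh => hh)); first by lia.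
have sub off : {subset off <= [:: 8; 10; 11; 12; 13; 14]}%N ->
    forall rg rg', same_regs M off rg rg' -> same_regs M [:: 8; 10; 11; 12; 13; 14] rg rg'.
  by move=> h rg rg'; apply: same_regsW h.
apply: reaches_seq; first by apply: (sign_spec (x := fun p => x (J_ p))) => // p pM; split; rewrite ?h11.
move=> s1 [m1 rs1 w1]; have he1 : env s1.1 by apply: env_same rs1 he.
rewrite -m1 in hA hy.
apply: reaches_seq; first exact: (place_spec he1 hA hy y0 w1).
move=> s2 [rs2 o2 h1 h3]; have he2 : env s2.1 by apply: env_same rs2 he1.
have rs12 : same_regs M [:: 8; 10; 11; 12] s.1 s2.1.
  apply: same_regs_trans rs1 _; apply: same_regsW rs2 => j.
  by rewrite !inE => /orP[] ->; rewrite ?orbT.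
have hA2 : input_ok s2.2 by move=> i j ni nj; rewrite (only_nat _ o2) // hA.
apply: reaches_seq; first exact: (hc s2 he2 rs12 h1).
move=> s3 [rs3 o3 c3 E3]; have he3 : env s3.1 by apply: env_same rs3 he2.
have hA3 : input_ok s3.2 by move=> i j ni nj; rewrite (only_nat _ o3) // hA2.
apply: reaches_seq; first exact: (argmin_spec he3 c3).
move=> s4 [rs4 o4 [a amin h14]]; have he4 : env s4.1 by apply: env_same rs4 he3.
have hA4 : input_ok s4.2 by move=> i j ni nj; rewrite (only_nat _ o4) // hA3.
have h34 p : (p < M)%N -> s4.2 (cell 3 p) = signed l x y (A_ p) (J_ p).
  move=> pM; rewrite (only_cell _ o4) // (only_cell _ o3) // h3 // word_const //.
  by apply: le_trans (signed_bound x (A_ p) (J_ p) y1) _.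
apply: reaches_weaken (update_spec he4 amin.1 hA4 h14 h34) => // s5 [rs5 hA5 hy5 o5].
split=> //.
- apply: same_regs_trans (sub _ _ _ _ rs12) _.
    by move=> j; rewrite !inE => /or4P[] ->; rewrite ?orbT.
  apply: same_regs_trans (sub _ _ _ _ rs3) _.
    by move=> j; rewrite !inE => /or4P[] ->; rewrite ?orbT.
  apply: same_regs_trans (sub _ _ _ _ rs4) (sub _ _ _ _ rs5).
    by move=> j; rewrite !inE => /or4P[] ->; rewrite ?orbT.
  by move=> j; rewrite !inE => ->; rewrite ?orbT.
- by exists s3.2 => // p; rewrite o5 // (only_cell _ o4).
exists a; split=> // p pM.
by rewrite rs5 // h14.
Qed.

(** Merged entries are at most [N] in modulus, so a row contributes at most [N ^ 6 + 2 N ^ 4 + 5 N ^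
    7 + 4 N ^ 5 <= 12 N ^ 7], and there are [N] rows. *)
Lemma word_total_potential h (Y : nat -> nat -> int) a : (k <= h <= l)%N ->
  (forall i j, (i < n)%N -> (j < n)%N -> `|A i j| <= 1) -> (forall a j, `|Y a j| <= 1) ->
  to_word b (total_potential l k n h padded (Y a)) = total_potential l k n h padded (Y a).
Proof.
move=> /andP[kh hl] hA hY; apply: word_int.
have hL i c : (c < 2 ^ h)%N -> `|merged l h (padded i) (Y a) c| <= N%:Z.
  move=> ch; apply: (le_trans (ler_norm_sum _ _ _)).
  apply: (@le_trans _ _ (\sum_(t < 2 ^ (l - h)) 1)).
    apply: ler_sum => t _; rewrite normrM -[leRHS]mulr1; apply: ler_pM => //.
    by rewrite /padded; case: ifP => [/andP[? ?]|_]; rewrite ?hA // normr0.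
  by rewrite sumr_const card_ord natz lez_nat leq_exp2l // leq_subr.
have HN : (2 ^ h <= N)%N by rewrite /pow2 leq_exp2l.
set u : int := N%:Z; have u2 : 2 <= u by rewrite lez_nat N_ge2.
have sum_bound m (F : 'I_m -> int) (P : pred 'I_m) v : (m <= N)%N -> 0 <= v ->
    (forall i, P i -> 0 <= F i <= v) -> 0 <= \sum_(i | P i) F i <= u * v.
  move=> mN v0 hF; rewrite sumr_ge0 => [|i /hF/andP[] //].
  apply: (@le_trans _ _ (\sum_(i | P i) v)); first by apply: ler_sum => i /hF/andP[].
  rewrite big_mkcond; apply: (@le_trans _ _ (\sum_(i < m) v)).
    by apply: ler_sum => i _; case: ifP.
  by rewrite sumr_const card_ord -mulr_natl natz ler_wpM2r.
have hL2 i c : (c < 2 ^ h)%N -> 0 <= merged l h (padded i) (Y a) c ^+ 2 <= u ^+ 2.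
  move=> /(hL i) H; rewrite sqr_ge0 -[leLHS](ger0_norm (sqr_ge0 _)) normrX.
  by rewrite lerXn2r ?nnegrE.
have hL4 i c : (c < 2 ^ h)%N -> 0 <= merged l h (padded i) (Y a) c ^+ 4 <= u ^+ 4.
  move=> /(hL2 i) /andP[g0 g1]; rewrite !(exprM _ 2 2) sqr_ge0.
  by rewrite lerXn2r ?nnegrE // sqr_ge0.
have u0 : 0 <= u by lia.
have powge m : 0 <= u ^+ m by rewrite exprn_ge0.
have hE i : 0 <= energy (2 ^ h) (merged l h (padded i) (Y a)) <= u ^+ 3.
  by rewrite [u ^+ 3]exprS; apply: sum_bound => // c _; apply: hL2.
have hC i p : 0 <= class_energy (2 ^ k) (2 ^ h) (merged l h (padded i) (Y a)) p <= u ^+ 3.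
  by rewrite [u ^+ 3]exprS; apply: sum_bound => // c _; apply: hL2.
have sqb v : 0 <= v <= u ^+ 3 -> 0 <= v ^+ 2 <= u ^+ 6.
  by move=> /andP[v0 v1]; rewrite sqr_ge0 (exprM u 3 2) lerXn2r ?nnegrE.
have hP i : `|potential (2 ^ k) n (2 ^ h) (merged l h (padded i) (Y a))| <= 12 * u ^+ 7.
  rewrite /potential; set L := merged _ _ _ _.
  have /andP[s0 s1] : 0 <= \sum_(p < 2 ^ k) class_energy (2 ^ k) (2 ^ h) L p ^+ 2 <= u ^+ 7.
    rewrite [u ^+ 7]exprS; apply: sum_bound => //; first exact: K_le_N.
    by move=> p _; apply/sqb/hC.
  have /andP[f0 f1] : 0 <= \sum_(c < 2 ^ h) L c ^+ 4 <= u ^+ 5.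
    by rewrite [u ^+ 5]exprS; apply: sum_bound => // c _; apply: hL4.
  have /andP[e0 e1] := hE i; rewrite -/L in e0 e1.
  have /andP[q0 q1] := sqb _ (hE i); rewrite -/L in q0 q1.
  have ne : 0 <= n%:Z * energy (2 ^ h) L <= u ^+ 4.
    rewrite mulr_ge0 // [u ^+ 4]exprS ler_pM // lez_nat ltnW //; exact: n_lt_N.
  have u67 : u ^+ 6 <= u ^+ 7 by rewrite ler_weXn2l //; lia.
  have u57 : u ^+ 5 <= u ^+ 7 by rewrite ler_weXn2l //; lia.
  have u47 : u ^+ 4 <= u ^+ 7 by rewrite ler_weXn2l //; lia.
  move: s0 s1 f0 f1 q0 q1 ne u67 u57 u47; rewrite -mulrA.
  move: (\sum_(p < _) _) (\sum_(c < _) _) (energy _ _ ^+ 2) (n%:Z * _) (u ^+ 4) (u ^+ 5) (u ^+ 6) (u ^+ 7).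
  by move=> *; lia.
apply: (@le_lt_trans _ _ (12 * u ^+ 8)).
  apply: (le_trans (ler_norm_sum _ _ _)).
  apply: (@le_trans _ _ (\sum_(i < 2 ^ l) 12 * u ^+ 7)); first by apply: ler_sum.
  by rewrite sumr_const card_ord -mulr_natl natz -/(pow2 l) -/u; lia.
have := word_bound8; have := N_gt0.
have -> : u ^+ 8 = (N * N * N * N * N * N * N * N)%N%:Z by rewrite !PoszM -/u; ring.
have : (0 < N * N * N * N * N * N * N * N)%N by rewrite !muln_gt0 N_gt0.
by move: (N * _)%N (B) => v w; lia.
Qed.

Lemma output_spec s a (z : nat -> int) y :
  env s.1 -> (a < N)%N -> signs_ok y s.2 ->
  (forall p, (p < M)%N -> s.1 p 14 = a%:Z) ->
  (forall i, (i < N)%N -> s.2 (cell 1 (idx a i 0)) = z i) ->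
  reaches b M output_prog s 5 M (fun s' => signs_ok y s'.2 /\
    forall i, (i < n)%N -> s'.2 (n * n + i)%N%:Z = if z i < 0 then -1 else 1).
Proof.
move=> he aN hy h14 hz.
have adr p : (p < M)%N ->
    eval_expr b (s.1 p) (cell_expr 1 ($14 * ($5 * $5) + $3 * $5)%prog) = cell 1 (idx a (I_ p) 0).
  move=> pM; apply: eval_cell => //.
    rewrite /= h14 // (env3 (he p pM)) (env5 (he p pM)) /idx addn0 !PoszM !PoszD !PoszM; ring.
  by apply: leq_trans (idx_lt aN (I_lt p) N_gt0) _; rewrite leq_pmull.
apply: (@reaches_weaken _ _ _ _ (1 + (1 + 1).+1).+1 _ _ _ _ (fun s' hh => hh)) => //.
apply: reaches_seq; first exact: (reaches_read 10 adr).
move=> s1 [m1 rs1 r1]; have he1 : env s1.1 by apply: env_same rs1 he.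
have t p : (p < M)%N -> eval_expr b (s1.1 p) ($3 < $0)%prog = if (I_ p < n)%N then 1 else 0.
  by move=> pM; rewrite evalE /= !evalE (env3 (he1 p pM)) (env0 (he1 p pM)) word_bool ltz_nat.
apply: reaches_seq; first exact: (reaches_assign 11 t).
move=> s2 [m2 rs2 r2]; have he2 : env s2.1 by apply: env_same rs2 he1.
set ae := ($11 * ($0 * $0 + $3) + (EConst 1 - $11) * EConst (-6))%prog.
set ve := (EConst 1 - EConst 2 * ($10 < EConst 0))%prog.
have adr2 p : (p < M)%N -> eval_expr b (s2.1 p) ae
    = if (I_ p < n)%N then (n * n + I_ p)%N%:Z else -6.
  move=> pM; rewrite evalE /= r2 // (env0 (he2 p pM)) (env3 (he2 p pM)).
  case: ifP => In; last by rewrite mul0r add0r subr0 mul1r word_const.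
  rewrite mul1r subrr mul0r addr0 -PoszM -PoszD wordM //.
  by apply: leq_trans (offset_small (I_lt p)); rewrite leq_add2r leq_addr.
have val p : (p < M)%N -> eval_expr b (s2.1 p) ve = if z (I_ p) < 0 then -1 else 1.
  move=> pM; rewrite evalE /= !evalE rs2 // r1 // hz ?I_lt // (word_const (z := 0)) //.
  by case: ifP => _; rewrite word_const.
set fa := fun p => eval_expr b (s2.1 p) ae; set fv := fun p => eval_expr b (s2.1 p) ve.
apply: reaches_straight => //; split=> /=.
  move=> j jN; rewrite -hy // -m1 -m2; apply: write_all_miss => p pM.
  by rewrite adr2 //; case: ifP => [In [] |]; lia.
move=> i ni; have iN : (i < N)%N by apply: ltn_trans ni n_lt_N.
have qM := idx_lt N_gt0 iN N_gt0.
case: (write_all_cases M fa fv s2.2 (n * n + i)%N%:Z) => [[p pM [ep ->]]|[h _]].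
  rewrite /fv val //; move: ep; rewrite /fa adr2 //; case: ifP => [_ [] /addnI <- //|_]; lia.
by case: (h _ qM); rewrite /fa adr2 // I_idx ?N_gt0 // ni.
Qed.

Hypothesis A_bound : forall i j, (i < n)%N -> (j < n)%N -> `|A i j| <= 1.

(** * The merging rounds and the class digits *)

Definition is_signing (y : nat -> int) : Prop :=
  (forall j, (n <= j)%N -> y j = 0) /\ (forall j, (j < n)%N -> y j = 1 \/ y j = -1).

Lemma signing_bound y : is_signing y -> forall j, `|y j| <= 1.
Proof.
move=> [h0 h1] j; have [jn|nj] := ltnP j n; last by rewrite h0.
by case: (h1 j jn) => ->.
Qed.

Lemma signing_signed x y a : is_signing y -> is_signing (signed l x y a).
Proof.
move=> [h0 h1]; split=> j jn; rewrite /signed; first by rewrite h0 // mul0r.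
have := walsh_sqr l a (x j); move: (walsh l a (x j)) => w ww.
by case: (h1 j jn) => ->; nia.
Qed.

Lemma upper_half_lt h j : (h < l)%N -> (upper_half h j < N)%N.
Proof.
move=> hl; rewrite /upper_half; case: ifP => _; first exact: N_gt0.
apply: (@leq_trans (2 ^ h.+1)); first by rewrite ltn_pmod // expn_gt0.
by rewrite /pow2 leq_exp2l.
Qed.

Lemma upper_half_spec s h :
  env s.1 -> (h < l)%N -> (forall p, (p < M)%N -> s.1 p 7 = (2 ^ h)%N%:Z) ->
  reaches b M upper_half_prog s 3 M (fun s' => [/\ s'.2 = s.2,
    same_regs M [:: 11] s.1 s'.1
    & forall p, (p < M)%N -> s'.1 p 11 = (upper_half h (J_ p))%:Z]).
Proof.
move=> he hl h7; apply: reaches_straight => //; split=> //=.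
  by do !apply: same_regs_upd.
move=> p pM; rewrite /upd /= !evalE /= !evalE /= (env4 (he p pM)) h7 //.
have e2 : 2 * (2 ^ h)%N%:Z = (2 ^ h.+1)%N%:Z by rewrite expnS PoszM.
have hN : (2 ^ h.+1 <= N)%N by rewrite /pow2 leq_exp2l.
rewrite e2 (wordN hN) modz_nat (wordN (m := J_ p %% _)); last first.
  exact: leq_trans (leq_mod _ _) (ltnW (J_lt p)).
rewrite ltz_nat /upper_half; case: ifP => _; first by rewrite subrr mulr0 word_const.
by rewrite subr0 mulr1 wordN // (leq_trans (leq_mod _ _) (ltnW (J_lt p))).
Qed.

(** Register 7 holds the number of columns that the coming round will leave, and the loop ends when
    this falls below [K]. For [k = 0] the last value is [1 / 2 = 0]. *)
Lemma merge_spec s y0 :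
  env s.1 -> input_ok s.2 -> signs_ok y0 s.2 -> is_signing y0 ->
  reaches b M merge_prog s (l * (90 * l + 120) + 10) M (fun s' =>
    [/\ env s'.1, input_ok s'.2 & exists y, [/\ signs_ok y s'.2, is_signing y &
      total_potential l k n k padded y <= total_potential l k n l padded y0]]).
Proof.
move=> he hA hy sy.
pose I u (s' : state) := [/\ env s'.1, forall p, (p < M)%N -> s'.1 p 7 = (2 ^ (l - u) %/ 2)%N%:Z,
   input_ok s'.2 & exists y, [/\ signs_ok y s'.2, is_signing y &
      total_potential l k n (l - u) padded y <= total_potential l k n l padded y0]].
have kl : (k <= l)%N by case: ok.
have hN p : (p < M)%N -> eval_expr b (s.1 p) ($5 / EConst 2)%prog = (N %/ 2)%N%:Z.
  by move=> pM; rewrite evalE /= !evalE (env5 (he p pM)) half_small // N_le_M.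
set TB := (90 * l + 110)%N.
apply: (@reaches_weaken _ _ _ _ (1 + ((l - k) * TB.+1).+1).+1 _ _ (I (l - k)%N)).
- by move=> s' [h1 h2 h3 h4]; split=> //; move: h4; rewrite subKn.
- have : ((l - k) * TB.+1 <= l * TB.+1)%N by rewrite leq_mul2r leq_subr orbT.
  by rewrite /TB; lia.
apply: reaches_seq; first exact: (reaches_assign 7 hN).
move=> s1 [m1 rs1 r1].
have I0 : I 0%N s1.
  split; first by apply: env_same rs1 he.
  - by move=> p pM; rewrite subn0 r1.
  - by rewrite m1.
  - by exists y0; rewrite m1 subn0.
have cond u s2 p : (u <= l)%N -> I u s2 -> (p < M)%N ->
    eval_expr b (s2.1 p) ($6 < $7 + EConst 1)%prog
    = if (2 ^ k < 2 ^ (l - u) %/ 2 + 1)%N then 1 else 0.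
  move=> ul [he2 h7 _ _] pM.
  rewrite evalE /= !evalE /= (env6 (he2 p pM)) h7 // word_bool -PoszD wordM //.
  apply: leq_trans (leq_add (leq_div _ _) (pow2_gt0 (3 * l))) _.
  rewrite mul2n -addnn leq_add2r; apply: leq_trans N_le_M.
  by rewrite /pow2 leq_exp2l // leq_subr.
apply: (triple_while (M := fun=> M)) I0.
- move=> u s2 p ul Is pM; rewrite (cond u) //; last by lia.
  have -> : (l - u = (l - u).-1.+1)%N by lia.
  rewrite expnS mulKn // addn1 ltnS leq_exp2l //.
  by rewrite ifT //; lia.
- move=> s2 p Is pM; rewrite (cond (l - k)%N) ?leq_subr // subKn // addn1 ltnS.
  by rewrite leqNgt ltn_Pdiv // expn_gt0.
move=> u ul s2 [he2 h7 hA2 [y [hy2 sy2 le2]]].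
pose h := (l - u).-1; have hu : (l - u = h.+1)%N by rewrite /h; lia.
have hl : (h < l)%N by rewrite /h; lia.
have kh : (k <= h <= l)%N by rewrite (ltnW hl) andbT /h; lia.
have {}h7 p : (p < M)%N -> s2.1 p 7 = (2 ^ h)%N%:Z by move=> pM; rewrite h7 // hu expnS mulKn.
apply: (@reaches_weaken _ _ _ _ (3 + ((10 * l + 50 + (80 * l + 50)) + 1).+1).+1 _ _ _ _ (fun s' hh => hh)).
  by rewrite /TB; lia.
apply: reaches_seq; first exact: upper_half_spec he2 hl h7.
move=> s3 [m3 rs3 r3]; have he3 : env s3.1 by apply: env_same rs3 he2.
rewrite -m3 in hA2 hy2.
pose c a := total_potential l k n h padded (signed l (upper_half h) y a).
apply: reaches_seq.
  apply: (select_spec (c := c) (E := fun=> True) he3 hA2 hy2 sy2.1 (signing_bound sy2) _ r3).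
    by move=> j; exact: upper_half_lt.
  move=> s4 he4 rs4 h1.
  have h74 p : (p < M)%N -> s4.1 p 7 = (2 ^ h)%N%:Z by move=> pM; rewrite rs4 // rs3 // h7.
  apply: reaches_weaken (potential_spec he4 kh h74 h1) => // s5 [rs5 o5 w5]; split=> // a aN.
  rewrite w5 // word_total_potential // => a' j; exact/signed_bound/signing_bound.
move=> s4 [rs4 hA4 _ [a [amin _ hy4]]]; have he4 : env s4.1 by apply: env_same rs4 he3.
have h7' p : (p < M)%N -> eval_expr b (s4.1 p) ($7 / EConst 2)%prog = (2 ^ h %/ 2)%N%:Z.
  move=> pM; rewrite evalE /= !evalE rs4 // rs3 // h7 // half_small //.
  by apply: leq_trans N_le_M; rewrite /pow2 leq_exp2l // ltnW.
have hs : (l - u.+1 = h)%N by rewrite /h; lia.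
apply: reaches_weaken (reaches_assign 7 h7') => // s5 [m5 rs5 r5].
split; first by apply: env_same rs5 he4.
- by move=> p pM; rewrite hs r5.
- by rewrite m5.
exists (signed l (upper_half h) y a); rewrite m5 hs; split=> //.
  exact: signing_signed.
apply: le_trans le2; rewrite hu; apply: total_potential_step => //.
by move: kh => /andP[-> _]; rewrite hl.
Qed.

Hypothesis K_le_l : (2 ^ k <= l)%N.

Lemma digit_lt j : (digit k j < N)%N.
Proof.
rewrite /digit /pow2 ltn_exp2l //; apply: leq_trans K_le_l.
by rewrite ltn_pmod // expn_gt0.
Qed.

Lemma digit_spec s : env s.1 ->
  reaches b M digit_prog s (10 * l + 10) M (fun s' => [/\ s'.2 = s.2,
    same_regs M [:: 11; 12; 13] s.1 s'.1
    & forall p, (p < M)%N -> s'.1 p 11 = (digit k (J_ p))%:Z]).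
Proof.
move=> he.
pose q p := (J_ p %% K)%N.
have qK p : (q p < K)%N by rewrite /q ltn_pmod // pow2_gt0.
pose I u (s' : state) := [/\ s'.2 = s.2, same_regs M [:: 11; 12; 13] s.1 s'.1
  & forall p, (p < M)%N -> [/\ s'.1 p 11 = (2 ^ minn u (q p))%N%:Z,
      s'.1 p 12 = (q p - u)%N%:Z & s'.1 p 13 = (K - u)%N%:Z]].
have KN := K_le_N.
apply: (@reaches_weaken _ _ _ _ (5 + (K * 6).+1).+1 _ _ (I K)).
- move=> s' [h1 h2 h3]; split=> // p pM; have [-> _ _] := h3 p pM.
  by rewrite (minn_idPr (ltnW (qK p))).
- by have := K_le_l; rewrite -/(pow2 k); lia.
apply: (reaches_seq (Q := I 0%N)).
  apply: reaches_straight => //; split=> //=; first by do !apply: same_regs_upd.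
  move=> p pM; rewrite /upd /= !evalE /= !evalE (env4 (he p pM)) (env6 (he p pM)) word_const //.
  rewrite modz_nat min0n !subn0 wordN //; apply: leq_trans KN; exact: ltnW (qK p).
move=> s1 I0; apply: (triple_while (M := fun=> M)) I0.
- move=> u s2 p uK [_ _ h] pM; have [_ _ h13] := h p pM.
  by rewrite evalE /= !evalE h13 word_bool (word_const (z := 0)) // ltz_nat subn_gt0 uK.
- move=> s2 p [_ _ h] pM; have [_ _ h13] := h p pM.
  by rewrite evalE /= !evalE h13 word_bool subnn (word_const (z := 0)).
move=> u uK; apply: triple_straight => // s2 [m2 rs2 h].
split=> //=; first by do !apply: same_regs_upd.
move=> p pM; have [h11 h12 h13] := h p pM; have qq := qK p.
rewrite /upd /= !evalE /= !evalE h11 h12 h13 !(word_const (z := 0)) // ltz_nat subn_gt0.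
have small m : (m <= q p)%N -> (2 ^ m <= N)%N.
  move=> mq; rewrite /pow2 leq_exp2l //; apply: leq_trans mq _.
  exact: leq_trans (ltnW qq) K_le_l.
split.
- have -> : (2 ^ minn u (q p))%N%:Z * (1 + (if (u < q p)%N then 1 else 0))
     = (2 ^ minn u.+1 (q p))%N%:Z.
    case: ifP => uq.
      by rewrite (minn_idPl (ltnW uq)) (minn_idPl uq) expnS PoszM mulrC.
    have qu : (q p <= u)%N by rewrite leqNgt uq.
    by rewrite (minn_idPr qu) (minn_idPr (leqW qu)) addr0 mulr1.
  by rewrite wordN // small // geq_minr.
- have -> : (q p - u)%N%:Z - (if (u < q p)%N then 1 else 0) = (q p - u.+1)%N%:Z.
    by case: ifP => uq; lia.
  by rewrite wordN // (leq_trans (leq_subr _ _)) // (leq_trans (ltnW qq)).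
have -> : (K - u)%N%:Z - 1 = (K - u.+1)%N%:Z by lia.
by rewrite wordN // (leq_trans (leq_subr _ _)).
Qed.

End Run.

(** * Activation of the processors and the complete run *)

Section Setup.

Variables (n l k b : nat).
Hypothesis (ok : admissible n l k b).
Hypotheses (l_gt0 : (0 < l)%N) (l_min : (2 ^ l.-1 <= n)%N).
Hypothesis (k_log : (2 ^ k <= l < 2 ^ k.+1)%N).

Local Notation N := (pow2 l).
Local Notation K := (pow2 k).
Local Notation M := (pow2 (3 * l)).
Local Notation env := (env n l k).

(** Until the digits are extracted, processors differ in their number alone, so the guards of the
    activation loop agree. *)
Definition uniform (m : nat) (v : nat -> int) (rg : nat -> nat -> int) : Prop :=
  forall p, (p < m)%N -> rg p 1%N = p%:Z /\ forall i, i <> 1%N -> rg p i = v i.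

Lemma fork_spec m v s : uniform m v s.1 -> (m.*2 <= M)%N ->
  reaches b m fork_prog s 3 m.*2 (fun s' => s'.2 = s.2 /\ uniform m.*2 v s'.1).
Proof.
move=> hu mM.
have small p : (p < m)%N -> (p.*2.+1 <= 2 * M)%N.
  by move=> pm; apply: (@leq_trans m.*2); [lia | apply: leq_trans mM _; rewrite leq_pmull].
pose s1 : state := (fun p => upd (s.1 p) 1 (eval_expr b (s.1 p) (EConst 2 * $1)%prog), s.2).
have r1 p : (p < m)%N -> s1.1 p 1%N = p.*2%:Z.
  move=> pm; have [e _] := hu p pm.
  rewrite /s1 /= /upd /= evalE /= e -mul2n PoszM (wordM ok (m := 2 * p)) //.
  by have := small p pm; rewrite -mul2n; lia.
have ro p i : (p < m)%N -> i <> 1%N -> s1.1 p i = v i.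
  move=> pm i1; have [_ ev] := hu p pm.
  by rewrite /s1 /= /upd (_ : (i == 1%N) = false) ?ev //; apply/eqP.
have ms : s1.2 = s.2 by [].
have e1 : executes b m (CAssign 1 (EConst 2 * $1)%prog) s 1 m s1.
  exact: executes_straight.
clearbody s1.
have e2 := @executes_fork b m 1 ($1 + EConst 1)%prog s1.
exists 3%N; eexists; split; [by [] | | exact: executes_seq e1 e2].
split=> //= p pm; have hp : (p./2 < m)%N by lia.
have rp := r1 _ hp; split.
  case: ifP => op; last first.
    by rewrite rp; congr Posz; have := odd_double_half p; rewrite op; lia.
  rewrite /upd /= evalE /= rp -PoszD (wordM ok); last by rewrite addn1 small.
  by congr Posz; have := odd_double_half p; rewrite op; lia.
move=> i i1; have ni : (i == 1%N) = false by apply/eqP.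
by case: ifP => _; rewrite /upd ?ni ro.
Qed.

Definition fork_regs (u i : nat) : int :=
  if i == 0%N then n%:Z else if i == 5%N then (2 ^ u)%N%:Z
  else if i == 8%N then u%:Z else 0.

Lemma l_le_N : (l <= N)%N. Proof. by rewrite /pow2 ltnW // ltn_expl. Qed.

Lemma setup_spec s :
  (forall i, s.1 0%N i = if i == 0%N then n%:Z else 0) ->
  reaches b 1 setup_prog s (30 * l + 40) M (fun s' =>
    [/\ env s'.1, forall j, (j < N)%N -> s'.2 (n * n + n + j)%N%:Z = (j < n)%N%:Z
      & forall x, (x < n * n)%N -> s'.2 x%:Z = s.2 x%:Z]).
Proof.
move=> h0.
have nN := n_lt_N ok.
apply: (@reaches_weaken _ _ _ _ (1 + ((l * 17.+1).+1 + (1 + ((k * 1.+1).+1 + (5 + 1).+1).+1).+1).+1).+1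
  _ _ _ _ (fun s' hh => hh)).
  have : (k < l)%N by apply: leq_trans (ltn_expl k (ltnSn 1)) _; case/andP: k_log.
  lia.
pose I u (s' : state) := s'.2 = s.2 /\ uniform (2 ^ (3 * u)) (fork_regs u) s'.1.
apply: (reaches_seq (Q := I 0%N)).
  apply: reaches_straight => //; split=> //= p; rewrite ltnS leqn0 => /eqP ->.
  split; first by rewrite /upd /= h0.
  move=> i i1; rewrite /upd /fork_regs h0; case: eqP => [-> | i5] /=.
    by rewrite evalE (word_const ok).
  by case: (i == 8%N).
move=> s1 I0; apply: (reaches_seq (Q := I l)).
  apply: (triple_while (M := fun u => 2 ^ (3 * u))%N) I0.
  - move=> u s2 p ul [_ hu] pM; have [_ hv] := hu p pM.
    rewrite evalE /= !evalE /= !hv // /fork_regs /= (word_bool ok) -PoszD.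
    rewrite (wordN ok) ?addn1 // ltz_nat ltnS ifT //.
    by apply: leq_trans l_min; rewrite leq_exp2l //; lia.
  - move=> s2 p [_ hu] pM; have [_ hv] := hu p pM.
    rewrite evalE /= !evalE /= !hv // /fork_regs /= (word_bool ok) -PoszD.
    rewrite (wordN ok) ?addn1 // ltz_nat ltnS ifF //.
    by apply/negbTE; rewrite -ltnNge.
  move=> u ul s2 [m2 hu].
  have bnd e : (e <= 3 * l)%N -> (2 ^ e <= M)%N by move=> h; rewrite /pow2 leq_exp2l.
  apply: (@reaches_weaken _ _ _ _ (3 + (3 + (3 + 3).+1).+1).+1 _ _ _ _ (fun s' hh => hh)) => //.
  apply: (reaches_seq (Q := fun s3 => s3.2 = s.2 /\ uniform (2 ^ (3 * u)) (fork_regs u.+1) s3.1)).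
    apply: reaches_straight => //; split=> //= p pM; have [hp hv] := hu p pM.
    split; first by rewrite /upd /= hp.
    move=> i i1; rewrite /upd /= !evalE /= !hv // /fork_regs /=.
    case: eqP => [-> | i8] /=.
      rewrite -PoszD addn1 (wordN ok) //; exact: leq_trans ul l_le_N.
    case: eqP => [-> | i5] //=.
    rewrite -[2 * _]/(2%N%:Z * _) -PoszM -expnS (wordN ok) // /pow2 leq_exp2l //.
  move=> s3 [m3 u3].
  have e1 : (2 ^ (3 * u).+1 = (2 ^ (3 * u)).*2)%N by rewrite expnS mul2n.
  have e2 : (2 ^ (3 * u).+2 = (2 ^ (3 * u)).*2.*2)%N by rewrite !expnS !mul2n.
  have e3 : (2 ^ (3 * u.+1) = (2 ^ (3 * u)).*2.*2.*2)%N.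
    by rewrite (_ : 3 * u.+1 = (3 * u).+3)%N; [rewrite !expnS !mul2n | lia].
  rewrite e3; apply: reaches_seq; first by apply: (fork_spec u3); rewrite -e1 bnd //; lia.
  move=> s4 [m4 u4]; apply: reaches_seq; first by apply: (fork_spec u4); rewrite -e2 bnd //; lia.
  move=> s5 [m5 u5]; apply: reaches_weaken (fork_spec u5 _) => //; last by rewrite -e3 bnd //; lia.
  by move=> s6 [m6 u6]; split; [rewrite m6 m5 m4 m3 | rewrite /I e3].
move=> s2 [m2 hu2].
pose J u (s' : state) := [/\ s'.2 = s.2, forall p, (p < M)%N -> s'.1 p 6%N = (2 ^ u)%N%:Z
  & forall p, (p < M)%N -> s'.1 p 1%N = p%:Z /\
      forall i, i <> 1%N -> i <> 6%N -> s'.1 p i = fork_regs l i].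
have KN := K_le_N ok.
apply: (reaches_seq (Q := J 0%N)).
  apply: reaches_straight => //; split=> //=.
    by move=> p pM; rewrite /upd /= evalE (word_const ok).
  move=> p pM; have [hp hv] := hu2 p pM; split; first by rewrite /upd /= hp.
  by move=> i i1 /eqP/negbTE i6; rewrite /upd i6 hv.
move=> s3 J0; apply: (reaches_seq (Q := J k)).
  have cond u s4 p : (u <= k)%N -> J u s4 -> (p < M)%N ->
      eval_expr b (s4.1 p) (EConst 2 * $6 < $8 + EConst 1)%prog
      = if (2 ^ u.+1 < l + 1)%N then 1 else 0.
    move=> uk [_ h6 h] pM; have [_ hv] := h p pM.
    rewrite evalE /= !evalE /= h6 // hv // /fork_regs /= (word_bool ok).
    rewrite -[2 * _]/(2%N%:Z * _) -PoszM -PoszD -expnS.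
    have h2 : (2 ^ u.+1 <= 2 * M)%N.
      rewrite expnS leq_pmul2l //; apply: leq_trans (N_le_M l); apply: leq_trans KN.
      by rewrite /pow2 leq_exp2l.
    rewrite (wordM ok h2) (wordM ok) //.
    by apply: leq_trans (leq_add (leq_trans l_le_N (N_le_M l)) (pow2_gt0 (3 * l))) _; rewrite mul2n -addnn.
  apply: (triple_while (M := fun=> M)) J0.
  - move=> u s4 p uk Ju pM; rewrite (cond u) ?(ltnW uk) // ifT // addn1 ltnS.
    by case/andP: k_log => h _; apply: leq_trans h; rewrite leq_exp2l.
  - move=> s4 p Ju pM; rewrite (cond k) // ifF // addn1 ltnS.
    by apply/negbTE; rewrite -ltnNge; case/andP: k_log.
  move=> u uk; apply: triple_straight => // s4 [m4 h6 h]; split=> //=.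
    move=> p pM; rewrite /upd /= evalE /= h6 // -[2 * _]/(2%N%:Z * _) -PoszM -expnS.
    by rewrite (wordN ok) //; apply: leq_trans KN; rewrite /pow2 leq_exp2l.
  move=> p pM; have [hp hv] := h p pM; split; first by rewrite /upd /= hp.
  by move=> i i1 i6; rewrite /upd /=; case: eqP => // _; rewrite hv.
move=> s4 [m4 h6 h].
have word_div p d : (p < M)%N -> to_word b (p %/ d)%N%:Z = (p %/ d)%N%:Z.
  move=> pM; rewrite (wordM ok) //; apply: leq_trans (leq_div _ _) (leq_trans (ltnW pM) _).
  by rewrite leq_pmull.
apply: (reaches_seq (Q := fun s5 => s5.2 = s.2 /\ env s5.1)).
  apply: reaches_straight => //; split=> //= p pM; have [hp hv] := h p pM.
  have h5 : s4.1 p 5%N = N%:Z by rewrite hv.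
  have small : (N * N <= 2 * M)%N by apply: leq_trans (NN_le_M l) _; rewrite leq_pmull.
  split; rewrite /upd /= ?evalE /= ?evalE /= ?evalE /= ?evalE /= ?evalE /= ?hp ?h5 ?h6 // ?hv //.
  - by rewrite -PoszM (wordM ok small) divz_nat word_div.
  - rewrite divz_nat word_div // modz_nat (wordN ok) //; exact: ltnW (I_lt l p).
  - by rewrite modz_nat (wordN ok) //; exact: ltnW (J_lt l p).
move=> s5 [m5 he]; rewrite -m5.
have adr p : (p < M)%N -> eval_expr b (s5.1 p) ($0 * $0 + $0 + $4)%prog = (n * n + n + J_ l p)%N%:Z.
  move=> pM; rewrite evalE /= (env0 (he p pM)) (env4 (he p pM)).
  by rewrite -!PoszM -!PoszD (wordM ok) ?(offset_small ok) ?J_lt.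
have val p : (p < M)%N -> eval_expr b (s5.1 p) ($4 < $0)%prog = (J_ l p < n)%N%:Z.
  move=> pM; rewrite evalE /= !evalE (env0 (he p pM)) (env4 (he p pM)) (word_bool ok) ltz_nat.
  by case: ifP.
set fa := fun p => eval_expr b (s5.1 p) ($0 * $0 + $0 + $4)%prog.
set fv := fun p => eval_expr b (s5.1 p) ($4 < $0)%prog.
apply: reaches_straight => //; split=> //=.
  move=> j jN; have qM := idx_lt (N_gt0 l) (N_gt0 l) jN.
  case: (write_all_cases M fa fv s5.2 (n * n + n + j)%N%:Z) => [[p pM [ep ->]]|[hh _]].
    by rewrite /fv val //; move: ep; rewrite /fa adr // => -[] /addnI ->.
  by case: (hh _ qM); rewrite /fa adr // J_idx.
by move=> x xn; apply: write_all_miss => p pM; rewrite adr // => -[]; lia.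
Qed.

End Setup.

Lemma word_total_abs n l k b A (Y : nat -> int) : admissible n l k b ->
  (forall i j, (i < n)%N -> (j < n)%N -> `|A i j| <= 1) -> (forall j, `|Y j| <= 1) ->
  to_word b (- total_abs l (padded n A) Y) = - total_abs l (padded n A) Y.
Proof.
move=> ok hA hY; apply: (word_int ok); rewrite normrN /total_abs.
rewrite ger0_norm; last by apply: sumr_ge0.
apply: (@le_lt_trans _ _ (pow2 l * pow2 l)%N%:Z).
  apply: (@le_trans _ _ (\sum_(i < 2 ^ l) (pow2 l)%:Z)).
    by apply: ler_sum => i _; apply: row_sum_bound.
  by rewrite sumr_const card_ord -mulr_natl natz PoszM.
rewrite ltz_nat; have := word_boundM ok; have := NN_le_M l.
by move: (pow2 l * pow2 l)%N (pow2 (3 * l)) (pow2 b.-1) => u v w; lia.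
Qed.

Definition run_time (l : nat) : nat := (90 * l * l + 300 * l + 200)%N.

Lemma main_spec n l k b (s : state) :
  admissible n l k b -> (0 < l)%N -> (2 ^ l.-1 <= n)%N -> (2 ^ k <= l < 2 ^ k.+1)%N ->
  (forall i, s.1 0%N i = if i == 0%N then n%:Z else 0) ->
  let A i j := s.2 (i * n + j)%N%:Z in
  (forall i j, (i < n)%N -> (j < n)%N -> A i j = 1 \/ A i j = -1) ->
  reaches b 1 main_prog s (run_time l) (pow2 (3 * l)) (fun s' =>
    exists y a, let z := signed l (digit k) y a in
      [/\ is_signing n z, signs_ok n l z s'.2,
        forall i, (i < n)%N -> s'.2 (n * n + i)%N%:Z =
          if row_sum l (padded n A i) z < 0 then -1 else 1,
        total_potential l k n k (padded n A) y
          <= total_potential l k n l (padded n A) (fun j => (j < n)%N%:Z)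
        & minimizer l (fun a => - total_abs l (padded n A) (signed l (digit k) y a)) a]).
Proof.
move=> ok l0 lmin klog hs A hA.
have A1 i j : (i < n)%N -> (j < n)%N -> `|A i j| <= 1.
  by move=> ni nj; case: (hA i j ni nj) => ->.
have kl : (2 ^ k <= l)%N by case/andP: klog.
apply: (@reaches_weaken _ _ _ _ ((30 * l + 40) + ((l * (90 * l + 120) + 10) +
   ((10 * l + 10) + ((10 * l + 50 + (40 * l + 20)) + 5).+1).+1).+1).+1 _ _ _ _ (fun s' hh => hh)).
  by rewrite /run_time; lia.
apply: reaches_seq; first exact: (setup_spec ok l0 lmin klog hs).
move=> s1 [he1 hy1 hA1].
pose y0 j := (j < n)%N%:Z.
have sy0 : is_signing n y0.
  by split=> j jn; rewrite /y0; [rewrite ltnNge jn | left; rewrite jn].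
have in1 : input_ok n A s1.2.
  by move=> i j ni nj; rewrite hA1 //; nia.
apply: reaches_seq; first exact: (merge_spec ok A1 he1 in1 hy1 sy0).
move=> s2 [he2 in2 [y [hy2 sy hpot]]].
apply: reaches_seq; first exact: (digit_spec ok kl he2).
move=> s3 [m3 rs3 r3]; have he3 : env n l k s3.1 by apply: (env_same _ rs3 he2).
rewrite -m3 in in2 hy2.
pose c a := - total_abs l (padded n A) (signed l (digit k) y a).
pose E (m : int -> int) := forall a i, (a < pow2 l)%N -> (i < pow2 l)%N ->
   m (cell 1 (idx l a i 0)) = row_sum l (padded n A i) (signed l (digit k) y a).
have yb := signing_bound sy.
have sb a j : `|signed l (digit k) y a j| <= 1 by apply: signed_bound.
apply: reaches_seq.
  apply: (select_spec ok (c := c) (E := E) he3 in2 hy2 sy.1 yb _ r3).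
    by move=> j; apply: (digit_lt kl).
  move=> s4 he4 rs4 h1.
  apply: reaches_weaken (total_abs_spec ok he4 A1 sb h1) => // s5 [rs5 o5 w5 e5].
  by split=> // a aN; rewrite w5 // (word_total_abs ok A1 (sb a)).
move=> s4 [rs4 in4 [m Em hm] [a [amin h14 hy4]]].
have he4 : env n l k s4.1 by apply: (env_same _ rs4 he3).
have hz i : (i < pow2 l)%N -> s4.2 (cell 1 (idx l a i 0))
    = row_sum l (padded n A i) (signed l (digit k) y a).
  by move=> iN; rewrite hm Em //; case: amin.
have H := output_spec ok he4 amin.1 hy4 h14 hz.
apply: reaches_weaken H => // s5 [hy5 hx5].
exists y, a; split=> //.
exact: signing_signed.
Qed.

Lemma input_memE (n : nat) (A : 'M[int]_n) (i j : 'I_n) :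
  input_mem A (i * n + j)%N%:Z = A i j.
Proof.
rewrite /input_mem (bigD1 i) //= (bigD1 j) //= eqxx big1 => [|j' /negbTE j'j].
  rewrite addr0 big1 ?addr0 // => i' /negbTE i'i; rewrite big1 // => j' _.
  case: eqP => // -[] e; move: i'i; rewrite (_ : i' = i) ?eqxx //; apply: val_inj => /=.
  have n0 : (0 < n)%N by apply: leq_ltn_trans (ltn_ord i).
  have := congr1 (divn^~ n) e.
  by rewrite !divnMDl // !divn_small ?ltn_ord // !addn0 => ->.
case: eqP => // -[] /addnI e; move: j'j; rewrite (_ : j' = j) ?eqxx //.
exact/val_inj.
Qed.

(** * Choice of parameters, growth rates and conclusion *)

Definition log_side (n : nat) : nat := (trunc_log 2 n).+1.

(** The largest [k] with [2 ^ k <= l]: a seed has a bit for every class, and yet [2 ^ k > l / 2]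
    tends to infinity. *)
Definition log_classes (n : nat) : nat := trunc_log 2 (log_side n).

Lemma log_classes_bounds n : (0 < n)%N ->
  [/\ (2 ^ (log_side n).-1 <= n)%N, (n < 2 ^ log_side n)%N,
    (2 ^ log_classes n <= log_side n < 2 ^ (log_classes n).+1)%N & (log_side n <= n)%N].
Proof.
move=> n0; have h1 := trunc_logP (isT : (1 < 2)%N) n0; have h2 := trunc_log_ltn n (isT : (1 < 2)%N).
split=> //.
  rewrite /log_classes trunc_log_ltn // andbT; exact: trunc_logP.
by apply: leq_trans h1; rewrite /log_side; exact: ltn_expl.
Qed.

Lemma admissible_word n : (0 < n)%N ->
  admissible n (log_side n) (log_classes n) (word_size 9 n).
Proof.
move=> n0; have [h1 h2 /andP[h3 _] _] := log_classes_bounds n0; split=> //.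
  by apply: leq_trans h3; apply/ltnW/ltn_expl.
rewrite (_ : 512 = 2 ^ 9)%N // -expnD leq_exp2l // /word_size /log_side; lia.
Qed.

Lemma log_classes_large m n : (2 ^ (2 * m) <= n)%N -> (m <= 2 ^ log_classes n)%N.
Proof.
move=> h; have n0 : (0 < n)%N by apply: leq_trans h; rewrite expn_gt0.
have [_ _ /andP[_ h3] _] := log_classes_bounds n0.
have : (2 * m <= trunc_log 2 n)%N by rewrite -(trunc_expnK (2 * m) (isT : (1 < 2)%N)); exact: leq_trunc_log.
by move: h3; rewrite /log_side expnS; lia.
Qed.

Local Open Scope classical_set_scope.

Definition value_loss (R : realType) (n : nat) : R :=
  10 / Num.sqrt (Num.sqrt (Num.sqrt (2 ^ log_classes n)%:R)).

Lemma value_loss_cvg (R : realType) : value_loss R @ \oo --> (0 : R).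
Proof.
apply/cvgrPdist_le => e e0.
have [m hm] : exists m : nat, (10 / e) ^+ 8 <= m%:R.
  exists (Num.bound ((10 / e) ^+ 8)); apply/ltW/archi_boundP.
  by rewrite exprn_ge0 // divr_ge0 // ltW.
exists (2 ^ (2 * m))%N => // n /= hn.
have mK := log_classes_large hn.
rewrite sub0r normrN /value_loss.
set q := Num.sqrt _.
have q8 : q ^+ 8 = (2 ^ log_classes n)%:R :> R.
  by rewrite (exprM _ 2 4) sqr_sqrtr // (exprM _ 2 2) sqr_sqrtr // sqr_sqrtr.
have qe : 10 / e <= q.
  rewrite -(@ler_pXn2r _ 8) ?nnegrE ?sqrtr_ge0 //; last by rewrite divr_ge0 // ltW.
  by rewrite q8 (le_trans hm) // ler_nat.
have q0 : 0 < q by apply: lt_le_trans qe; rewrite divr_gt0.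
rewrite ger0_norm; last by rewrite divr_ge0 // ltW.
by rewrite ler_pdivrMr // mulrC -ler_pdivrMr.
Qed.

(** The side of the processor cube is at most [2 n], hence the factor 8; the exponent 0 means that
    no logarithm is spent. *)
Lemma processors_soft_O (R : realType) :
  @soft_O R (fun n => 2 ^ (3 * log_side n))%N (fun n : nat => (n%:R : R) `^ (7%:R / 2%:R)).
Proof.
exists 8%N, 0%N => n n0; rewrite expr0 mulr1.
have [h1 _ _ _] := log_classes_bounds n0.
have n1 : 1 <= n%:R :> R by rewrite ler1n.
have h3 : (2 ^ (3 * log_side n) <= 8 * n ^ 3)%N.
  rewrite mulnC expnM (_ : 2 ^ log_side n = 2 * 2 ^ (log_side n).-1)%N; last by rewrite -expnS.
  by rewrite expnMn leq_mul2l /= leq_exp2r.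
have h4 : n%:R ^+ 3 <= (n%:R : R) `^ (7%:R / 2%:R).
  by rewrite -powR_mulrn ?ler0n // ler_powR //; lra.
apply: (@le_trans _ _ (8 * n ^ 3)%N%:R); first by rewrite ler_nat.
by rewrite natrM natrX mulrC ler_wpM2r.
Qed.

Lemma run_time_polylogarithmic : polylogarithmic (fun n => run_time (log_side n)).
Proof. by exists 600%N, 2%N => n _; rewrite /run_time /log_side; lia. Qed.

Lemma powR_three_halves (R : realType) (n : nat) :
  (n%:R : R) `^ (3%:R / 2%:R) = n%:R * Num.sqrt n%:R.
Proof.
have [->|n0] := posnP n; first by rewrite powR0 ?mul0r //; apply: lt0r_neq0; lra.
rewrite (_ : 3%:R / 2%:R = 1 + 2^-1); last by field.
rewrite powRD; last by apply/implyP => _; rewrite pnatr_eq0 -lt0n.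
by rewrite powRr1 ?ler0n // powR12_sqrt ?ler0n.
Qed.

Lemma bilinear_signs n l (A : 'M[int]_n) (B : nat -> nat -> int) (x y : 'cV[int]_n) (z : nat -> int) :
  (n <= 2 ^ l)%N -> (forall i j : 'I_n, B i j = A i j) ->
  (forall j : 'I_n, y j 0 = z j) -> (forall j, (n <= j)%N -> z j = 0) ->
  (forall i : 'I_n, x i 0 = if row_sum l (padded n B i) z < 0 then -1 else 1) ->
  bilinear_value A x y = total_abs l (padded n B) z.
Proof.
move=> nl hB hy hz hx.
have rE i : row_sum l (padded n B i) z = \sum_(j < n) padded n B i j * z j.
  apply: (sum_rows_zero (F := fun j => padded n B i j * z j) nl) => j nj.
  by rewrite hz // mulr0.
rewrite /bilinear_value /total_abs.
rewrite (sum_rows_zero (F := fun i => `|row_sum l (padded n B i) z|) nl).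
  apply: eq_bigr => i _; transitivity (x i 0 * row_sum l (padded n B i) z).
    rewrite rE mulr_sumr; apply: eq_bigr => j _.
    by rewrite hy /padded !ltn_ord /= hB; ring.
  by rewrite hx; case: ltP => h; [rewrite ltr0_norm // mulN1r | rewrite ger0_norm // mul1r].
move=> i ni; rewrite rE big1 ?normr0 // => j _.
by rewrite /padded ltnNge ni mul0r.
Qed.

Theorem mainTheorem13 (R : realType) :
  exists (prog : cmd) (c : nat) (P T : nat -> nat) (eps : nat -> R),
    [/\ soft_O P (fun n : nat => (n%:R : R) `^ (7%:R / 2%:R)),
        polylogarithmic T,
        eps @ \oo --> (0 : R)
      & forall (n : nat) (A : 'M[int]_n), (0 < n)%N -> pm1_matrix A ->
        let s := run (word_size c n) (T n) (init prog A) in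
        let x := output_x n s in
        let y := output_y n s in
        [/\ halted s,
            (nprocs s <= P n)%N,
            pm1_matrix x,
            pm1_matrix y
          & (Num.sqrt (2%:R / pi) - eps n) * (n%:R : R) `^ (3%:R / 2%:R)
              <= (bilinear_value A x y)%:~R]].
Proof.
exists main_prog, 9%N, (fun n => 2 ^ (3 * log_side n))%N, (fun n => run_time (log_side n)), (value_loss R).
split; [exact: processors_soft_O | exact: run_time_polylogarithmic | exact: value_loss_cvg |].
move=> n A n0 hA.
have [lmin nl klog ln] := log_classes_bounds n0.
have ok := admissible_word n0.
set l := log_side n in lmin nl klog ln ok *; set k := log_classes n in klog ok *.
pose s0 : state := ((fun (_ i : nat) => if i == 0%N then n%:Z else 0), input_mem A).
pose B i j := s0.2 (i * n + j)%N%:Z.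
have BE (i j : 'I_n) : B i j = A i j by exact: input_memE.
have hB i j : (i < n)%N -> (j < n)%N -> B i j = 1 \/ B i j = -1.
  by move=> ni nj; rewrite (BE (Ordinal ni) (Ordinal nj)).
have [t [s [tT [y [a [sz yz xz hpot amin]]] ex]]] :=
  @main_spec n l k (word_size 9 n) s0 ok isT lmin klog (fun=> erefl) hB.
set z := signed l (digit k) y a in sz yz xz.
have -> : run (word_size 9 n) (run_time l) (init main_prog A)
   = lockstep (pow2 (3 * l)) [::] s.1 s.2.
  (* The run may halt before the allotted time; halted processors then idle. *)
  rewrite -(subnKC tT) runD.
  have -> : init main_prog A = lockstep 1 [:: main_prog] s0.1 s0.2 by [].
  by rewrite ex run_halted.
set sf := lockstep _ _ _ _.
have xE i : output_x n sf i 0 = if row_sum l (padded n B i) z < 0 then -1 else 1.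
  by rewrite mxE /= xz.
have yE j : output_y n sf j 0 = z j.
  rewrite mxE /= yz //; exact: ltn_trans (ltn_ord j) nl.
move=> s' x y'; split.
- exact: lockstep_halted.
- by rewrite /nprocs /= size_map size_iota.
- by move=> i j; rewrite ord1 xE; case: ifP; [right | left].
- by move=> i j; rewrite ord1 yE; apply: sz.2.
rewrite (@bilinear_signs n l A B x y' z (ltnW nl) BE yE sz.1 xE) powR_three_halves.
rewrite /value_loss -/k.
have H := @signed_value R n l k (padded n B) y (fun j => (j < n)%N%:Z) a _ (ltnW nl) _ _ _ _ hpot amin.
apply: H => //.
- by case/andP: klog => h _; apply: leq_trans h ln.
- by case/andP: klog.
- move=> i j ni nj; rewrite /padded ni nj /=.
  by case: (hB i j ni nj) => ->.
- by move=> i j ni; rewrite /padded ltnNge ni.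
Qed.
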